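(* With $\mathcal{M}$, $d$, $\sigma_*$, $\kappa_*$, $\sigma$, $\bar x$, $\delta$ and $\mathcal{D}$ as in the context, the set $\lambda^{-1}(\mathcal{D})=\{X\in\mathbf{S}^n:\lambda(X)\in\mathcal{D}\}$ is an analytic submanifold of $\mathbf{S}^n$ around any $\bar X\in\mathbf{S}^n$ with $\lambda(\bar X)=\bar x$, of dimension $$\frac{n(n+1)}{2}+d+n^{\mathrm{red}}-\kappa_*-\sum_{I\in P(\sigma_* ),\,|I|\ge2}\frac{|I|(|I|+1)}{2},$$ where $n^{\mathrm{red}}=\dim N^{\mathrm{red}}_{\mathcal{M}}(\bar x)$.
   Context: $\mathbf{S}^n$ real symmetric matrices; $\lambda(X)$ nonincreasingly ordered eigenvalues. $\Sigma^n$ permutations of $\mathbb{N}_n$ acting by $(\sigma x)_i=x_{\sigma^{-1}(i)}$; $P(\sigma)$ orbit partition; $P(x)$ partition by equal coordinates; $\Delta(\sigma)=\{x:P(x)=P(\sigma)\}$; $\Delta(\sigma)^{\perp\perp}=\{x:x_i=x_j$ whenever $i,j$ in same set of $P(\sigma)\}$; $\mathbb{R}^n_\ge=\{x:x_1\ge\cdots\ge x_n\}$; $B$ open ball. A set $S$ is locally symmetric if $S\cap\mathbb{R}^n_\ge\ne\emptyset$ and each $x\in S$ has $\delta>0$ with $\sigma(S\cap B(x,\delta))=S\cap B(x,\delta)$ for all $y\in S\cap B(x,\delta)$, $\sigma y=y$; strongly locally symmetric: $\sigma S=S$ for all $y\in S$, $\sigma y=y$. $\mathcal{M}$ is a locally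 symmetric $C^2$ submanifold (connected, without boundary) of dimension $d$, with characteristic permutation $\sigma_*$ (i.e. $\mathcal{M}\cap B(y,\rho)\subset\Delta(\sigma_* )$ for some $y\in\mathcal{M}$, $\rho>0$), $\kappa_*=|\mathbb{N}_n\setminus\mathrm{supp}(\sigma_* )|$. For $x\in\mathbb{R}^n$, $x^F\in\mathbb{R}^{\kappa_*}$ collects coordinates with indices outside $\mathrm{supp}(\sigma_* )$, $x^M$ the rest, and $\otimes$ is the inverse reassembling. Fix $\bar x\in\mathcal{M}\cap\Delta(\sigma)$ and $\delta>0$ such that $B(\bar x,\delta)$ meets only strata $\Delta(\sigma')$ with $P(\sigma')$ refining $P(\sigma)$, $\mathcal{M}\cap B(\bar x,\delta)$ is strongly locally symmetric, and the orthogonal projection onto $\bar x+T_{\mathcal{M}}(\bar x)$ restricted to $\mathcal{M}\cap B(\bar x,\delta)$ is a diffeomorphism onto its image. Let $N^{\mathrm{red}}_{\mathcal{M}}(\bar x)=N_{\mathcal{M}}(\bar x)\cap\Delta(\sigma)^{\perp\perp}$, choose $\delta_1,\delta_2>0$ with $\mathcal{B}:=B(\bar x^F,\delta_1)\otimes B(\bar x^M,\delta_2)\subset B(\bar x,\delta)$ and let $\mathcal{D}=(\bar x+T_{\mathcal{M}}(\bar x)\oplus N^{\mathrm{red}}_{\mathcal{M}}(\bar x))\cap\mathcal{B}$. *)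

(* Defs.v *)
From HB Require Import structures.
From mathcomp Require Import all_boot all_order all_algebra all_fingroup.
From mathcomp Require Import all_classical all_reals all_analysis.
Set Implicit Arguments. Unset Strict Implicit. Unset Printing Implicit Defensive.
Import Order.TTheory GRing.Theory Num.Theory.
Import numFieldNormedType.Exports.
Local Open Scope classical_set_scope.
Local Open Scope ring_scope.

Section Defs.
Variable R : realType.

Definition dotv n (x y : 'rV[R]_n) : R := \sum_i x 0 i * y 0 i.

Definition eball n (x : 'rV[R]_n) (r : R) : set 'rV[R]_n :=
  [set y | \sum_i (y 0 i - x 0 i) ^+ 2 < r ^+ 2].

Definition prodball n (sstar : 'S_n) (x : 'rV[R]_n) (r1 r2 : R) : set 'rV[R]_n :=
  [set y | \sum_(i | sstar i == i) (y 0 i - x 0 i) ^+ 2 < r1 ^+ 2 /\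
           \sum_(i | sstar i != i) (y 0 i - x 0 i) ^+ 2 < r2 ^+ 2].

Definition perm_act n (s : 'S_n) (x : 'rV[R]_n) : 'rV[R]_n := \row_i x 0 ((s^-1)%g i).

(* Delta(sigma) = {x : P(x) = P(sigma)} *)
Definition Delta n (s : 'S_n) : set 'rV[R]_n :=
  [set x | forall i j, x 0 i = x 0 j <-> j \in porbit s i].

Definition Deltapp n (s : 'S_n) : set 'rV[R]_n :=
  [set x | forall i j, j \in porbit s i -> x 0 i = x 0 j].

Definition Rge (n : nat) : set 'rV[R]_n :=
  [set x | forall i j : 'I_n, (i <= j)%N -> x 0 j <= x 0 i].

Definition locally_symmetric n (S : set 'rV[R]_n) : Prop :=
  (S `&` @Rge n !=set0) /\
  forall x, S x -> exists2 delta : R, 0 < delta &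
    forall (y : 'rV[R]_n) (s : 'S_n), (S `&` eball x delta) y -> perm_act s y = y ->
      perm_act s @` (S `&` eball x delta) = S `&` eball x delta.

Definition strongly_locally_symmetric n (S : set 'rV[R]_n) : Prop :=
  forall (y : 'rV[R]_n) (s : 'S_n), S y -> perm_act s y = y -> perm_act s @` S = S.

Definition C1on (V W : normedModType R) (U : set V) (f : V -> W) : Prop :=
  forall v : V, (forall y, U y -> derivable f y v) /\
                {within U, continuous (fun y => derive f y v)}.

Definition C2on (V W : normedModType R) (U : set V) (f : V -> W) : Prop :=
  C1on U f /\ forall v : V, C1on U (fun y => derive f y v).

(* M is a C^2 embedded submanifold (without boundary) of R^n of dimension d:
   locally the regular zero set of a C^2 map R^n -> R^(n-d). *)
Definition C2_submanifold n (M : set 'rV[R]_n) (d : nat) : Prop :=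
  (d <= n)%N /\
  forall x, M x -> exists (U : set 'rV[R]_n) (F : 'rV[R]_n -> 'rV[R]_(n - d)),
    [/\ open U, U x, C2on U F,
        (forall w, exists v, derive F x v = w) &
        M `&` U = [set y | U y /\ F y = 0]].

Definition mfd_tangent n (M : set 'rV[R]_n) (x : 'rV[R]_n) : set 'rV[R]_n :=
  [set v | exists g : R -> 'rV[R]_n,
     [/\ g 0 = x, (exists2 e : R, 0 < e & forall t : R, `|t| < e -> M (g t)),
         derivable g 0 1 & derive g 0 1 = v]].

Definition mfd_normal n (M : set 'rV[R]_n) (x : 'rV[R]_n) : set 'rV[R]_n :=
  [set w | forall v, mfd_tangent M x v -> dotv w v = 0].

Definition is_orth_proj n (T : set 'rV[R]_n) (x y z : 'rV[R]_n) : Prop :=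
  T (z - x) /\ forall v, T v -> dotv (y - z) v = 0.

(* the orthogonal projection onto x + T_M(x), restricted to M cap B(x,delta),
   is a (C^2) diffeomorphism onto its image: the image is relatively open in
   x + T_M(x) and the inverse is (the restriction of) a C^2 map. *)
Definition proj_diffeo n (M : set 'rV[R]_n) (x : 'rV[R]_n) (delta : R) : Prop :=
  let T := mfd_tangent M x in
  exists (O : set 'rV[R]_n) (g : 'rV[R]_n -> 'rV[R]_n),
    [/\ open O, C2on O g,
        [set z | exists2 y, (M `&` eball x delta) y & is_orth_proj T x y z]
          = O `&` [set z | T (z - x)] &
        forall y z, (M `&` eball x delta) y -> is_orth_proj T x y z -> g z = y].

Definition subspace_dim n (S : set 'rV[R]_n) (k : nat) : Prop :=
  exists B : 'M[R]_(k, n), row_free B /\ forall v, S v <-> (v <= B)%MS.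

Definition SymMx (n : nat) : set 'M[R]_n := [set X | X^T = X].

(* lambda(X) = x : x is the nonincreasingly ordered vector of eigenvalues of X
   (spectral decomposition X = U^T Diag(x) U with U orthogonal) *)
Definition is_lambda n (X : 'M[R]_n) (x : 'rV[R]_n) : Prop :=
  Rge x /\ exists U : 'M[R]_n, U *m U^T = 1%:M /\ X = U^T *m diag_mx x *m U.

Definition lambda_inv n (D : set 'rV[R]_n) : set 'M[R]_n :=
  [set X | @SymMx n X /\ exists x, is_lambda X x /\ D x].

Definition mono p q (a : 'I_p -> 'I_q -> nat) (Z : 'M[R]_(p, q)) : R :=
  \prod_i \prod_j Z i j ^+ a i j.

Definition psum p q (c : ('I_p -> 'I_q -> nat) -> R) (Z : 'M[R]_(p, q)) (N : nat) : R :=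
  \sum_(a : {ffun 'I_p * 'I_q -> 'I_N.+1} | (\sum_ij a ij <= N)%N)
     c (fun i j => nat_of_ord (a (i, j))) * mono (fun i j => nat_of_ord (a (i, j))) Z.

Definition abs_psum p q (c : ('I_p -> 'I_q -> nat) -> R) (Z : 'M[R]_(p, q)) (N : nat) : R :=
  \sum_(a : {ffun 'I_p * 'I_q -> 'I_N.+1} | (\sum_ij a ij <= N)%N)
     `|c (fun i j => nat_of_ord (a (i, j))) * mono (fun i j => nat_of_ord (a (i, j))) Z|.

(* f is real analytic at A: near A it is the sum of an absolutely convergent
   power series in the entries of Y - A *)
Definition analytic_at p q (f : 'M[R]_(p, q) -> R) (A : 'M[R]_(p, q)) : Prop :=
  exists2 r : R, 0 < r & exists c : ('I_p -> 'I_q -> nat) -> R,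
    forall Y : 'M[R]_(p, q), (forall i j, `|Y i j - A i j| < r) ->
      (psum c (Y - A) @ \oo --> f Y) /\
      (exists B : R, forall N, abs_psum c (Y - A) N <= B).

Definition analytic_on p q k (V : set 'M[R]_(p, q)) (F : 'M[R]_(p, q) -> 'rV[R]_k) : Prop :=
  forall A, V A -> forall j, analytic_at (fun Y => F Y 0 j) A.

(* L is an analytic submanifold of S^n of dimension m around X:
   locally in S^n, L is the regular zero set of an analytic map
   S^n -> R^(dim S^n - m) (given as an analytic map on the ambient 'M_n). *)
Definition analytic_submanifold_Sn n (L : set 'M[R]_n) (m : nat) (X : 'M[R]_n) : Prop :=
  L `<=` @SymMx n /\ (m <= (n * n.+1)./2)%N /\
  exists (V : set 'M[R]_n) (F : 'M[R]_n -> 'rV[R]_((n * n.+1)./2 - m)),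
    [/\ open V, V X, analytic_on V F,
        (forall w, exists2 H, @SymMx n H & derive F X H = w) &
        L `&` V = [set Y | V Y /\ @SymMx n Y /\ F Y = 0]].

End Defs.

(* Main.v *)
Require Import Defs.
From HB Require Import structures.
From mathcomp Require Import all_boot all_order all_algebra all_fingroup.
From mathcomp Require Import all_classical all_reals all_analysis.
From mathcomp Require Import ring lra zify.
From mathcomp Require Import -(notations) mpoly.
Import Order.TTheory GRing.Theory Num.Theory.
Import numFieldNormedType.Exports.
Local Open Scope classical_set_scope.
Local Open Scope ring_scope.
Set Implicit Arguments. Unset Strict Implicit. Unset Printing Implicit Defensive.

(** For x in M the coordinates i, j are "locally equal" at x if y_i = y_j for all y in M near x. Local symmetry under
    the transposition (i j) shows that this is an open and closed condition on M: if x_i = x_j, then either all tangent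
    vectors satisfy v_i = v_j, and uniqueness in the implicit function theorem gives y_i = y_j near x, or e_i - e_j is
    tangent and the points with y_i <> y_j are dense near x. As M is connected, i and j lie in one orbit of sigma_*
    iff they are locally equal at xbar. It follows that every nontrivial orbit of sigma_* is a whole block of equal
    coordinates of xbar, and that T + N^red is the space of all vectors constant on the orbits of sigma_*.

    So near Xbar the set lambda^-1(D) consists of the symmetric X for which the eigenvalues in each nontrivial orbit I
    coincide. Write Y for X in an eigenbasis of Xbar. Then X has an eigenvalue t of multiplicity |I| near the value of
    xbar on I iff the Schur complement of Y - t on I vanishes. Its entry at the least index of I is, as a function of t,
    a polynomial with a simple root mu(X), which depends analytically on X; the other entries on and above the diagonal
    at t = mu(X) are |I|(|I|+1)/2 - 1 independent analytic equations. *)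

(** * Weighted l1 norms of polynomials and simple roots *)

(** Individual eigenvalues inside a cluster are not analytic in X, and analyticity means here an
    explicit power series at every point of a neighbourhood. The equations therefore avoid spectral
    quantities: the Schur complement, scaled by a determinant, is polynomial in X and t, so the only
    non-polynomial ingredient is one simple root of a polynomial whose coefficients are polynomials.
    A Newton iteration with frozen derivative, run on polynomials, produces its power series. The
    root mu(X) is known to be an eigenvalue only where the remaining equations hold. Surjectivity of
    the derivative is tested along directions on which mu is constant, so mu is never
    differentiated.

    The dimension comes from counting orbits: d + n^red is the number of all orbits of sigma_*,
    hence d + n^red - kappa_* is the number of nontrivial ones, that is, of the entries spent on
    defining the roots mu. The codimension is the sum of the |I|(|I|+1)/2 minus this number. A block
    of equal coordinates of xbar that consists of fixed points gives no equation. *)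

Section MpolyNorm.
Variables (R : realType) (k : nat).
Local Notation P := (mpoly k R).
Implicit Types (p q : P) (r : R).

Definition mnorm r p : R := \sum_(m <- msupp p) `|mcoeff m p| * r ^+ mdeg m.

(** Vanishing to order [d] at the origin. Applied to a difference, it says that two approximants
    share all coefficients of degree below [d]. *)
Definition ord_ge d p := forall m, (mdeg m < d)%N -> mcoeff m p = 0.

Lemma mnorm_supset r p (s : seq (multinom k)) : uniq s -> {subset msupp p <= s} ->
  mnorm r p = \sum_(m <- s) `|mcoeff m p| * r ^+ mdeg m.
Proof.
move=> us sub; rewrite /mnorm [RHS](bigID (fun m => m \in msupp p)) /=.
rewrite [X in _ + X]big1 ?addr0; last first.
  by move=> m /memN_msupp_eq0 ->; rewrite normr0 mul0r.
rewrite -[RHS]big_filter; apply: perm_big; apply: uniq_perm.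
- exact: msupp_uniq.
- exact: filter_uniq.
- move=> m; rewrite mem_filter; case: (boolP (m \in msupp p)) => //= mp.
  by rewrite (sub _ mp).
Qed.

Lemma mnorm_ge0 r p : 0 <= r -> 0 <= mnorm r p.
Proof. by move=> r0; apply: sumr_ge0 => m _; rewrite mulr_ge0 ?exprn_ge0. Qed.

Lemma sum_mcoeff_le_mnorm r p (s : seq (multinom k)) : 0 <= r -> uniq s ->
  \sum_(m <- s) `|mcoeff m p| * r ^+ mdeg m <= mnorm r p.
Proof.
move=> r0 us; rewrite (@mnorm_supset r p (undup (msupp p ++ s))) ?undup_uniq//; last first.
  by move=> m mp; rewrite mem_undup mem_cat mp.
rewrite [leRHS](bigID (fun m => m \in s)) /= -[X in _ <= X + _]big_filter.
rewrite [X in _ <= X + _](_ : _ = \sum_(m <- s) `|mcoeff m p| * r ^+ mdeg m); last first.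
  apply: perm_big; apply: uniq_perm => //; first by rewrite filter_uniq ?undup_uniq.
  move=> m; rewrite mem_filter mem_undup mem_cat.
  by case: (m \in s); rewrite ?orbT ?andbF.
by rewrite lerDl sumr_ge0// => m _; rewrite mulr_ge0 ?exprn_ge0.
Qed.

Lemma mnormD r p q : 0 <= r -> mnorm r (p + q) <= mnorm r p + mnorm r q.
Proof.
move=> r0; set s := undup (msupp p ++ msupp q).
have us : uniq s by exact: undup_uniq.
rewrite (@mnorm_supset r p s)//; last by move=> m mp; rewrite mem_undup mem_cat mp.
rewrite (@mnorm_supset r q s)//; last by move=> m mp; rewrite mem_undup mem_cat mp orbT.
rewrite (@mnorm_supset r (p + q) s)//; last by move=> m /msuppD_le; rewrite mem_undup.
rewrite -big_split /=; apply: ler_sum => m _.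
by rewrite mcoeffD -mulrDl ler_wpM2r ?exprn_ge0 ?ler_normD.
Qed.

Lemma mnormN r p : mnorm r (- p) = mnorm r p.
Proof.
rewrite {1}/mnorm (perm_big _ (msuppN p)) /=; apply: eq_bigr => m _.
by rewrite mcoeffN normrN.
Qed.

Lemma mnorm0 r : mnorm r 0 = 0.
Proof. by rewrite /mnorm big1// => m _; rewrite mcoeff0 normr0 mul0r. Qed.

Lemma mnorm_sum (I : Type) r (s : seq I) (C : pred I) (f : I -> P) : 0 <= r ->
  mnorm r (\sum_(i <- s | C i) f i) <= \sum_(i <- s | C i) mnorm r (f i).
Proof.
move=> r0; elim/big_ind2 : _ => [|x a y b xa yb|i _] //; first by rewrite mnorm0.
by apply: (le_trans (mnormD _ _ r0)); exact: lerD.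
Qed.

Lemma mnormZX r c m : mnorm r (c *: mpolyX R m) = `|c| * r ^+ mdeg m.
Proof.
rewrite (@mnorm_supset r _ [:: m])//; last first.
  by move=> m' /msuppZ_le; rewrite msuppX.
by rewrite big_seq1 mcoeffZ mcoeffX eqxx mulr1.
Qed.

Lemma mnormC r c : mnorm r (mpolyC k c) = `|c|.
Proof. by rewrite -[mpolyC k c]mulr1 mul_mpolyC -mpolyX0 mnormZX mdeg0 expr0 mulr1. Qed.

Lemma mnormM r p q : 0 <= r -> mnorm r (p * q) <= mnorm r p * mnorm r q.
Proof.
move=> r0; rewrite mpolyME; apply: (le_trans (mnorm_sum _ _ _ r0)).
rewrite big_allpairs /= /mnorm mulr_suml; apply: ler_sum => m1 _.
rewrite mulr_sumr; apply: ler_sum => m2 _.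
by rewrite -/(mnorm _ _) mnormZX normrM mdegD exprD mulrACA.
Qed.

Lemma mnormX r p d : 0 <= r -> mnorm r (p ^+ d) <= mnorm r p ^+ d.
Proof.
move=> r0; elim: d => [|d IH]; first by rewrite !expr0 -mpolyC1 mnormC normr1.
rewrite !exprS; apply: (le_trans (mnormM _ _ r0)).
by rewrite ler_wpM2l// mnorm_ge0.
Qed.

Lemma mnorm_mono r r' p : 0 <= r -> r <= r' -> mnorm r p <= mnorm r' p.
Proof. by move=> r0 rr'; apply: ler_sum => m _; rewrite ler_wpM2l// lerXn2r ?nnegrE// (le_trans r0). Qed.

(** Every monomial that occurs carries at least one factor [r]. Shrinking the polydisc thus makes a
    polynomial without constant term small, which starts the Newton iteration. *)
Lemma mnorm_ord1 r p : 0 <= r <= 1 -> ord_ge 1 p -> mnorm r p <= r * mnorm 1 p.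
Proof.
case/andP=> r0 r1 op; rewrite /mnorm mulr_sumr; apply: ler_sum => m _.
rewrite expr1n mulr1 mulrC; have [m0|m0] := posnP (mdeg m).
  by rewrite op ?m0// normr0 !mulr0.
by rewrite ler_wpM2r// -(prednK m0) exprS ler_piMr// exprn_ile1.
Qed.

Lemma meval_le_mnorm r p (v : 'I_k -> R) : (forall i, `|v i| <= r) -> `|meval v p| <= mnorm r p.
Proof.
move=> vr; rewrite mevalE; apply: (le_trans (ler_norm_sum _ _ _)); apply: ler_sum => m _.
rewrite normrM ler_wpM2l// normr_prod mdegE.
rewrite (_ : r ^+ _ = \prod_i r ^+ m i); last first.
  by elim/big_rec2 : _ => // i y x _ <-; rewrite exprD.
by apply: ler_prod => i _; rewrite normr_ge0 normrX lerXn2r ?nnegrE// (le_trans (normr_ge0 _) (vr i)).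
Qed.

Lemma ord_geD d p q : ord_ge d p -> ord_ge d q -> ord_ge d (p + q).
Proof. by move=> op oq m md; rewrite mcoeffD op// oq// addr0. Qed.

Lemma ord_geM a b p q : ord_ge a p -> ord_ge b q -> ord_ge (a + b) (p * q).
Proof.
move=> op oq m md; rewrite mcoeffM big1// => -[k1 k2] /= /eqP em.
have mdd := congr1 mdeg em; rewrite mdegD in mdd.
have [h|h] := ltnP (mdeg k1) a; first by rewrite op ?mul0r.
have aux (x y z : nat) : (z = x + y -> z < a + b -> a <= x -> y < b)%N by lia.
by rewrite oq ?mulr0//; exact: aux mdd md h.
Qed.

Lemma ord_ge0 p : ord_ge 0 p.
Proof. by []. Qed.

Lemma ord_ge1E p : ord_ge 1 p <-> meval (fun=> 0) p = 0.
Proof.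
have -> : meval (fun=> 0) p = mcoeff mnm0 p.
  rewrite [in LHS](mpolyE p) [in RHS](mpolyE p) !raddf_sum /=; apply: eq_bigr => m _.
  rewrite mevalZ mcoeffZ mcoeffX mevalX; congr (_ * _).
  case: eqP => [->|/eqP m0].
    by rewrite big1// => i _; rewrite mnm0E expr0.
  have [i mi] : exists i, m i != 0%N.
    apply: contrapT => H; move/negP: m0; apply; apply/eqP/mnmP => i; rewrite mnm0E.
    by apply/eqP/negPn/negP => mi; apply: H; exists i.
  by rewrite (bigD1 i)//= expr0n (negbTE mi) mul0r.
split=> [h|h m]; first by apply: h; rewrite mdeg0.
by rewrite ltnS leqn0 mdeg_eq0 => /eqP ->.
Qed.

End MpolyNorm.

(** * Simple roots of polynomials whose coefficients are polynomials in parameters *)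

Section SimpleRoot.
Variables (R : realType) (k : nat).
Local Notation P := (mpoly k R).
Implicit Types (q : {poly P}) (w : P).

(** The divided difference of [q], written without division so that it also makes sense for
    [w' = w], where it is the derivative. *)
Definition divdiff q w' w : P :=
  \sum_(i < size q) q`_i * \sum_(j < i) w' ^+ (i.-1 - j) * w ^+ j.

Lemma divdiffE q w' w : q.[w'] - q.[w] = (w' - w) * divdiff q w' w.
Proof.
rewrite !horner_coef -sumrB mulr_sumr; apply: eq_bigr => i _.
by rewrite -mulrBr subrXX mulrCA.
Qed.

Lemma divdiff_diag q w : divdiff q w w = q^`().[w].
Proof.
rewrite -{2}[q]coefK poly_def raddf_sum horner_sum; apply: eq_bigr => i _ /=.
rewrite derivZ derivXn hornerZ hornerMn hornerXn; congr (_ * _).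
rewrite (eq_bigr (fun=> w ^+ i.-1)); last first.
  by move=> j _; rewrite -exprD subnK//; move: (ltn_ord j); lia.
by rewrite sumr_const card_ord.
Qed.

(** The linear coefficient differs from [c] by a polynomial without constant term, and every term of
    higher degree contains a factor [w] or [w']; both are O(r). The constant [K] depends on [q]
    alone, so the radii can be chosen after it. *)
Lemma divdiff_near (q : {poly P}) (c : R) : meval (fun=> 0) q`_1 = c -> c != 0 ->
  exists K, 0 <= K /\ forall rho r w w', 0 <= rho -> rho <= r -> r <= 1 ->
    mnorm rho w <= r -> mnorm rho w' <= r -> mnorm rho (divdiff q w' w - mpolyC k c) <= r * K.
Proof.
move=> qc c0.
have q1 : (1 < size q)%N.
  rewrite ltnNge; apply: contra c0 => sq; rewrite -qc nth_default//.
  by rewrite meval0.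
pose e i : R := if i == 1%N then c else 0.
(* The multiplicity [i] counts the products of powers of [w'] and [w] that belong to the coefficient
   of index [i]. *)
pose K := \sum_(i < size q) (mnorm 1 (q`_i - mpolyC k (e i)) *+ i).
exists K; split.
  by apply: sumr_ge0 => i _; rewrite mulrn_wge0// mnorm_ge0.
move=> rho r w w' rho0 rhor r1 nw nw'; have r0 := le_trans rho0 rhor.
have -> : mpolyC k c = \sum_(i < size q) mpolyC k (e i).
  rewrite (bigD1 (Ordinal q1))//= /e eqxx big1 ?addr0// => i.
  rewrite -val_eqE /= => /negbTE ->; exact: mpolyC0.
rewrite -sumrB; apply: (le_trans (mnorm_sum _ _ _ rho0)).
rewrite mulr_sumr; apply: ler_sum => -[[|[|i]] /= iq] _.
- by rewrite big_ord0 mulr0 /e /= mpolyC0 subr0 mnorm0 mulr0n mulr0.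
- rewrite big_ord_recl big_ord0 /= expr0 addr0 !expr0 !mulr1 mulr1n /e eqxx.
  apply: (@le_trans _ _ (rho * mnorm 1 (q`_1 - mpolyC k c))).
    apply: mnorm_ord1; first by rewrite rho0 (le_trans rhor).
    by apply/ord_ge1E; rewrite mevalB qc mevalC subrr.
  by rewrite ler_wpM2r// mnorm_ge0.
- rewrite /e /= mpolyC0 !subr0; apply: (le_trans (mnormM _ _ rho0)).
  rewrite mulrnAr [r * _]mulrC -mulrnAr; apply: ler_pM; rewrite ?mnorm_ge0//.
    by apply: mnorm_mono => //; exact: le_trans r1.
  apply: (le_trans (mnorm_sum _ _ _ rho0)).
  apply: (@le_trans _ _ (\sum_(j < i.+2) r)); last by rewrite sumr_const card_ord.
  apply: ler_sum => j _; apply: (le_trans (mnormM _ _ rho0)).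
  apply: (@le_trans _ _ (r ^+ (i.+1 - j) * r ^+ j)).
    apply: ler_pM; rewrite ?mnorm_ge0//.
      by apply: (le_trans (mnormX _ _ rho0)); rewrite lerXn2r ?nnegrE ?mnorm_ge0.
    by apply: (le_trans (mnormX _ _ rho0)); rewrite lerXn2r ?nnegrE ?mnorm_ge0.
  rewrite -exprD subnK; last by rewrite -ltnS.
  by rewrite exprS ler_piMr// exprn_ile1.
Qed.

Lemma cvg_of_geometric_steps (u : nat -> R) (C : R) :
  (forall d, `|u d.+1 - u d| <= C * (1/2) ^+ d) -> cvgn u.
Proof.
move=> H; pose a d := u d.+1 - u d.
have sa : cvgn (series a).
  apply: normed_cvg; apply: (@series_le_cvg _ _ (geometric C (1/2))).
  - by move=> n; exact: normr_ge0.
  - by move=> n; exact: le_trans (H n).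
  - by move=> n; exact: H.
  - by apply: is_cvg_geometric_series; rewrite gtr0_norm; lra.
have -> : u = (fun n => u 0%N + series a n).
  apply/funext => n; rewrite /series /= telescope_sumr// addrC subrK//.
by apply: is_cvgD => //; exact: is_cvg_cst.
Qed.

(** The iteration w -> w - q(w)/c, with c the derivative at the origin, runs in the ring of
    polynomials in the parameters. It contracts [mnorm rho], hence converges at every small
    parameter; and each step raises the order of the increment by one, hence the coefficients
    stabilise. *)
Lemma simple_root_analytic (q : {poly P}) :
  (map_poly (meval (fun=> 0)) q).[0] = 0 ->
  (map_poly (meval (fun=> 0)) q)^`().[0] != 0 ->
  forall eta : R, 0 < eta -> exists rho r : R, [/\ 0 < rho, rho <= eta, 0 < r & r <= eta] /\
    exists (Q : nat -> P) (f : ('I_k -> R) -> R),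
    [/\ forall d, ord_ge d.+1 (Q d.+1 - Q d), forall d, mnorm rho (Q d) <= r &
     forall v, (forall i, `|v i| <= rho) ->
      [/\ meval v (Q d) @[d --> \oo] --> f v, `|f v| < r,
        root (map_poly (meval v) q) (f v),
        (map_poly (meval v) q)^`().[f v] != 0 &
        forall u, `|u| <= r -> root (map_poly (meval v) q) u -> u = f v]].
Proof.
move=> q00 q01 eta eta0.
pose c := meval (fun=> 0) q`_1.
have hC (v : 'I_k -> R) u : (map_poly (meval v) q).[u] = meval v q.[mpolyC k u].
  by rewrite -{1}(mevalC (n := k) v u) horner_map.
have hD (v : 'I_k -> R) u : (map_poly (meval v) q)^`().[u] = meval v (divdiff q (mpolyC k u) (mpolyC k u)).
  by rewrite divdiff_diag deriv_map -{1}(mevalC (n := k) v u) horner_map.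
have c0 : c != 0.
  move: q01; rewrite horner_coef0 coef_deriv mulr1n coef_map.
  exact.
have [K [K0 dd]] := divdiff_near (erefl c) c0.
have nc : 0 < `|c| by rewrite normr_gt0.
(* With this choice the divided difference stays within |c|/2 of [c], so the step contracts by the
   factor 1/2. *)
pose r := Num.min (Num.min eta 1) (`|c| / (2 * (K + 1))).
have K1 : 0 < 2 * (K + 1) by lra.
have r0 : 0 < r by rewrite !lt_min eta0 ltr01 divr_gt0.
have reta : r <= eta by rewrite !ge_min lexx.
have r1 : r <= 1 by rewrite !ge_min lexx !orbT.
have rK : r * K <= `|c| / 2.
  apply: (@le_trans _ _ (`|c| / (2 * (K + 1)) * K)).
    by apply: ler_wpM2r => //; rewrite !ge_min lexx !orbT.
  rewrite mulrAC ler_pdivrMr//; nra.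
pose N0 := mnorm 1 q`_0.
have N00 : 0 <= N0 by apply: mnorm_ge0; exact: ler01.
(* Chosen so that the first increment, -q_0/c, has norm at most r/4; the geometric series of
   increments then stays below r/2. *)
pose rho := Num.min r (r * `|c| / (4 * (N0 + 1))).
have N1 : 0 < 4 * (N0 + 1) by lra.
have rho0 : 0 < rho.
  by rewrite lt_min r0 /=; apply: divr_gt0 => //; exact: mulr_gt0.
have rhor : rho <= r by rewrite ge_min lexx.
have rhoN : rho * N0 <= r * `|c| / 4.
  apply: (@le_trans _ _ (r * `|c| / (4 * (N0 + 1)) * N0)).
    by apply: ler_wpM2r => //; rewrite !ge_min lexx !orbT.
  rewrite mulrAC ler_pdivrMr//; have := mulr_gt0 r0 nc; nra.
exists rho, r; split; first by rewrite rho0 r0 reta (le_trans rhor).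
pose step w := w - c^-1 *: q.[w].
pose Q := fun d => iter d step 0.
have QSt d : Q d.+1 = step (Q d) by [].
have QS d : Q d.+1 = Q d - c^-1 *: q.[Q d] by [].
have stepE w w' : step w' - step w = (w' - w) * (- c^-1 *: (divdiff q w' w - mpolyC k c)).
  have cVc : mpolyC k c^-1 * mpolyC k c = 1 by rewrite -mpolyCM mulVf.
  have qE : q.[w'] = q.[w] + (w' - w) * divdiff q w' w by rewrite -divdiffE addrC subrK.
  rewrite /step qE -!mul_mpolyC mpolyCN.
  transitivity ((w' - w) * (mpolyC k c^-1 * mpolyC k c) - mpolyC k c^-1 * (w' - w) * divdiff q w' w).
    by rewrite cVc; ring.
  by ring.
have bd d : mnorm rho (Q d) <= r / 2 * (1 - (1/2) ^+ d) /\
   mnorm rho (Q d.+1 - Q d) <= r / 4 * (1/2) ^+ d.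
  elim: d => [|d [IH1 IH2]].
    rewrite expr0 subrr mulr0 mulr1 mnorm0; split => //.
    rewrite QS /= subr0 add0r mnormN horner_coef0 -mul_mpolyC.
    apply: (le_trans (mnormM _ _ (ltW rho0))); rewrite mnormC normfV.
    rewrite ler_pdivrMl//; apply: (@le_trans _ _ (rho * N0)); last by lra.
    apply: mnorm_ord1; first by rewrite ltW//= (le_trans rhor).
    by apply/ord_ge1E; rewrite -coef_map -horner_coef0.
  have p0 : 0 < (1/2 : R) ^+ d by apply: exprn_gt0; lra.
  have rp0 := mulr_gt0 r0 p0.
  have nQS : mnorm rho (Q d.+1) <= r / 2 * (1 - (1/2) ^+ d.+1).
    rewrite -[Q d.+1](subrK (Q d)); apply: (le_trans (mnormD _ _ (ltW rho0))).
    by rewrite exprS; lra.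
  split => //.
  rewrite (QSt d.+1) [X in _ - X]QSt stepE.
  apply: (le_trans (mnormM _ _ (ltW rho0))).
  rewrite exprS (_ : _ * (_ * _) = r / 4 * (1/2) ^+ d * (1/2)); last by ring.
  apply: ler_pM; rewrite ?(mnorm_ge0 _ (ltW rho0))//.
  rewrite -mul_mpolyC; apply: (le_trans (mnormM _ _ (ltW rho0))); rewrite mnormC normrN normfV.
  rewrite ler_pdivrMl//; apply: le_trans (le_trans _ rK) _; last by lra.
  have p1 : 0 < (1/2 : R) ^+ d.+1 by apply: exprn_gt0; lra.
  have rp1 := mulr_gt0 r0 p1.
  by apply: dd => //; [exact: ltW|lra|lra].
have nQ d : mnorm rho (Q d) <= r / 2.
  have p0 : 0 < (1/2 : R) ^+ d by apply: exprn_gt0; lra.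
  by have := mulr_gt0 r0 p0; have := (bd d).1; lra.
(* All iterates vanish at the origin, so the factor [divdiff - c] in [stepE] vanishes there as well
   and contributes one more order. *)
have oQ d : ord_ge d.+1 (Q d.+1 - Q d) /\ meval (fun=> 0) (Q d) = 0.
  elim: d => [|d [IH1 IH2]].
    rewrite meval0; split=> //.
    rewrite QS /= subr0 add0r; apply/ord_ge1E.
    by rewrite mevalN mevalZ horner_coef0 -coef_map -horner_coef0 q00 mulr0 oppr0.
  have e1 : meval (fun=> 0) (Q d.+1) = 0.
    rewrite -[Q d.+1](subrK (Q d)) mevalD IH2 addr0.
    apply/ord_ge1E => m md; apply: IH1; move: md; by rewrite ltnS leqn0 => /eqP ->.
  split => //.
  rewrite (QSt d.+1) [X in _ - X]QSt stepE -(addn1 d.+1).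
  apply: ord_geM => //; apply/ord_ge1E.
  rewrite mevalZ mevalB mevalC /divdiff raddf_sum /=.
  have q1 : (1 < size q)%N.
    rewrite ltnNge; apply: contra c0 => sq; rewrite /c nth_default//.
    by rewrite meval0.
  rewrite (bigD1 (Ordinal q1))//= big_ord_recl big_ord0 !expr0 addr0 !mulr1.
  rewrite big1 ?addr0 ?subrr ?mulr0// => -[[|[|i]] /= iq] // _.
    by rewrite big_ord0 mulr0 meval0.
  rewrite mevalM raddf_sum big1 ?mulr0// => j _ /=.
  rewrite mevalM !rmorphXn /= e1 IH2 -exprD subnK; last by rewrite -ltnS.
  by rewrite expr0n.
have evQ v : (forall i, `|v i| <= rho) -> cvgn (fun d => meval v (Q d)).
  move=> hv; apply: (@cvg_of_geometric_steps _ (r / 4)) => d.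
  by rewrite -mevalB; apply: (le_trans (meval_le_mnorm _ hv)); exact: (bd d).2.
exists Q, (fun v => limn (fun d => meval v (Q d))).
split; [by move=> d; exact: (oQ d).1|by move=> d; have := nQ d; lra|].
move=> v hv; have cv := evQ v hv.
set y := limn _.
have cvy : meval v (Q d) @[d --> \oo] --> y by [].
have yr : `|y| <= r / 2.
  rewrite ler_norml; apply/andP; split.
    apply: limr_ge => //; apply: nearW => d.
    by have := le_trans (meval_le_mnorm (Q d) hv) (nQ d); rewrite ler_norml => /andP[].
  apply: limr_le => //; apply: nearW => d.
  by have := le_trans (meval_le_mnorm (Q d) hv) (nQ d); rewrite ler_norml => /andP[].
(* This one bound gives both simplicity of the root (u = u') and its uniqueness (u and u' two
   roots). *)
have ddn u u' : `|u| <= r -> `|u'| <= r -> meval v (divdiff q (mpolyC k u) (mpolyC k u')) != 0.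
  move=> ur ur'; apply/negP => /eqP h.
  have := dd rho r (mpolyC k u') (mpolyC k u); rewrite !mnormC.
  move=> /(_ (ltW rho0) rhor r1 ur' ur) /(le_trans (meval_le_mnorm _ hv)).
  by rewrite mevalB h mevalC sub0r normrN; lra.
have yr' : `|y| <= r by lra.
have ry : root (map_poly (meval v) q) y.
  apply/eqP.
  have l1 : (map_poly (meval v) q).[meval v (Q d)] @[d --> \oo] --> (map_poly (meval v) q).[y].
    by apply: continuous_cvg => //; exact: continuous_horner.
  (* By the iteration, q evaluated at an iterate is c times the difference of two consecutive
     iterates, which tends to 0. *)
  have l2 : (map_poly (meval v) q).[meval v (Q d)] @[d --> \oo] --> c * (y - y).
    rewrite (_ : (fun d => _) = (fun d => c * (meval v (Q d) - meval v (Q d.+1)))); last first.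
      apply/funext => d; rewrite QS mevalB mevalZ horner_map /=.
      by rewrite opprB addrC subrK mulrA mulfV// mul1r.
    apply: cvgMr; apply: cvgB => //.
    by rewrite -(cvg_shiftS (fun d => meval v (Q d))) in cvy.
  by rewrite (cvg_unique _ l1 l2) // subrr mulr0.
split => //; first by lra.
  by rewrite hD ddn.
move=> u ur /eqP ru; have/eqP := ry; rewrite hC => ry'; move: ru; rewrite hC => ru.
have := divdiffE q (mpolyC k u) (mpolyC k y) => /(congr1 (meval v)).
rewrite mevalB mevalM ru ry' subrr mevalB !mevalC => /esym/eqP.
by rewrite mulf_eq0 (negbTE (ddn _ _ ur yr')) orbF subr_eq0 => /eqP.
Qed.

End SimpleRoot.

(** * Analytic functions of matrices *)

Section AnalyticApprox.
Variables (R : realType) (p q : nat).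
Local Notation MX := 'M[R]_(p, q).
Local Notation P := (mpoly (p * q) R).
Implicit Types (f g : MX -> R) (A Z : MX).

Definition mxev Z : 'I_(p * q) -> R := fun l => mxvec Z 0 l.

Definition ent_var (i : 'I_p) (j : 'I_q) : P := mpolyX R (mnm1 (mxvec_index i j)).

Lemma meval_ent_var Z i j : meval (mxev Z) (ent_var i j) = Z i j.
Proof. by rewrite /ent_var mevalXU /mxev mxvecE. Qed.

Lemma mxev_le (r : R) Z : (forall i j, `|Z i j| <= r) -> forall l, `|mxev Z l| <= r.
Proof. by move=> h l; case/mxvec_indexP : l => i j; rewrite /mxev mxvecE. Qed.

(* Power series are handled through polynomial approximants whose coefficients of degree <= d no longer change after
   step d and whose weighted l1 norms are bounded: sums and products of such sequences need no Cauchy products. *)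
Definition analytic_approx f A := exists r B (Q : nat -> P),
  [/\ 0 < r, forall d, ord_ge d.+1 (Q d.+1 - Q d), forall d, mnorm r (Q d) <= B &
   forall Z, (forall i j, `|Z i j| <= r) -> meval (mxev Z) (Q d) @[d --> \oo] --> f (A + Z)].

Lemma analytic_approx_poly f A (P0 : P) r : 0 < r ->
  (forall Z, (forall i j, `|Z i j| <= r) -> f (A + Z) = meval (mxev Z) P0) -> analytic_approx f A.
Proof.
move=> r0 fE; exists r, (mnorm r P0), (fun=> P0); split => //.
  by move=> d m _; rewrite subrr mcoeff0.
by move=> Z Zr; rewrite fE//; exact: cvg_cst.
Qed.

Lemma analytic_approx_cst c A : analytic_approx (fun=> c) A.
Proof. by apply: (@analytic_approx_poly _ _ (mpolyC _ c) 1) => // Z _; rewrite mevalC. Qed.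

Lemma analytic_approx_ent i j A : analytic_approx (fun Y => Y i j) A.
Proof.
apply: (@analytic_approx_poly _ _ (mpolyC _ (A i j) + ent_var i j) 1) => // Z _.
by rewrite mevalD mevalC meval_ent_var mxE.
Qed.

Lemma analytic_approx_local f g A r : 0 < r ->
  (forall Z, (forall i j, `|Z i j| <= r) -> f (A + Z) = g (A + Z)) ->
  analytic_approx f A -> analytic_approx g A.
Proof.
move=> r0 fg [r' [B [Q [r'0 oQ nQ cQ]]]].
exists (Num.min r r'), B, Q; split => //; first by rewrite lt_min r0.
  move=> d; apply: le_trans (nQ d); apply: mnorm_mono; first by rewrite le_min !ltW.
  by rewrite ge_min lexx orbT.
move=> Z hZ; rewrite -fg.
  by apply: cQ => i j; apply: (le_trans (hZ i j)); rewrite ge_min lexx orbT.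
by move=> i j; apply: (le_trans (hZ i j)); rewrite ge_min lexx.
Qed.

Lemma analytic_approxD f g A : analytic_approx f A -> analytic_approx g A ->
  analytic_approx (fun Y => f Y + g Y) A.
Proof.
move=> [r [B [Q [r0 oQ nQ cQ]]]] [r' [B' [Q' [r'0 oQ' nQ' cQ']]]].
have m0 : 0 <= Num.min r r' by rewrite le_min !ltW.
exists (Num.min r r'), (B + B'), (fun d => Q d + Q' d); split.
- by rewrite lt_min r0.
- by move=> d; rewrite opprD addrACA; exact: ord_geD.
- move=> d; apply: (le_trans (mnormD _ _ m0)); apply: lerD.
    by apply: le_trans (nQ d); apply: mnorm_mono => //; rewrite ge_min lexx.
  by apply: le_trans (nQ' d); apply: mnorm_mono => //; rewrite ge_min lexx orbT.
- move=> Z hZ; under eq_fun do rewrite mevalD.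
  apply: cvgD; [apply: cQ|apply: cQ'] => i j; apply: (le_trans (hZ i j)).
    by rewrite ge_min lexx.
  by rewrite ge_min lexx orbT.
Qed.

Lemma analytic_approxM f g A : analytic_approx f A -> analytic_approx g A ->
  analytic_approx (fun Y => f Y * g Y) A.
Proof.
move=> [r [B [Q [r0 oQ nQ cQ]]]] [r' [B' [Q' [r'0 oQ' nQ' cQ']]]].
have m0 : 0 <= Num.min r r' by rewrite le_min !ltW.
exists (Num.min r r'), (B * B'), (fun d => Q d * Q' d); split.
- by rewrite lt_min r0.
- move=> d; rewrite (_ : _ - _ = (Q d.+1 - Q d) * Q' d.+1 + Q d * (Q' d.+1 - Q' d)); last by ring.
  apply: ord_geD; first by have := ord_geM (oQ d) (@ord_ge0 _ _ (Q' d.+1)); rewrite addn0.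
  exact: (ord_geM (@ord_ge0 _ _ (Q d)) (oQ' d)).
- move=> d; apply: (le_trans (mnormM _ _ m0)); apply: ler_pM; rewrite ?mnorm_ge0//.
    by apply: le_trans (nQ d); apply: mnorm_mono => //; rewrite ge_min lexx.
  by apply: le_trans (nQ' d); apply: mnorm_mono => //; rewrite ge_min lexx orbT.
- move=> Z hZ; under eq_fun do rewrite mevalM.
  apply: cvgM; [apply: cQ|apply: cQ'] => i j; apply: (le_trans (hZ i j)).
    by rewrite ge_min lexx.
  by rewrite ge_min lexx orbT.
Qed.

Lemma analytic_approxN f A : analytic_approx f A -> analytic_approx (fun Y => - f Y) A.
Proof.
move=> hf; apply: (@analytic_approx_local (fun Y => -1 * f Y) _ _ 1) => //.
  by move=> Z _; rewrite mulN1r.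
by apply: analytic_approxM => //; exact: analytic_approx_cst.
Qed.

Lemma analytic_approx_sum (I : Type) (s : seq I) (C : pred I) (h : I -> MX -> R) A :
  (forall i, analytic_approx (h i) A) -> analytic_approx (fun Y => \sum_(i <- s | C i) h i Y) A.
Proof.
move=> hh; elim: s => [|i s IH].
  by under eq_fun do rewrite big_nil; exact: analytic_approx_cst.
under eq_fun do rewrite big_cons.
by case: (C i) => //; exact: analytic_approxD.
Qed.

Lemma analytic_approx_prod (I : Type) (s : seq I) (C : pred I) (h : I -> MX -> R) A :
  (forall i, analytic_approx (h i) A) -> analytic_approx (fun Y => \prod_(i <- s | C i) h i Y) A.
Proof.
move=> hh; elim: s => [|i s IH].
  by under eq_fun do rewrite big_nil; exact: analytic_approx_cst.
under eq_fun do rewrite big_cons.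
by case: (C i) => //; exact: analytic_approxM.
Qed.

Definition mx_analytic a b (H : MX -> 'M[R]_(a, b)) A :=
  forall i j, analytic_approx (fun Y => H Y i j) A.

Lemma mx_analytic_cst a b (C : 'M[R]_(a, b)) A : mx_analytic (fun=> C) A.
Proof. by move=> i j; exact: analytic_approx_cst. Qed.

Lemma mx_analyticD a b (H K : MX -> 'M[R]_(a, b)) A :
  mx_analytic H A -> mx_analytic K A -> mx_analytic (fun Y => H Y + K Y) A.
Proof. by move=> hH hK i j; under eq_fun do rewrite mxE; exact: analytic_approxD. Qed.

Lemma mx_analyticN a b (H : MX -> 'M[R]_(a, b)) A :
  mx_analytic H A -> mx_analytic (fun Y => - H Y) A.
Proof. by move=> hH i j; under eq_fun do rewrite mxE; exact: analytic_approxN. Qed.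

Lemma mx_analyticM a b c (H : MX -> 'M[R]_(a, b)) (K : MX -> 'M[R]_(b, c)) A :
  mx_analytic H A -> mx_analytic K A -> mx_analytic (fun Y => H Y *m K Y) A.
Proof.
move=> hH hK i j; under eq_fun do rewrite mxE.
by apply: analytic_approx_sum => l; exact: analytic_approxM.
Qed.

Lemma mx_analyticZ a b h (H : MX -> 'M[R]_(a, b)) A :
  analytic_approx h A -> mx_analytic H A -> mx_analytic (fun Y => h Y *: H Y) A.
Proof. by move=> hh hH i j; under eq_fun do rewrite mxE; exact: analytic_approxM. Qed.

Lemma analytic_approx_det a (H : MX -> 'M[R]_a) A :
  mx_analytic H A -> analytic_approx (fun Y => \det (H Y)) A.
Proof.
move=> hH; apply: analytic_approx_sum => s; apply: analytic_approxM.
  exact: analytic_approx_cst.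
by apply: analytic_approx_prod => i; exact: hH.
Qed.

Lemma mx_analytic_adj a (H : MX -> 'M[R]_a) A :
  mx_analytic H A -> mx_analytic (fun Y => \adj (H Y)) A.
Proof.
move=> hH i j; under eq_fun do rewrite mxE.
apply: analytic_approxM; first exact: analytic_approx_cst.
apply: analytic_approx_det => x y; under eq_fun do rewrite !mxE.
exact: hH.
Qed.

End AnalyticApprox.

(** * From polynomial approximants to power series in the matrix entries *)

Section ApproxAnalytic.
Variables (R : realType) (p q : nat).
Local Notation MX := 'M[R]_(p, q).
Local Notation P := (mpoly (p * q) R).

Definition mxidx (l : 'I_(p * q)) : 'I_p * 'I_q := enum_val (cast_ord (esym (mxvec_cast p q)) l).

Lemma mxidxK i j : mxidx (mxvec_index i j) = (i, j).
Proof. by rewrite /mxidx /mxvec_index cast_ordK enum_rankK. Qed.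

Lemma mxvec_indexK l : mxvec_index (mxidx l).1 (mxidx l).2 = l.
Proof. by case/mxvec_indexP : l => i j; rewrite mxidxK. Qed.

Definition mnm_of (e : 'I_p -> 'I_q -> nat) : multinom (p * q) :=
  Multinom [tuple e (mxidx l).1 (mxidx l).2 | l < p * q].

Lemma mnm_ofE e l : mnm_of e l = e (mxidx l).1 (mxidx l).2.
Proof. by rewrite /mnm_of multinomE tnth_mktuple. Qed.

Lemma big_mxidx (T : Type) (idx : T) (op : Monoid.com_law idx) (F : 'I_p -> 'I_q -> T) :
  \big[op/idx]_l F (mxidx l).1 (mxidx l).2 = \big[op/idx]_i \big[op/idx]_j F i j.
Proof.
rewrite pair_big /= (reindex (fun ij : 'I_p * 'I_q => mxvec_index ij.1 ij.2)) /=.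
  by apply: eq_bigr => -[i j] _ /=; rewrite mxidxK.
exists mxidx => [[i j]|l] _ /=; [exact: mxidxK|exact: mxvec_indexK].
Qed.

Lemma mdeg_mnm_of e : mdeg (mnm_of e) = (\sum_i \sum_j e i j)%N.
Proof.
rewrite mdegE -(big_mxidx _ e); apply: eq_bigr => l _; exact: mnm_ofE.
Qed.

Lemma mono_mnm_of e (Z : MX) : mono e Z = \prod_l mxev Z l ^+ mnm_of e l.
Proof.
rewrite /mono -(big_mxidx _ (fun i j => Z i j ^+ e i j)); apply: eq_bigr => l _.
by rewrite mnm_ofE /mxev; case/mxvec_indexP : l => i j; rewrite mxidxK mxvecE.
Qed.

(** The index set of [psum] and [abs_psum] at stage [N], translated to multinomials. Bounding each
    exponent by [N] loses nothing, since the total degree is at most [N]. *)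
Definition low_mnms (N : nat) : seq (multinom (p * q)) :=
  [seq mnm_of (fun i j => nat_of_ord (a (i, j))) |
    a : {ffun 'I_p * 'I_q -> 'I_N.+1} <- enum [pred a : {ffun 'I_p * 'I_q -> 'I_N.+1} | (\sum_ij a ij <= N)%N]].

Lemma low_mnms_uniq N : uniq (low_mnms N).
Proof.
rewrite map_inj_uniq ?enum_uniq// => a b ab; apply/ffunP => -[i j]; apply/val_inj => /=.
have := congr1 (fun m : multinom _ => m (mxvec_index i j)) ab.
by rewrite !mnm_ofE mxidxK.
Qed.

Lemma mem_low_mnms N m : (m \in low_mnms N) = (mdeg m <= N)%N.
Proof.
apply/mapP/idP => [[a]|mN].
  rewrite mem_enum inE => aN ->; rewrite mdeg_mnm_of pair_big /=.
  by apply: leq_trans aN; apply: eq_leq; apply: eq_bigr => -[].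
have mle l : (m l < N.+1)%N.
  by rewrite ltnS (leq_trans _ mN)// mdegE (bigD1 l)//= leq_addr.
exists [ffun ij : 'I_p * 'I_q => Ordinal (mle (mxvec_index ij.1 ij.2))].
  rewrite mem_enum inE (leq_trans _ mN)// mdegE.
  rewrite (eq_bigr (fun l => m (mxvec_index (mxidx l).1 (mxidx l).2))); last first.
    by move=> l _; rewrite mxvec_indexK.
  rewrite (big_mxidx _ (fun i j => m (mxvec_index i j))) pair_big /=.
  by apply: eq_leq; apply: eq_bigr => -[i j] _; rewrite ffunE.
by apply/mnmP => l; rewrite mnm_ofE ffunE /= mxvec_indexK.
Qed.

(** The coefficient of a monomial of degree e is final from [Q e] on, so it can be read off there.
    The partial sum of degree [N] is then the truncation of [Q N], and the cut-off tail is small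
    because the norm of [Q N] is bounded uniformly. *)
Lemma analytic_approx_at (f : MX -> R) (A : MX) : analytic_approx f A -> analytic_at f A.
Proof.
move=> [r [B [Q [r0 oQ nQ cQ]]]].
have stab m N : (mdeg m <= N)%N -> mcoeff m (Q (mdeg m)) = mcoeff m (Q N).
  elim: N => [|N IH]; first by rewrite leqn0 => /eqP ->.
  rewrite leq_eqVlt => /predU1P[->//|mN]; rewrite (IH mN).
  by have /eqP := oQ N m mN; rewrite mcoeffB subr_eq0 => /eqP.
(* On half the radius, monomials of degree above [N] are smaller by a factor 2^-N than their weight
   in [mnorm r]. *)
exists (r / 2); first by rewrite divr_gt0.
exists (fun e => mcoeff (mnm_of e) (Q (mdeg (mnm_of e)))) => Y hY.
set Z := Y - A.
have hZ i j : `|Z i j| <= r / 2 by rewrite /Z !mxE ltW.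
have hZr i j : `|Z i j| <= r by apply: (le_trans (hZ i j)); lra.
have vZ := mxev_le hZ.
have mle (m : multinom (p * q)) : \prod_l `|mxev Z l| ^+ m l <= (r / 2) ^+ mdeg m.
  rewrite mdegE (_ : (r / 2) ^+ _ = \prod_l (r / 2) ^+ m l); last first.
    by elim/big_rec2 : _ => // i y x _ <-; rewrite exprD.
  apply: ler_prod => i _; rewrite exprn_ge0//= lerXn2r ?nnegrE//.
  by rewrite divr_ge0// ltW.
pose T (N : nat) := \sum_(m <- low_mnms N) mcoeff m (Q N) * \prod_l mxev Z l ^+ m l.
have psumE N : psum (fun e => mcoeff (mnm_of e) (Q (mdeg (mnm_of e)))) Z N = T N.
  rewrite /T big_seq /psum -[in RHS]big_seq /low_mnms big_map big_enum /=.
  apply: eq_bigr => a aN; rewrite mono_mnm_of (@stab _ N)//.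
  by rewrite -mem_low_mnms; apply: map_f; rewrite mem_enum.
split.
  have -> : psum (fun e => mcoeff (mnm_of e) (Q (mdeg (mnm_of e)))) Z =
            (fun N => meval (mxev Z) (Q N) - (meval (mxev Z) (Q N) - T N)).
    by apply/funext => N; rewrite psumE opprB addrC subrK.
  rewrite -[f Y]subr0; apply: cvgB.
    by have := cQ Z hZr; rewrite (_ : A + Z = Y)// /Z addrC subrK.
  have B0 : 0 <= B by apply: le_trans (nQ 0%N); rewrite mnorm_ge0 ?ltW.
  apply/cvgr0Pnorm_le => e e0.
  have geo : (B * (1/2) ^+ N) @[N --> \oo] --> (0 : R).
    rewrite -[X in _ --> X](mulr0 B); apply: cvgMr; apply: cvg_expr.
    by rewrite gtr0_norm; lra.
  move/cvgr0Pnorm_le: geo => /(_ e e0); apply: filterS => N.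
  apply: le_trans; rewrite [leRHS]ger0_norm; last by rewrite mulr_ge0// exprn_ge0//; lra.
  rewrite mevalE (bigID (fun m => (mdeg m <= N)%N)) /=.
  rewrite (_ : \sum_(m <- msupp (Q N) | (mdeg m <= N)%N) _ = T N); last first.
    rewrite /T [RHS](bigID (fun m => m \in msupp (Q N))) /= [X in _ = _ + X]big1 ?addr0; last first.
      by move=> m /memN_msupp_eq0 ->; rewrite mul0r.
    rewrite -[LHS]big_filter -[RHS]big_filter; apply: perm_big; apply: uniq_perm.
    - by rewrite filter_uniq ?msupp_uniq.
    - by rewrite filter_uniq ?low_mnms_uniq.
    - by move=> m; rewrite !mem_filter mem_low_mnms andbC.
  rewrite addrAC subrr add0r; apply: (le_trans (ler_norm_sum _ _ _)).
  apply: (@le_trans _ _ (\sum_(m <- msupp (Q N)) `|mcoeff m (Q N)| * r ^+ mdeg m * (1/2) ^+ N)).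
    rewrite big_mkcond /=; apply: ler_sum => m _; case: ifPn => [|_]; last first.
      apply: mulr_ge0; [by rewrite mulr_ge0 ?(exprn_ge0 _ (ltW r0))|by apply: exprn_ge0; lra].
    rewrite -ltnNge => mN; rewrite normrM -mulrA ler_wpM2l//.
    rewrite normr_prod; under eq_bigr do rewrite normrX.
    apply: (le_trans (mle m)); rewrite exprMn ler_wpM2l ?(exprn_ge0 _ (ltW r0))// mul1r.
    by apply: ler_wiXn2l; [lra|lra|exact: ltnW].
  rewrite -mulr_suml; apply: ler_wpM2r; [by apply: exprn_ge0; lra|exact: nQ].
exists B => N; rewrite /abs_psum.
apply: le_trans (nQ N); apply: le_trans (sum_mcoeff_le_mnorm _ (ltW r0) (low_mnms_uniq N)).
rewrite /low_mnms big_map big_enum /=; apply: ler_sum => a aN.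
rewrite mono_mnm_of (@stab _ N); last first.
  by rewrite -mem_low_mnms; apply: map_f; rewrite mem_enum.
rewrite normrM ler_wpM2l// normr_prod; under eq_bigr do rewrite normrX.
apply: (le_trans (mle _)); rewrite lerXn2r ?nnegrE ?ltW ?divr_gt0//; lra.
Qed.

End ApproxAnalytic.

(** * Schur complements and eigenvalue multiplicities *)

Section SchurRing.
Variables (n : nat) (I : {set 'I_n}).

Definition projm (A : comNzRingType) (J : {set 'I_n}) : 'M[A]_n := diag_mx (\row_i (i \in J)%:R).

(** The block of [T] outside [I], completed by the identity on [I]: it keeps size [n], has the
    determinant of the block, and spares any reindexing of submatrices. *)
Definition bordm (A : comNzRingType) (T : 'M[A]_n) : 'M[A]_n :=
  projm A (~: I) *m T *m projm A (~: I) + projm A I.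

(* The Schur complement of the block outside I, scaled by its determinant so that it is polynomial in T. *)
Definition schur (A : comNzRingType) (T : 'M[A]_n) : 'M[A]_n :=
  \det (bordm T) *: T - T *m projm A (~: I) *m \adj (bordm T) *m projm A (~: I) *m T.

Lemma map_projm (A B : comNzRingType) (f : {rmorphism A -> B}) J :
  map_mx f (projm A J) = projm B J.
Proof. by apply/matrixP => i j; rewrite !mxE rmorphMn rmorph_nat. Qed.

Lemma map_bordm (A B : comNzRingType) (f : {rmorphism A -> B}) (T : 'M[A]_n) :
  map_mx f (bordm T) = bordm (map_mx f T).
Proof. by rewrite /bordm map_mxD !map_mxM !map_projm. Qed.

Lemma map_schur (A B : comNzRingType) (f : {rmorphism A -> B}) (T : 'M[A]_n) :
  map_mx f (schur T) = schur (map_mx f T).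
Proof.
by rewrite /schur map_mxB map_mxZ !map_mxM map_mx_adj !map_projm map_bordm -det_map_mx map_bordm.
Qed.

Lemma schur_map_entry (A B : comNzRingType) (f : {rmorphism A -> B}) (T : 'M[A]_n) i k :
  f (schur T i k) = schur (map_mx f T) i k.
Proof. by rewrite -map_schur [RHS]mxE. Qed.

Lemma projm_mull (A : comNzRingType) J m (X : 'M[A]_(n, m)) i k :
  (projm A J *m X) i k = (i \in J)%:R * X i k.
Proof. by rewrite /projm mul_diag_mx !mxE. Qed.

Lemma projm_mulr (A : comNzRingType) J m (X : 'M[A]_(m, n)) i k :
  (X *m projm A J) i k = X i k * (k \in J)%:R.
Proof. by rewrite /projm mul_mx_diag !mxE. Qed.

Lemma tr_projm (A : comNzRingType) J : (projm A J)^T = projm A J.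
Proof. exact: tr_diag_mx. Qed.

Lemma projm_id (A : comNzRingType) J : projm A J *m projm A J = projm A J.
Proof.
apply/matrixP => i k; rewrite projm_mull !mxE.
by case: (i \in J); rewrite ?mul1r// mul0r mul0rn.
Qed.

Lemma projmC0 (A : comNzRingType) : projm A I *m projm A (~: I) = 0.
Proof.
apply/matrixP => i k; rewrite projm_mull !mxE inE.
by case: (i \in I); rewrite ?mul0r// mul0rn mulr0.
Qed.

Lemma projmC0' (A : comNzRingType) : projm A (~: I) *m projm A I = 0.
Proof.
apply/matrixP => i k; rewrite projm_mull !mxE inE.
by case: (i \in I); rewrite ?mul0r// mul0rn mulr0.
Qed.

Lemma projm_add (A : comNzRingType) : projm A I + projm A (~: I) = 1%:M.
Proof.
apply/matrixP => i k; rewrite !mxE inE -mulrnDl -natrD.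
by case: (i \in I).
Qed.

Lemma schur_tr (A : comNzRingType) (T : 'M[A]_n) : T^T = T -> (schur T)^T = schur T.
Proof.
move=> sT; have sB : (bordm T)^T = bordm T.
  by rewrite /bordm linearD /= !trmx_mul !tr_projm sT mulmxA.
by rewrite /schur linearB /= linearZ /= !trmx_mul !tr_projm trmx_adj sB sT !mulmxA.
Qed.

(** If row [i] does not couple to the complement of [I], the correction term vanishes. This makes
    the Schur entries computable at Xbar and along block diagonal directions. *)
Lemma schur_block (A : comNzRingType) (T : 'M[A]_n) i k :
  (forall b, b \notin I -> T i b = 0) -> schur T i k = \det (bordm T) * T i k.
Proof.
move=> Tb; rewrite /schur -!mulmxA mulmxA !mxE big1 ?subr0// => b _.
by rewrite projm_mulr inE; case: (boolP (b \in I)) => bI; rewrite ?mulr0 ?mul0r// Tb// !mul0r.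
Qed.

Lemma bordm_diag (A : comNzRingType) (y : 'rV[A]_n) :
  bordm (diag_mx y) = diag_mx (\row_a if a \in I then 1 else y 0 a).
Proof.
apply/matrixP => i k; rewrite /bordm mxE projm_mulr projm_mull !mxE !inE.
have [<-|] := eqVneq i k; last by rewrite !mulr0n mulr0 mul0r addr0.
by case: (i \in I); rewrite !mulr1n ?(mul0r, mul1r, mulr1, mulr0, add0r, addr0).
Qed.

End SchurRing.

Section SchurField.
Variables (F : fieldType) (n : nat) (I : {set 'I_n}).
Implicit Types (T V W : 'M[F]_n) (y : 'rV[F]_n).
Local Notation PI := (projm F I).
Local Notation Pc := (projm F (~: I)).

Lemma rank_projm_le (J : {set 'I_n}) : (\rank (projm F J) <= #|J|)%N.
Proof.
pose X : 'M[F]_(n, #|J|) := \matrix_(i, a) (i == enum_val a)%:R.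
have -> : projm F J = X *m X^T.
  apply/matrixP => i k; rewrite !mxE.
  under eq_bigr do rewrite !mxE.
  have [iJ|iJ] := boolP (i \in J); last first.
    rewrite mul0rn big1// => a _; case: eqP => [ia|_]; rewrite ?mul0r//.
    by move: iJ; rewrite ia enum_valP.
  rewrite (bigD1 (enum_rank_in iJ i))//= enum_rankK_in// eqxx mul1r big1 ?addr0.
    by rewrite eq_sym; case: eqP.
  move=> a ai; case: eqP => [ia|_]; rewrite ?mul0r//.
  by case/negP: ai; apply/eqP/enum_val_inj; rewrite enum_rankK_in.
exact: mulmx_max_rank.
Qed.

Lemma rank_projm (J : {set 'I_n}) : \rank (projm F J) = #|J|.
Proof.
apply/eqP; rewrite eqn_leq rank_projm_le /=.
have := mxrank_add (projm F J) (projm F (~: J)).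
rewrite projm_add mxrank1 => h.
have e : (#|J| + #|~: J| = n)%N by rewrite cardsC card_ord.
by rewrite -(leq_add2r #|~: J|) e (leq_trans h)// leq_add2l rank_projm_le.
Qed.

Lemma schurE T : bordm I T \in unitmx ->
  schur I T = \det (bordm I T) *: (T - T *m Pc *m invmx (bordm I T) *m Pc *m T).
Proof.
move=> uE; rewrite /schur scalerBr; congr (_ - _).
rewrite /invmx uE -!(scalemxAr, scalemxAl) scalerA mulfV ?scale1r//.
by move: uE; rewrite unitmxE unitfE.
Qed.

Lemma mulmx_projc_bordm T W : W *m Pc = W -> W *m bordm I T = W *m T *m Pc.
Proof.
move=> WP; have WI : W *m PI = 0 by rewrite -WP -mulmxA projmC0' mulmx0.
by rewrite /bordm mulmxDr !mulmxA WP WI addr0.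
Qed.

(** Block Gaussian elimination: subtracting multiples of the rows outside [I] turns the rows in [I]
    into rows of the Schur complement. [V] records the elimination; since [V] is the identity on
    [I], its rank is at least |I|. *)
Lemma kernel_of_schur T : bordm I T \in unitmx -> {in I &, forall i k, schur I T i k = 0} ->
  exists2 V, V *m T = 0 & V *m PI = PI.
Proof.
move=> uE S0; set E := bordm I T in uE *.
exists (PI - PI *m T *m Pc *m invmx E *m Pc).
  have cE : invmx E *m Pc *m T *m Pc = Pc.
    have -> : invmx E *m Pc *m T *m Pc = invmx E *m (E *m Pc).
      rewrite /E /bordm mulmxDl -!mulmxA projm_id projmC0 addr0 !mulmxA.
      by [].
    by rewrite mulKmx.
  have PS : PI *m (T - T *m Pc *m invmx E *m Pc *m T) *m PI = 0.
    have d0 : \det E != 0 by move: uE; rewrite unitmxE unitfE.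
    apply/matrixP => i k; rewrite projm_mulr projm_mull [RHS]mxE.
    have [iI|] := boolP (i \in I); last by rewrite !mul0r.
    have [kI|] := boolP (k \in I); last by rewrite mulr0.
    have := S0 i k iI kI; rewrite schurE// mxE => /eqP; rewrite mulf_eq0 (negbTE d0) /=.
    by move=> /eqP ->; rewrite mul1r mul0r.
  rewrite -[_ *m T]mulmx1 -(projm_add I) mulmxDr.
  have -> : (PI - PI *m T *m Pc *m invmx E *m Pc) *m T *m PI = 0.
    by rewrite -{}PS mulmxBl mulmxBr !mulmxA.
  rewrite add0r !mulmxBl -[X in _ - X]mulmxA -[X in _ - X]mulmxA -[X in _ - X]mulmxA.
  have cE' : invmx E *m (Pc *m (T *m Pc)) = Pc by rewrite !mulmxA.
  by rewrite cE' -[X in _ - X]mulmxA projm_id subrr.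
by rewrite mulmxBl projm_id -[X in _ - X]mulmxA projmC0' mulmx0 subr0.
Qed.

(** The columns outside [I] of the kernel equation determine the part [W] of [V] outside [I];
    inserting it into the columns in [I] leaves the Schur complement. *)
Lemma schur_of_kernel T V : bordm I T \in unitmx -> V *m T = 0 -> V *m PI = PI ->
  {in I &, forall i k, schur I T i k = 0}.
Proof.
move=> uE VT VP; set E := bordm I T in uE *.
pose V0 := PI *m V; pose W := V0 *m Pc.
have V0T : V0 *m T = 0 by rewrite /V0 -mulmxA VT mulmx0.
have V0E : V0 = PI + W.
  by rewrite -{1}[V0]mulmx1 -(projm_add I) mulmxDr /V0 -mulmxA VP projm_id.
have WPc : W *m Pc = W by rewrite /W -mulmxA projm_id.
have WE : W *m E = - (PI *m T *m Pc).
  rewrite mulmx_projc_bordm//; apply/eqP; rewrite -addr_eq0 -mulmxDl -mulmxDl addrC -V0E V0T.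
  by rewrite mul0mx.
have WE' : W = - (PI *m T *m Pc *m invmx E) by rewrite -mulNmx -WE mulmxK.
have key : PI *m (T - T *m Pc *m invmx E *m Pc *m T) *m PI = 0.
  have : V0 *m T *m PI = 0 by rewrite V0T mul0mx.
  rewrite V0E !mulmxDl -WPc WE' !mulNmx => <-.
  by rewrite mulmxBr mulmxBl !mulmxA.
move=> i k iI kI; rewrite schurE// mxE.
have /matrixP/(_ i k) := key; rewrite projm_mulr projm_mull iI kI mul1r mulr1 => ->.
by rewrite mxE mulr0.
Qed.

(** A dimension count: the kernel has dimension at least |I|, and it is spanned by eigenvectors for
    the set [J] of zero eigenvalues, which is contained in [I]. *)
Lemma schur0_eigen T W y : bordm I T \in unitmx -> {in I &, forall i k, schur I T i k = 0} ->
  W *m W^T = 1%:M -> T = W^T *m diag_mx y *m W -> (forall a, a \notin I -> y 0 a != 0) ->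
  forall a, a \in I -> y 0 a = 0.
Proof.
move=> uE S0 WW TE yI; have [V VT VP] := kernel_of_schur uE S0.
pose J : {set 'I_n} := [set a | y 0 a == 0]%SET.
have JI : J \subset I.
  by apply/fintype.subsetP => a; rewrite inE; apply: contraLR => /yI.
have Vd : V *m W^T *m diag_mx y = 0.
  have : V *m T *m W^T = 0 by rewrite VT mul0mx.
  by rewrite TE -!mulmxA WW mulmx1 !mulmxA.
have VJ : V *m W^T = V *m W^T *m projm F J.
  apply/matrixP => i a; rewrite projm_mulr inE; case: eqP => [|/eqP ya]; rewrite ?mulr1// mulr0.
  move/matrixP/(_ i a): Vd; rewrite mul_mx_diag !mxE => /eqP; rewrite mulf_eq0 (negbTE ya) orbF.
  by move/eqP.
have rV : (\rank V <= #|J|)%N.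
  have -> : V = V *m W^T *m projm F J *m W by rewrite -VJ -mulmxA (mulmx1C WW) mulmx1.
  apply: (leq_trans (mxrankM_maxl _ _)); apply: (leq_trans (mxrankM_maxr _ _)).
  by rewrite rank_projm.
have IV : (#|I| <= \rank V)%N by rewrite -rank_projm -{1}VP mxrankM_maxl.
have IJ : I = J by apply/eqP; rewrite eq_sym eqEcard JI (leq_trans IV).
by move=> a; rewrite IJ inE => /eqP.
Qed.

(** The eigenvectors with index in [I] span a kernel of dimension |I|. A kernel vector supported
    outside [I] is killed by [bordm I T], hence zero, so projection to the coordinates in [I] is
    injective on this span and the basis can be normalised to the identity on [I]. *)
Lemma eigen_schur0 T W y : bordm I T \in unitmx ->
  W *m W^T = 1%:M -> T = W^T *m diag_mx y *m W -> (forall a, a \in I -> y 0 a = 0) ->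
  {in I &, forall i k, schur I T i k = 0}.
Proof.
move=> uE WW TE yI; pose K := PI *m W.
have Pd : PI *m diag_mx y = 0.
  apply/matrixP => i k; rewrite projm_mull !mxE; case: (boolP (i \in I)) => iI; last by rewrite mul0r.
  by rewrite yI// mul0rn mulr0.
have KT : K *m T = 0 by rewrite TE /K !mulmxA -[_ *m W *m _]mulmxA WW mulmx1 Pd mul0mx.
have rK : \rank K = #|I|.
  rewrite /K mxrankMfree ?rank_projm// row_free_unit.
  by case/mulmx1_unit: WW.
have kK : (K :&: kermx PI)%MS = 0.
  apply/eqP/rowV0P => v; rewrite sub_capmx => /andP[/submxP[u vE] /sub_kermxP vP].
  have vc : v *m Pc = v by rewrite -{2}[v]mulmx1 -(projm_add I) mulmxDr vP add0r.
  have : v *m bordm I T = 0.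
    rewrite /bordm mulmxDr vP addr0 !mulmxA vc vE -[u *m K *m T]mulmxA KT mulmx0 mul0mx.
    by [].
  by move=> h; rewrite -[v](mulmxK uE) h mul0mx.
have rKP : \rank (K *m PI) = #|I|.
  by have := mxrank_mul_ker K PI; rewrite kK mxrank0 addn0 rK.
have /submxP[C PE] : (PI <= K *m PI)%MS.
  by rewrite -(geq_leqif (mxrank_leqif_sup (submxMl K PI))) rKP rank_projm.
apply: (@schur_of_kernel T (C *m K)) => //; first by rewrite -mulmxA KT mulmx0.
by rewrite -mulmxA -PE.
Qed.

End SchurField.

(** * Spectral theorem and perturbation of eigenvalues *)

Section Spectral.
Variables (R : realType) (n : nat).
Implicit Types (X Y U C A : 'M[R]_n) (v : 'rV[R]_n).

Definition qf A v : R := (v *m A *m v^T) 0 0.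

Lemma qfE A v : qf A v = \sum_a \sum_b v 0 a * A a b * v 0 b.
Proof.
rewrite /qf !mxE exchange_big /=; apply: eq_bigr => b _.
by rewrite !mxE mulr_suml; apply: eq_bigr => a _.
Qed.

Lemma qf_pair A (i k : 'I_n) (al : R) : i != k ->
  qf A (al *: delta_mx 0 i + delta_mx 0 k) = al ^+ 2 * A i i + al * (A i k + A k i) + A k k.
Proof.
move=> ik; rewrite /qf linearD /= linearZ /= !trmx_delta !mulmxDl !mulmxDr.
rewrite -!(scalemxAl, scalemxAr) -!rowE -!colE !mxE.
by ring.
Qed.

Definition householder v : 'M[R]_n := 1%:M - (2 / qf 1%:M v) *: (v^T *m v).

Lemma mul11 (S : 'M[R]_1) : S = (S 0 0)%:M.
Proof. by apply/matrixP => i j; rewrite !ord1 mxE eqxx mulr1n. Qed.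

Lemma householder_orth v : qf 1%:M v != 0 -> householder v *m (householder v)^T = 1%:M.
Proof.
move=> s0; set s := qf 1%:M v in s0 *.
have vv : v *m v^T = s%:M by rewrite /s /qf mulmx1 [LHS]mul11.
have tH : (householder v)^T = householder v.
  by rewrite /householder linearB /= linearZ /= trmx1 trmx_mul trmxK.
have pp : v^T *m v *m (v^T *m v) = s *: (v^T *m v).
  by rewrite mulmxA -[v^T *m v *m v^T]mulmxA vv mul_mx_scalar -scalemxAl.
have ab : 2 / s * (2 / s) * s = 2 / s + 2 / s by field.
rewrite tH /householder -/s mulmxBl !mulmxBr !mul1mx !mulmx1 -scalemxAl -scalemxAr pp !scalerA ab.
by rewrite scalerDl opprB -addrA addrK addNr addr0.
Qed.

Lemma householder_trace C Y v : qf 1%:M v != 0 -> C^T = C -> Y^T = Y ->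
  \tr (C *m (householder v *m Y *m (householder v)^T)) =
  \tr (C *m Y) - 4 / qf 1%:M v * qf (C *m Y) v + 4 / qf 1%:M v ^+ 2 * (qf C v * qf Y v).
Proof.
move=> s0 sC sY; set s := qf 1%:M v in s0 *.
have tH : (householder v)^T = householder v.
  by rewrite /householder linearB /= linearZ /= trmx1 trmx_mul trmxK.
have tr1 (S : 'M[R]_1) : \tr S = S 0 0 by rewrite /mxtrace big_ord1.
have e1 : \tr (C *m (v^T *m v *m Y)) = qf (C *m Y) v.
  rewrite -!mulmxA mulmxA mxtrace_mulC tr1 /qf -[RHS](mxE trmx_key (fun i j => (v *m (C *m Y) *m v^T) j i)).
  by rewrite -[RHS]/((v *m (C *m Y) *m v^T)^T 0 0) !trmx_mul trmxK sC sY !mulmxA.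
have e2 : \tr (C *m (Y *m (v^T *m v))) = qf (C *m Y) v.
  by rewrite !mulmxA mxtrace_mulC tr1 /qf !mulmxA.
have e3 : \tr (C *m (v^T *m v *m Y *m (v^T *m v))) = qf C v * qf Y v.
  rewrite (_ : v^T *m v *m Y *m (v^T *m v) = qf Y v *: (v^T *m v)); last first.
    rewrite -[v^T *m v *m Y]mulmxA mulmxA -[v^T *m (v *m Y) *m v^T]mulmxA [v *m Y *m v^T]mul11.
    by rewrite mul_mx_scalar -scalemxAl.
  rewrite -scalemxAr mxtraceZ mulmxA mxtrace_mulC tr1 mulrC.
  by rewrite /qf !mulmxA.
rewrite tH /householder -/s.
rewrite mulmxBl mul1mx mulmxBr mulmx1 !mulmxBl !mulmxBr.
rewrite -!(scalemxAl, scalemxAr) !scalerA !(raddfB, raddfD, raddfN) /= !mxtraceZ e1 e2.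
rewrite e3; field.
exact: s0.
Qed.

(** The orthogonal group, flattened to row vectors, where closed bounded sets are compact. *)
Definition orthv : set 'rV[R]_(n * n) := [set w | vec_mx w *m (vec_mx w)^T = 1%:M].

Lemma vec_mx_entry_continuous i k : continuous (fun w : 'rV[R]_(n * n) => (vec_mx w : 'M[R]_n) i k).
Proof. by under eq_fun do rewrite mxE; exact: coord_continuous. Qed.

Lemma continuous_bigsum (T : topologicalType) (I : Type) (s : seq I) (P : pred I) (f : I -> T -> R) :
  (forall i, continuous (f i)) -> continuous (fun x => \sum_(i <- s | P i) f i x).
Proof.
move=> hf; elim: s => [|i s IH] x.
  by under eq_fun do rewrite big_nil; exact: cvg_cst.
under eq_fun do rewrite big_cons; case: (P i) => //; last exact: IH.
by apply: cvgD; [exact: hf|exact: IH].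
Qed.

Lemma continuous_mulR (T : topologicalType) (f g : T -> R) :
  continuous f -> continuous g -> continuous (fun x => f x * g x).
Proof. by move=> hf hg x; apply: cvgM; [exact: hf|exact: hg]. Qed.

Lemma continuous_subR (T : topologicalType) (f g : T -> R) :
  continuous f -> continuous g -> continuous (fun x => f x - g x).
Proof. by move=> hf hg x; apply: cvgB; [exact: hf|exact: hg]. Qed.

Lemma orthv_compact : compact orthv.
Proof.
apply: bounded_closed_compact.
  exists 1; split=> [|M M1 w /= ow]; first exact: num_real.
  apply: le_trans (ltW M1).
  rewrite [leLHS]/Num.Def.normr/= mx_normrE; apply: bigmax_le => // -[z l] _ /=.
  rewrite ord1; case/mxvec_indexP : l => i k.
  have -> : w 0 (mxvec_index i k) = (vec_mx w : 'M[R]_n) i k by rewrite mxE.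
  move/matrixP/(_ i i): ow; rewrite !mxE eqxx (bigD1 k)//= !mxE => h.
  rewrite -[_ <= 1]/(_ <= 1) -(@ler_pXn2r _ 2%N)// ?nnegrE// expr1n real_normK ?num_real//.
  have s0 : 0 <= \sum_(l < n | l != k) (vec_mx w : 'M[R]_n) i l * (vec_mx w : 'M[R]_n)^T l i.
    by apply: sumr_ge0 => l _; rewrite [_^T _ _]mxE -expr2 sqr_ge0.
  by move: h s0; rewrite expr2 /=; lra.
pose g (w : 'rV[R]_(n * n)) := \sum_i \sum_k ((vec_mx w *m (vec_mx w)^T) i k - (i == k)%:R) ^+ 2.
have -> : orthv = g @^-1` [set 0].
  apply/seteqP; split => w /=; rewrite /orthv /g /=.
    move=> ->; rewrite big1// => i _; rewrite big1// => k _.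
    by rewrite mxE subrr expr0n.
  move=> /eqP; rewrite psumr_eq0; last first.
    by move=> i _; apply: sumr_ge0 => k _; exact: sqr_ge0.
  move=> /allP h; apply/matrixP => i k.
  have := h i (mem_index_enum _); rewrite /= psumr_eq0; last by move=> ? _; exact: sqr_ge0.
  move=> /allP/(_ k (mem_index_enum _)) /=; rewrite sqrf_eq0 subr_eq0 => /eqP ->.
  by rewrite mxE.
apply: closed_comp; last exact: closed_eq.
move=> w _; apply: continuous_bigsum => i; apply: continuous_bigsum => k.
have c1 : continuous (fun w : 'rV[R]_(n * n) => (vec_mx w *m (vec_mx w)^T) i k - (i == k)%:R).
  apply: continuous_subR; last exact: cst_continuous.
  under eq_fun do rewrite mxE; apply: continuous_bigsum => l.
  under eq_fun do rewrite [_^T _ _]mxE.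
  by apply: continuous_mulR; exact: vec_mx_entry_continuous.
under eq_fun do rewrite expr2.
by apply: continuous_mulR; exact: c1.
Qed.

(** Maximise tr(C U X U^T) over orthogonal U, with C diagonal and strictly decreasing. Householder
    reflections of a maximiser in the planes of two basis vectors show that U X U^T is diagonal with
    nonincreasing entries, so existence and ordering come together. *)
Lemma spectral_decomposition X : X^T = X -> exists x, is_lambda X x.
Proof.
move=> sX.
(* Strictly decreasing weights: their differences are positive and cancel from the inequality
   [pair]. *)
pose c : 'rV[R]_n := \row_i (n - i)%:R.
pose C := diag_mx c.
pose f (w : 'rV[R]_(n * n)) := \tr (C *m (vec_mx w *m X *m (vec_mx w)^T)).
have orth0 : orthv !=set0.
  by exists (mxvec 1%:M); rewrite /orthv /= mxvecK trmx1 mulmx1.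
have cf : continuous f.
  rewrite /f /mxtrace; apply: continuous_bigsum => i.
  under eq_fun do rewrite mul_diag_mx mxE; apply: continuous_mulR; first exact: cst_continuous.
  under eq_fun do rewrite mxE; apply: continuous_bigsum => k.
  under eq_fun do rewrite mxE [_^T _ _]mxE; apply: continuous_mulR; last exact: vec_mx_entry_continuous.
  apply: continuous_bigsum => l; apply: continuous_mulR; first exact: vec_mx_entry_continuous.
  exact: cst_continuous.
have [w0] := compact_EVT_max orth0 orthv_compact (continuous_subspaceT cf).
rewrite inE => ow0 max0.
pose U : 'M[R]_n := vec_mx w0; pose Y := U *m X *m U^T.
have UU : U *m U^T = 1%:M by exact: ow0.
have sY : Y^T = Y by rewrite /Y !trmx_mul trmxK sX mulmxA.
have sC : C^T = C by rewrite /C tr_diag_mx.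
have maxi v : qf 1%:M v != 0 -> qf C v * qf Y v <= qf 1%:M v * qf (C *m Y) v.
  move=> s0; pose H := householder v.
  have : mxvec (H *m U) \in orthv.
    rewrite inE /orthv /= mxvecK trmx_mul mulmxA -[H *m U *m U^T]mulmxA UU mulmx1.
    exact: householder_orth.
  move=> /max0; rewrite /f mxvecK -/U trmx_mul.
  rewrite (_ : H *m U *m X *m (U^T *m H^T) = H *m Y *m H^T); last by rewrite /Y !mulmxA.
  rewrite householder_trace// -/Y.
  have sp : 0 < qf 1%:M v.
    rewrite lt_neqAle eq_sym s0 qfE /=; apply: sumr_ge0 => a _.
    rewrite (bigD1 a)//= big1; last by move=> b /negbTE ba; rewrite mxE eq_sym ba mulr0 mul0r.
    by rewrite addr0 mxE eqxx mulr1 -expr2 sqr_ge0.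
  rewrite -subr_ge0 => h; rewrite -subr_ge0.
  have := mulr_ge0 (ltW (mulr_gt0 sp sp)) h.
  have aux (s q cy t : R) : s != 0 -> s * s * (t - (t - 4 / s * q + 4 / s ^+ 2 * cy)) = 4 * (s * q - cy).
    by move=> ?; field.
  rewrite aux//.
  by rewrite pmulr_rge0.
have YE : U *m X *m U^T = Y by [].
clearbody Y.
(* Maximality against the reflection along al e_i + e_k. The value al = 1 gives the ordering; a
   small al of sign opposite to [Y i k] excludes a nonzero off-diagonal entry. *)
have pair (i k : 'I_n) al : (i < k)%N ->
   0 <= al ^+ 2 * (Y i i - Y k k) + al * (Y i k * (1 - al ^+ 2)).
  move=> ik; have nik : i != k by rewrite neq_ltn ik.
  have q1 : qf 1%:M (al *: delta_mx 0 i + delta_mx 0 k) = al ^+ 2 + 1.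
    by rewrite qf_pair// !mxE !eqxx (negbTE nik) eq_sym (negbTE nik) addr0 !mulr1 mulr0 addr0.
  have := maxi (al *: delta_mx 0 i + delta_mx 0 k).
  rewrite q1 => /(_ _)/wrap[]; first by have := sqr_ge0 al; lra.
  have Yki : Y k i = Y i k by rewrite -{1}sY mxE.
  rewrite !qf_pair// /C !mul_diag_mx !mxE !eqxx (negbTE nik) eq_sym (negbTE nik) !mulr1n !mulr0n Yki.
  have cik : 0 < ((n - i)%:R - (n - k)%:R : R).
    by rewrite subr_gt0 ltr_nat; have := ltn_ord k; lia.
  move: ((n - i)%:R : R) ((n - k)%:R : R) cik => ci ck cik h.
  rewrite -(pmulr_rge0 _ cik); rewrite -subr_ge0 in h; apply: le_trans h _.
  by rewrite le_eqVlt; apply/orP; left; apply/eqP; ring.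
have ordY (i k : 'I_n) : (i < k)%N -> Y k k <= Y i i.
  by move=> ik; have := pair i k 1 ik; rewrite !expr1n; lra.
have offY (i k : 'I_n) : (i < k)%N -> Y i k = 0.
  move=> ik; apply/eqP; apply: contraT => b0.
  have D0 : 0 <= Y i i - Y k k by rewrite subr_ge0 ordY.
  pose b := Y i k; pose D := Y i i - Y k k.
  have bb : 0 < b ^+ 2 by rewrite lt_neqAle sqr_ge0 eq_sym sqrf_eq0 b0.
  (* Small enough for the linear term -t b^2 to dominate the quadratic and cubic ones when al = -t
     b. *)
  pose t := (2 * (1 + D + b ^+ 2))^-1.
  have den : 0 < 2 * (1 + D + b ^+ 2) by rewrite -/D in D0; lra.
  have t0 : 0 < t by rewrite invr_gt0.
  have tE : t * (2 * (1 + D + b ^+ 2)) = 1 by rewrite mulVf// gt_eqF.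
  have := pair i k (- (t * b)) ik; rewrite -/b -/D.
  rewrite (_ : _ + _ = (t * b ^+ 2) * (t * D - (1 - t * (t * b ^+ 2)))); last by ring.
  rewrite pmulr_rge0; last exact: mulr_gt0.
  have tD0 : 0 <= t * D by rewrite mulr_ge0// ltW.
  have tb0 := mulr_gt0 t0 bb.
  have tE' : t + t * D + t * b ^+ 2 = 1/2 by lra.
  have : t * (t * b ^+ 2) <= 1/2 * (1/2).
    by apply: ler_pM; [exact: ltW|exact: ltW|lra|lra].
  by move=> h1; rewrite leNgt => /negP[]; lra.
have dY : Y = diag_mx (\row_i Y i i).
  apply/matrixP => i k; rewrite !mxE; have [->|nik] := eqVneq i k; first by rewrite mulr1n.
  rewrite mulr0n; have [ik|ki|/val_inj e] := ltngtP i k; first exact: offY.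
    by rewrite -sY mxE offY.
  by rewrite e eqxx in nik.
exists (\row_i Y i i); split.
  move=> i j ij; rewrite !mxE; move: ij; rewrite leq_eqVlt => /predU1P[/val_inj ->//|]; exact: ordY.
exists U; split => //; rewrite -dY -YE !mulmxA (mulmx1C UU) mul1mx -mulmxA (mulmx1C UU) mulmx1.
by [].
Qed.

Lemma qf1E v : qf 1%:M v = \sum_a v 0 a ^+ 2.
Proof. by rewrite /qf mulmx1 mxE; apply: eq_bigr => a _; rewrite mxE expr2. Qed.

Lemma qf_spectral U (x : 'rV[R]_n) v :
  qf (U^T *m diag_mx x *m U) v = \sum_a x 0 a * (v *m U^T) 0 a ^+ 2.
Proof.
rewrite /qf !mulmxA -[_ *m U *m v^T]mulmxA (_ : U *m v^T = (v *m U^T)^T); last first.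
  by rewrite trmx_mul trmxK.
rewrite mul_mx_diag !mxE; apply: eq_bigr => a _; rewrite !mxE; ring.
Qed.

(** The Courant-Fischer argument: n - 1 linear conditions leave a vector [v] orthogonal to the
    eigenvectors of [X'] before [i] and to those of [X] after [i]. Its two Rayleigh quotients are at
    least [x 0 i] and at most [x' 0 i]. *)
Lemma weyl_le X X' (x x' : 'rV[R]_n) (e : R) : is_lambda X x -> is_lambda X' x' ->
  (forall a b, `|X a b - X' a b| <= e) -> forall i, x 0 i <= x' 0 i + n%:R * e.
Proof.
move=> [rx [U [UU XE]]] [rx' [U' [UU' XE']]] hX i.
(* Row [i] is zero, which makes the matrix singular and yields [v]. *)
pose N : 'M[R]_n := \matrix_(a, b) if (a < i)%N then U' a b else if (i < a)%N then U a b else 0.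
have NE a b : N a b = if (a < i)%N then U' a b else if (i < a)%N then U a b else 0 by rewrite mxE.
clearbody N.
have /det0P[v v0 vN] : \det N^T == 0.
  by rewrite det_tr (expand_det_row _ i) big1// => b _; rewrite NE !ltnn mul0r.
have vNa a : \sum_b v 0 b * N a b = 0.
  have : (v *m N^T) 0 a = 0 by rewrite vN mxE.
  rewrite mxE => h; rewrite -[RHS]h; apply: eq_bigr => b _.
  by rewrite [N^T _ _]mxE.
have z1 (a : 'I_n) : (i < a)%N -> (v *m U^T) 0 a = 0.
  move=> ia; rewrite -(vNa a) mxE; apply: eq_bigr => b _; rewrite mxE NE ia.
  by rewrite ltnNge (ltnW ia).
have z2 (a : 'I_n) : (a < i)%N -> (v *m U'^T) 0 a = 0.
  by move=> ia; rewrite -(vNa a) mxE; apply: eq_bigr => b _; rewrite mxE NE ia.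
have normU (W : 'M[R]_n) : W *m W^T = 1%:M -> \sum_a (v *m W^T) 0 a ^+ 2 = \sum_a v 0 a ^+ 2.
  move=> WW; rewrite -!qf1E /qf !mulmx1 trmx_mul trmxK mulmxA -[v *m W^T *m W]mulmxA.
  by rewrite (mulmx1C WW) mulmx1.
set s := \sum_a v 0 a ^+ 2 in normU.
have s0 : 0 < s.
  rewrite lt_neqAle sumr_ge0 ?andbT; last by move=> a _; exact: sqr_ge0.
  rewrite eq_sym psumr_eq0; last by move=> a _; exact: sqr_ge0.
  apply: contra v0 => /allP h; apply/eqP/rowP => a; rewrite mxE.
  by have := h a (mem_index_enum _); rewrite /= sqrf_eq0 => /eqP.
have lo : x 0 i * s <= qf X v.
  rewrite XE qf_spectral -(normU U UU) mulr_sumr; apply: ler_sum => a _.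
  have [ai|ia] := leqP a i; last by rewrite z1// expr0n !mulr0.
  by rewrite ler_wpM2r ?sqr_ge0// rx.
have hi : qf X' v <= x' 0 i * s.
  rewrite XE' qf_spectral -(normU U' UU') mulr_sumr; apply: ler_sum => a _.
  have [ia|ai] := leqP i a; last by rewrite z2// expr0n !mulr0.
  by rewrite ler_wpM2r ?sqr_ge0// rx'.
have dif : qf X v - qf X' v <= n%:R * e * s.
  rewrite !qfE -sumrB.
  (* The arithmetic-geometric mean bound on each product of coordinates; summing over [a] and [b]
     produces the factor n. *)
  apply: (@le_trans _ _ (\sum_(a < n) \sum_(b < n) e * ((v 0 a ^+ 2 + v 0 b ^+ 2) / 2))).
    apply: ler_sum => a _; rewrite -sumrB; apply: ler_sum => b _.
    have e0 : 0 <= e by exact: le_trans (hX a b).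
    rewrite -mulrBl -mulrBr mulrAC mulrC.
    apply: (le_trans (ler_norm _)); rewrite normrM; apply: ler_pM => //.
    have := sqr_ge0 (v 0 a - v 0 b); have := sqr_ge0 (v 0 a + v 0 b).
    by rewrite !expr2 ler_norml; lra.
  rewrite (_ : \sum_(a < n) _ = n%:R * e * s)//.
  rewrite (eq_bigr (fun a => e * ((n%:R * v 0 a ^+ 2 + s) / 2))); last first.
    move=> a _; rewrite -mulr_sumr -mulr_suml big_split /= sumr_const card_ord -/s.
    by rewrite [n%:R * _]mulr_natl.
  rewrite -mulr_sumr -mulr_suml big_split /= -mulr_sumr -/s sumr_const card_ord -[s *+ n]mulr_natl.
  by field.
have : (x 0 i - x' 0 i - n%:R * e) * s <= 0.
  rewrite !mulrBl; move: lo hi dif; move: (x 0 i * s) (x' 0 i * s) (n%:R * e * s) (qf X v) (qf X' v) => *; lra.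
by rewrite pmulr_lle0//; lra.
Qed.

Lemma weyl X X' (x x' : 'rV[R]_n) (e : R) : is_lambda X x -> is_lambda X' x' ->
  (forall a b, `|X a b - X' a b| <= e) -> forall i, `|x 0 i - x' 0 i| <= n%:R * e.
Proof.
move=> l l' h i; have := weyl_le l l' h i.
have := @weyl_le X' X x' x e l' l; move=> /(_ _ i)/wrap[]; first by move=> a b; rewrite distrC.
by rewrite ler_norml; lra.
Qed.

End Spectral.

(** * Tangent spaces of submanifolds *)

Section MatrixNorm.
Variable R : realType.

Lemma mxnorm_le p q (x : 'M[R]_(p, q)) (e : R) : 0 <= e -> (forall i j, `|x i j| <= e) -> `|x| <= e.
Proof.
by move=> e0 h; rewrite [leLHS]/Num.Def.normr/= mx_normrE; apply: bigmax_le => // -[i j] _; exact: h.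
Qed.

Lemma entry_le_mxnorm p q (x : 'M[R]_(p, q)) i j : `|x i j| <= `|x|.
Proof. by rewrite [leRHS]/Num.Def.normr/= mx_normrE; exact: (le_bigmax _ (fun ij => `|x ij.1 ij.2|) (i, j)). Qed.

Lemma mulmx_norm_le p m n (w : 'M[R]_(p, m)) (A : 'M[R]_(m, n)) : `|w *m A| <= m%:R * `|A| * `|w|.
Proof.
apply: mxnorm_le; first by rewrite !mulr_ge0.
move=> i j; rewrite mxE; apply: (le_trans (ler_norm_sum _ _ _)).
apply: (@le_trans _ _ (\sum_(k < m) `|A| * `|w|)).
  by apply: ler_sum => k _; rewrite normrM mulrC ler_pM// entry_le_mxnorm.
by rewrite sumr_const card_ord -[leLHS]mulr_natl mulrA.
Qed.

Lemma mxnorm_lt p q (x : 'M[R]_(p, q)) (e : R) : 0 < e -> (forall i j, `|x i j| < e) -> `|x| < e.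
Proof.
move=> e0 h; rewrite [ltLHS]/Num.Def.normr/= mx_normrE; apply/bigmax_ltP.
by split => // -[i j] _; exact: h.
Qed.

Lemma nbhs_mxP p q (x : 'M[R]_(p, q)) (P : set 'M[R]_(p, q)) :
  nbhs x P <-> exists2 e : R, 0 < e & forall y, `|y - x| < e -> P y.
Proof.
split=> [/nbhs_ballP[e e0 H]|[e e0 H]].
  by exists e => // y xy; apply: H; rewrite mx_norm_ball /ball_ /= distrC.
apply/nbhs_ballP; exists e => // y; rewrite mx_norm_ball /ball_ /= => xy.
by apply: H; rewrite distrC.
Qed.

Lemma common_radius (I : finType) (P : I -> R -> Prop) :
  (forall i d d', d' <= d -> P i d -> P i d') ->
  (forall i, exists2 d, 0 < d & P i d) -> exists2 d, 0 < d & forall i, P i d.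
Proof.
move=> mono H.
suff [d d0 h] : exists2 d, 0 < d & forall i, i \in enum I -> P i d.
  by exists d => // i; apply: h; rewrite mem_enum.
elim: (enum I) => [|j s [d d0 h]]; first by exists 1.
have [d' d'0 h'] := H j; exists (Num.min d d'); first by rewrite lt_min d0.
move=> i; rewrite inE => /predU1P[->|si].
  by apply: mono h'; rewrite ge_min lexx orbT.
by apply: mono (h _ si); rewrite ge_min lexx.
Qed.

Section Deriv.
Variables (V W : normedModType R).

Lemma derive_eps (f : V -> W) a v : derivable f a v -> forall e : R, 0 < e ->
  exists2 d : R, 0 < d & forall h : R, h != 0 -> `|h| < d ->
    `|derive f a v - h^-1 *: (f (h *: v + a) - f a)| < e.
Proof.
move=> df e e0; have : h^-1 *: (f (h *: v + a) - f a) @[h --> 0^'] --> derive f a v by exact: df.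
move/cvgrPdist_lt => /(_ e e0) [d /= d0 H]; exists d => // h h0 hd; apply: H => //=.
by rewrite sub0r normrN.
Qed.

Lemma derive_of_eps (f : V -> W) a v l : (forall e : R, 0 < e ->
  exists2 d : R, 0 < d & forall h : R, h != 0 -> `|h| < d ->
    `|l - h^-1 *: (f (h *: v + a) - f a)| < e) -> derivable f a v /\ derive f a v = l.
Proof.
move=> H; have c : h^-1 *: (f (h *: v + a) - f a) @[h --> 0^'] --> l.
  apply/cvgrPdist_lt => e e0; have [d d0 hd] := H e e0.
  exists d => //= h /=; rewrite sub0r normrN => hd' h0; exact: hd.
by split; [apply/cvg_ex; exists l|exact: cvg_lim c].
Qed.

End Deriv.
End MatrixNorm.

(** * Strict differentiability of C^1 maps *)

Section StrictDerivative.
Variables (R : realType) (n m : nat).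
Implicit Types (f : 'rV[R]_n -> 'rV[R]_m).

Lemma line_mean_value f (w e : 'rV[R]_n) (h a eps : R) (c : 'I_m) :
  (forall t, 0 <= t * h -> `|t| <= `|h| ->
    derivable f (w + t *: e) e /\ `|derive f (w + t *: e) e 0 c - a| <= eps) ->
  `|f (w + h *: e) 0 c - f w 0 c - h * a| <= eps * `|h|.
Proof.
move=> H; pose phi t : R := f (w + t *: e) 0 c.
pose D t : R := derive f (w + t *: e) e 0 c.
have dphi t : 0 <= t * h -> `|t| <= `|h| -> is_derive t 1 phi (D t).
  move=> t1 t2; have [df _] := H t t1 t2.
  have dfc : derivable (fun x => f x 0 c) (w + t *: e) e by move/derivable_mxP: df; exact.
  have DE : D t = derive (fun x => f x 0 c) (w + t *: e) e by rewrite /D derive_mx// mxE.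
  have E : (fun u : R => u^-1 *: ((phi \o shift t) (u *: 1) - phi t)) =
           (fun u : R => u^-1 *: (((fun x => f x 0 c) \o shift (w + t *: e)) (u *: e) - f (w + t *: e) 0 c)).
    apply/funext => u; rewrite /phi /=; congr (_ *: (f _ 0 c - _)).
    by rewrite [u%:A]mulr1 scalerDl addrCA.
  split; first by rewrite /derivable E.
  by rewrite /derive E DE.
have fin t : 0 <= t * h -> `|t| <= `|h| -> phi h - phi 0 = D t * h ->
    `|f (w + h *: e) 0 c - f w 0 c - h * a| <= eps * `|h|.
  move=> t1 t2; rewrite /phi scale0r addr0 => ->; rewrite [h * a]mulrC -mulrBl normrM.
  by rewrite ler_wpM2r//; exact: (H t t1 t2).2.
have [h0|h0] := leP 0 h.
  have inI t : t \in `[0, h]%R -> 0 <= t * h /\ `|t| <= `|h|.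
    by rewrite in_itv /= => /andP[a1 a2]; rewrite mulr_ge0// !ger0_norm.
  have [||t /inI[t1 t2]] := @MVT_segment R phi D 0 h h0; last by rewrite subr0; exact: fin.
    by move=> t /subset_itv_oo_cc /inI[]; exact: dphi.
  apply: derivable_within_continuous => t /inI[t1 t2].
  by case: (dphi t t1 t2).
have inI t : t \in `[h, 0]%R -> 0 <= t * h /\ `|t| <= `|h|.
  rewrite in_itv /= => /andP[a1 a2]; rewrite mulr_le0 ?(ltW h0)//; split => //.
  by rewrite !ler0_norm ?(ltW h0)// lerN2.
have [||t /inI[t1 t2]] := @MVT_segment R phi D h 0 (ltW h0).
- by move=> t /subset_itv_oo_cc /inI[]; exact: dphi.
- apply: derivable_within_continuous => t /inI[t1 t2].
  by case: (dphi t t1 t2).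
- move=> E; apply: (fin t) => //; rewrite -[LHS]opprB E sub0r mulrN opprK; done.
Qed.

Definition jacobian f (x : 'rV[R]_n) : 'M[R]_(n, m) := \matrix_(i < n) derive f x (delta_mx 0 i).

Lemma jacobianE f x i c : jacobian f x i c = derive f x (delta_mx 0 i) 0 c.
Proof. by rewrite /jacobian !mxE. Qed.

(** Only directional derivatives are at hand, so [z] is moved to [y] one coordinate at a time and
    the mean value theorem is applied on each segment; the errors add up over n coordinates. *)
Lemma C1_strict_derivative (U : set 'rV[R]_n) f x : open U -> U x -> C1on U f ->
  forall eps : R, 0 < eps -> exists2 d : R, 0 < d & forall y, `|y - x| < d -> U y /\
    forall z, `|z - x| < d -> `|f y - f z - (y - z) *m jacobian f x| <= eps * `|y - z|.
Proof.
move=> oU Ux C1 eps eps0.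
pose e' := eps / n.+1%:R.
have e'0 : 0 < e' by rewrite divr_gt0.
have [d0 d00 HU] : exists2 d : R, 0 < d & forall y, `|y - x| < d -> U y.
  by apply/nbhs_mxP; exact: open_nbhs_nbhs.
have [d1 d10 HD] : exists2 d : R, 0 < d & forall i : 'I_n, forall y, `|y - x| < d ->
    `|derive f x (delta_mx 0 i) - derive f y (delta_mx 0 i)| < e'.
  apply: common_radius => [i d d' dd' Hd y yd|i]; first by apply: Hd; exact: lt_le_trans dd'.
  have [_] := C1 (delta_mx 0 i); rewrite continuous_open_subspace// => /(_ x).
  rewrite inE => /(_ Ux) /cvgrPdist_lt /(_ _ e'0) /nbhs_mxP[d d_gt0 Hd].
  by exists d => // y yd; exact: Hd.
pose d := Num.min d0 d1.
have d_gt0 : 0 < d by rewrite lt_min d00.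
have H' y : `|y - x| < d -> U y /\ forall i : 'I_n, `|derive f x (delta_mx 0 i) - derive f y (delta_mx 0 i)| < e'.
  by rewrite lt_min => /andP[y0 y1]; split => [|i]; [exact: HU|exact: HD].
exists d => // y yd; split=> [|z zd]; first exact: (H' y yd).1.
pose w (k : nat) : 'rV[R]_n := \row_i if (i < k)%N then y 0 i else z 0 i.
have w0 : w 0%N = z by apply/rowP => i; rewrite mxE.
have wn : w n = y by apply/rowP => i; rewrite mxE ltn_ord.
have wS (k : 'I_n) : w k.+1 = w k + (y 0 k - z 0 k) *: delta_mx 0 k.
  apply/rowP => i; rewrite !mxE eqxx /= ltnS leq_eqVlt.
  have [->|ik] := eqVneq i k; first by rewrite eqxx ltnn /= mulr1 addrC subrK.
  by rewrite mulr0 addr0 (inj_eq val_inj) (negbTE ik).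
(* The norm is the maximum norm, so its balls are boxes and contain the whole axis-parallel path. *)
have inb (k : 'I_n) t : 0 <= t * (y 0 k - z 0 k) -> `|t| <= `|y 0 k - z 0 k| ->
    `|w k + t *: delta_mx 0 k - x| < d.
  move=> t1 t2; apply: mxnorm_lt => // i0 i; rewrite ord1 {i0}.
  have yi : `|y 0 i - x 0 i| < d.
    by apply: le_lt_trans yd; have := entry_le_mxnorm (y - x) 0 i; rewrite !mxE.
  have zi : `|z 0 i - x 0 i| < d.
    by apply: le_lt_trans zd; have := entry_le_mxnorm (z - x) 0 i; rewrite !mxE.
  rewrite !mxE eqxx /=; have [ik|ik] := eqVneq i k; last first.
    by rewrite mulr0 addr0; case: ifP.
  rewrite ik ltnn mulr1; rewrite -ik in t1 t2 *.
  move: yi zi; rewrite !ltr_norml => /andP[y1 y2] /andP[z1 z2].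
  have [h0|h0] := leP 0 (y 0 i - z 0 i).
    have t0 : 0 <= t.
      move: h0; rewrite le_eqVlt => /predU1P[h0|h0]; last by rewrite pmulr_lge0 in t1.
      by move: t2; rewrite -h0 normr0 normr_le0 => /eqP ->.
    by move: t2; rewrite !ger0_norm// => t2; apply/andP; split; lra.
  have t0 : t <= 0 by rewrite nmulr_lge0 in t1.
  move: t2; rewrite !ler0_norm ?(ltW h0)// => t2; apply/andP; split; lra.
apply: mxnorm_le; first by rewrite mulr_ge0// ltW.
move=> i0 c; rewrite ord1 {i0}.
have -> : (f y - f z - (y - z) *m jacobian f x) 0 c =
    \sum_(k < n) (f (w k.+1) 0 c - f (w k) 0 c - (y 0 k - z 0 k) * jacobian f x k c).
  rewrite sumrB -(big_mkord xpredT (fun k => f (w k.+1) 0 c - f (w k) 0 c)) telescope_sumr// w0 wn.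
  rewrite !mxE; congr (_ - _); apply: eq_bigr => k _.
  by rewrite !mxE.
apply: (le_trans (ler_norm_sum _ _ _)).
apply: (@le_trans _ _ (\sum_(k < n) e' * `|y - z|)).
  apply: ler_sum => k _; apply: (@le_trans _ _ (e' * `|y 0 k - z 0 k|)); last first.
    rewrite ler_wpM2l ?(ltW e'0)//.
    by have := entry_le_mxnorm (y - z) 0 k; rewrite !mxE.
  rewrite wS jacobianE; apply: line_mean_value => t t1 t2.
  have [Uw Dw] := H' _ (inb k t t1 t2); split; first exact: (C1 _).1.
  rewrite distrC; apply: ltW; apply: le_lt_trans (Dw k).
  by have := entry_le_mxnorm (derive f x (delta_mx 0 k) - derive f (w k + t *: delta_mx 0 k) (delta_mx 0 k)) 0 c; rewrite !mxE.
rewrite sumr_const card_ord -[leLHS]mulr_natl mulrA ler_wpM2r//.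
rewrite /e' mulrCA ler_piMr ?(ltW eps0)// ler_pdivrMr// mul1r ler_nat.
exact: leqnSn.
Qed.

End StrictDerivative.

Lemma dotvE (R : realType) n (x y : 'rV[R]_n) : dotv x y = (x *m y^T) 0 0.
Proof. by rewrite mxE; apply: eq_bigr => i _; rewrite mxE. Qed.

Lemma dotvv_eq0 (R : realType) n (x : 'rV[R]_n) : dotv x x = 0 -> x = 0.
Proof.
move=> h; apply/rowP => i; rewrite mxE; apply/eqP; rewrite -sqrf_eq0.
move/eqP: h; rewrite psumr_eq0; last by move=> j _; rewrite -expr2 sqr_ge0.
by move=> /allP/(_ i (mem_index_enum _)) /=; rewrite -expr2.
Qed.

(** The Moore-Penrose inverse (J^T J)^-1 J^T. Its image is orthogonal to the kernel of [J], so
    corrections of the form [w *m A] are normal to the manifold. *)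
Lemma orth_right_inverse (R : realType) n m (J : 'M[R]_(n, m)) : (forall w : 'rV[R]_m, exists v : 'rV[R]_n, v *m J = w) ->
  exists2 A : 'M[R]_(m, n), A *m J = 1%:M & forall (v : 'rV[R]_n) (w : 'rV[R]_m), v *m J = 0 -> dotv (w *m A) v = 0.
Proof.
move=> sJ; have [g gE] := choice sJ.
pose B : 'M[R]_(m, n) := \matrix_i g (delta_mx 0 i).
have BJ : B *m J = 1%:M by apply/row_matrixP => i; rewrite row_mul rowK gE rowE mulmx1.
have uJ : J^T *m J \in unitmx.
  rewrite -row_free_unit -kermx_eq0; apply/rowV0P => u /sub_kermxP uJJ.
  have uJ0 : u *m J^T = 0.
    apply: dotvv_eq0; rewrite dotvE trmx_mul trmxK mulmxA -(mulmxA u) uJJ mul0mx.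
    by rewrite mxE.
  by rewrite -[u]mulmx1 -trmx1 -BJ trmx_mul mulmxA uJ0 mul0mx.
exists (invmx (J^T *m J) *m J^T); first by rewrite -mulmxA mulVmx.
move=> v w vJ; rewrite dotvE -!mulmxA -trmx_mul vJ trmx0 !mulmx0.
by rewrite mxE.
Qed.

Lemma continuous_at_eps (R : realType) m (g : 'rV[R]_m -> R) (w : 'rV[R]_m) :
  (forall e : R, 0 < e -> exists2 d : R, 0 < d & forall w', `|w' - w| < d -> `|g w - g w'| < e) ->
  {for w, continuous g}.
Proof.
move=> H; apply: (proj2 (@cvgrPdist_lt _ _ _ (nbhs w) (nbhs_filter w) g (g w))) => e e0.
by apply/nbhs_mxP; exact: H.
Qed.

(** * Implicit function theorem in normal slices *)

Section LocalSolution.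
Variables (R : realType) (n m : nat) (f : 'rV[R]_n -> 'rV[R]_m) (x : 'rV[R]_n).
Variables (U : set 'rV[R]_n) (J : 'M[R]_(n, m)) (A : 'M[R]_(m, n)).
Hypothesis strict : forall eps : R, 0 < eps -> exists2 d : R, 0 < d & forall y, `|y - x| < d -> U y /\
    forall z, `|z - x| < d -> `|f y - f z - (y - z) *m J| <= eps * `|y - z|.
Hypothesis AJ : A *m J = 1%:M.

Lemma derive_strict v : derivable f x v /\ derive f x v = v *m J.
Proof.
apply: derive_of_eps => e e0.
have v1 : 0 < `|v| + 1 by rewrite ltr_pwDr.
have [d d0 H] := strict (divr_gt0 e0 (mulr_gt0 (ltr0n _ 2) v1)).
exists (d / (`|v| + 1)); first by rewrite divr_gt0.
move=> h h0 hd.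
have hv : `|h *: v + x - x| < d.
  rewrite addrK normrZ; rewrite ltr_pdivlMr// in hd; apply: le_lt_trans hd.
  by rewrite ler_wpM2l// lerDl.
have xx : `|x - x| < d by rewrite subrr normr0.
have := (H _ hv).2 x xx; rewrite addrK -scalemxAl normrZ => K.
have -> : v *m J - h^-1 *: (f (h *: v + x) - f x) = - h^-1 *: (f (h *: v + x) - f x - h *: (v *m J)).
  set F := f _ - f x.
  by rewrite scaleNr [h^-1 *: (F - _)]scalerBr opprB scalerA mulVf// scale1r.
rewrite normrZ normrN normfV; apply: (@le_lt_trans _ _ (e / (2 * (`|v| + 1)) * `|v|)).
  rewrite ler_pdivrMl ?normr_gt0//; apply: (le_trans K).
  by rewrite mulrCA.
rewrite mulrAC ltr_pdivrMr ?mulr_gt0//; have := mulr_ge0 (ltW e0) (normr_ge0 v); lra.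
Qed.

Let C := m%:R * `|A| + 1.
Let C0 : 0 < C. Proof. by rewrite ltr_wpDl// mulr_ge0. Qed.
Let AC (w : 'rV[R]_m) : `|w *m A| <= C * `|w|.
Proof. by apply: (le_trans (mulmx_norm_le _ _)); rewrite ler_wpM2r// lerDl. Qed.

(** For a difference [w *m A] the linear part of [f] is [w] itself, and the error is at most half of
    [w]; so equal values force w = 0. *)
Lemma local_unique : exists2 d : R, 0 < d & forall y z (w : 'rV[R]_m), `|y - x| < d -> `|z - x| < d ->
  f y = f z -> y - z = w *m A -> y = z.
Proof.
have eps0 : 0 < (2 * C)^-1 by rewrite invr_gt0 mulr_gt0.
have [d d0 H] := strict eps0; exists d => // y z w yd zd fyz yz.
have := (H y yd).2 z zd; rewrite fyz subrr sub0r normrN yz -mulmxA AJ mulmx1 => K.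
have : `|w| <= `|w| / 2.
  apply: (le_trans K); rewrite ler_pdivrMl ?mulr_gt0//; apply: (le_trans (AC w)).
  by lra.
move=> h; have w0 : w = 0.
  by apply/eqP; rewrite -normr_le0; lra.
by apply/eqP; rewrite -subr_eq0 yz w0 mul0mx.
Qed.

(** Existence by minimising |f| over a compact ball of corrections: at a nonzero minimum one Newton
    step would halve the value. The base point [y] is any zero near [x], as the density argument
    requires; the bound by |f(y + v)| makes the corrected line differentiable at [x]. *)
Lemma local_solution : exists2 d : R, 0 < d & forall y v, `|y - x| < d -> `|v| < d -> f y = 0 -> v *m J = 0 ->
  exists w : 'rV[R]_m, [/\ U (y + v + w *m A), f (y + v + w *m A) = 0, `|w| <= 2 * `|f (y + v)| & `|w *m A| <= `|v|].
Proof.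
have eps0 : 0 < (2 * C)^-1 by rewrite invr_gt0 mulr_gt0.
have [d0 d00 H] := strict eps0; exists (d0 / 4); first by rewrite divr_gt0.
move=> y v yd vd fy vJ.
have yd0 : `|y - x| < d0 by lra.
have yvd : `|y + v - x| < d0.
  rewrite addrAC; apply: le_lt_trans (ler_normD _ _) _; lra.
have fyv : `|f (y + v)| <= (2 * C)^-1 * `|v|.
  have := (H _ yvd).2 y yd0; rewrite fy subr0 addrAC subrr add0r vJ subr0.
  by [].
(* Twice the residual: the Newton step from any point of this ball stays inside it. *)
pose rho := 2 * `|f (y + v)|.
have rho0 : 0 <= rho by rewrite mulr_ge0.
have Crho : C * rho <= `|v|.
  rewrite /rho mulrCA mulrA -ler_pdivlMl ?mulr_gt0//.
pose B : set 'rV[R]_m := [set w | `|w| <= rho].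
pose g (w : 'rV[R]_m) : R := `|f (y + v + w *m A)|.
have inb (w : 'rV[R]_m) : `|w| <= rho -> `|y + v + w *m A - x| < d0 * 3 / 4.
  move=> wr; rewrite -(addrA y) addrAC; apply: le_lt_trans (ler_normD _ _) _.
  have := ler_normD v (w *m A); have := AC w; have := ler_wpM2l (ltW C0) wr; lra.
have estim (w w' : 'rV[R]_m) : `|y + v + w *m A - x| < d0 -> `|y + v + w' *m A - x| < d0 ->
   `|f (y + v + w *m A) - f (y + v + w' *m A) - (w - w')| <= `|w - w'| / 2.
  move=> i1 i2; have := (H _ i1).2 _ i2.
  have -> : y + v + w *m A - (y + v + w' *m A) = (w - w') *m A.
    by rewrite opprD addrACA subrr add0r mulmxBl.
  rewrite -mulmxA AJ mulmx1 => /le_trans; apply.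
  rewrite ler_pdivrMl ?mulr_gt0//; apply: (le_trans (AC _)); lra.
have [w0 Bw0 min0] : exists2 c, c \in B & forall t, t \in B -> g c <= g t.
  apply: EVT_min_rV.
  - by exists 0; rewrite /B /= normr0.
  - apply: bounded_closed_compact.
      by exists rho; split => [|M M1 w /= Bw]; [exact: num_real|exact: le_trans (ltW M1)].
    have -> : B = (fun w : 'rV[R]_m => `|w|) @^-1` [set t | t <= rho] by [].
    apply: closed_comp; last exact: closed_le.
    by move=> w _; exact: norm_continuous.
  - apply: continuous_in_subspaceT => w; rewrite inE => Bw.
    apply: continuous_at_eps => e e0.
    exists (Num.min (e / 4) (d0 / (4 * C))).
      by rewrite lt_min !divr_gt0// mulr_gt0.
    move=> w'; rewrite lt_min => /andP[w1 w2].
    have i1 : `|y + v + w *m A - x| < d0 by have := inb w Bw; lra.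
    have i2 : `|y + v + w' *m A - x| < d0.
      have -> : y + v + w' *m A - x = (y + v + w *m A - x) + (w' - w) *m A.
        rewrite mulmxBl [RHS]addrAC; congr (_ - _).
        by rewrite -[RHS]addrA [X in _ = _ + X]addrC subrK.
      apply: le_lt_trans (ler_normD _ _) _.
      have := inb w Bw; have := AC (w' - w).
      have := w2; rewrite ltr_pdivlMr ?mulr_gt0//; lra.
    have K := estim w w' i1 i2.
    apply: le_lt_trans (ler_dist_dist _ _) _.
    rewrite -[X in `|X|](subrK (w - w')); apply: le_lt_trans (ler_normD _ _) _.
    rewrite distrC in w1; lra.
rewrite inE in Bw0; have w0r : `|w0| <= rho by [].
have i0 : `|y + v + w0 *m A - x| < d0 by have := inb w0 w0r; lra.
exists w0; split => //.
- exact: (H _ i0).1.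
- apply/eqP; rewrite -normr_le0; apply: contraT; rewrite -ltNge => f0.
  pose w1 := w0 - f (y + v + w0 *m A).
  have w1r : `|w1| <= rho.
    have e0 : y + v + 0 *m A = y + v by rewrite mul0mx addr0.
    have K := estim w0 0; rewrite e0 subr0 in K; have {}K := K i0 yvd.
    have -> : w1 = - f (y + v) - (f (y + v + w0 *m A) - f (y + v) - w0).
      by rewrite !opprB addrCA addKr.
    apply: (le_trans (ler_normB _ _)); rewrite normrN.
    have : `|f (y + v)| = rho / 2 by rewrite /rho; lra.
    lra.
  have i1 : `|y + v + w1 *m A - x| < d0 by have := inb w1 w1r; lra.
  have := estim w1 w0 i1 i0.
  have -> : w1 - w0 = - f (y + v + w0 *m A) by rewrite /w1 addrAC subrr add0r.
  rewrite opprK subrK normrN => K.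
  have : g w0 <= g w1 by apply: min0; rewrite inE.
  rewrite /g => K'; lra.
- apply: (le_trans (AC _)); apply: le_trans Crho.
  by rewrite ler_wpM2l// ltW.
Qed.

Variable M : set 'rV[R]_n.
Hypothesis Mx : M x.
Hypothesis Ux : U x.
Hypothesis MU : M `&` U = [set y | U y /\ f y = 0].

Lemma mem_zeros y : U y -> f y = 0 -> M y.
Proof. by move=> Uy fy; have [] : (M `&` U) y by rewrite MU; split.  Qed.

Lemma zeros_mem y : U y -> M y -> f y = 0.
Proof. by move=> Uy My; have : (M `&` U) y by []; rewrite MU => -[]. Qed.

(** From left to right, the strict estimate is applied to difference quotients of the curve.
    Conversely the line x + t v is corrected to a curve in [M], and the correction is o(t) because
    f(x + t v) is. *)
Lemma tangent_kernel v : mfd_tangent M x v <-> v *m J = 0.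
Proof.
have fx : f x = 0 by exact: zeros_mem.
split=> [[g [g0 [e e0 Mg] dg <-]]|vJ].
  set v0 := derive g 0 1.
  pose CJ := n%:R * `|J|.
  have CJ0 : 0 <= CJ by rewrite mulr_ge0.
  have key eps : 0 < eps -> eps <= 1 -> `|v0 *m J| <= eps * (CJ + `|v0| + 1).
    move=> eps0 eps1; have [d d0 H] := strict eps0.
    have [d1 d10 K] := derive_eps dg eps0.
    have v2 : 0 < `|v0| + 2 by rewrite ltr_wpDl.
    pose h := Num.min (Num.min (e / 2) (d1 / 2)) (d / 2 / (`|v0| + 2)).
    have h0 : 0 < h by rewrite !lt_min !divr_gt0.
    have nh : `|h| = h by rewrite gtr0_norm.
    have he : h <= e / 2 by rewrite !ge_min lexx.
    have hd1 : h <= d1 / 2 by rewrite !ge_min lexx orbT.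
    have hd : h * (`|v0| + 2) <= d / 2 by rewrite -ler_pdivlMr// !ge_min lexx !orbT.
    have Mgh : M (g h) by apply: Mg; rewrite nh; lra.
    have := K h (lt0r_neq0 h0); rewrite nh [h *: 1]mulr1 addr0 g0 => /(_ _)/wrap[]; first by lra.
    set q := h^-1 *: (g h - x) => Kq.
    have ghq : g h - x = h *: q by rewrite /q scalerA mulfV ?gt_eqF// scale1r.
    rewrite -/v0 in Kq; clearbody q.
    have nq : `|q| <= `|v0| + 1.
      rewrite -[q](subrK v0); apply: (le_trans (ler_normD _ _)); rewrite distrC; lra.
    have ghd : `|g h - x| < d.
      rewrite ghq normrZ nh; have := ler_wpM2l (ltW h0) nq; lra.
    have [Ugh Hgh] := H _ ghd.
    have xx : `|x - x| < d by rewrite subrr normr0.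
    have := Hgh x xx; rewrite fx (zeros_mem Ugh Mgh) subrr sub0r normrN ghq -scalemxAl !normrZ nh.
    rewrite mulrCA ler_pM2l// => qJ.
    rewrite -[X in X *m J](subrK q) mulmxDl; apply: (le_trans (ler_normD _ _)).
    have := mulmx_norm_le (v0 - q) J; rewrite -/CJ => a1.
    have a2 := ler_wpM2l CJ0 (ltW Kq).
    have a3 := ler_wpM2l (ltW eps0) nq.
    lra.
  apply/eqP; rewrite -normr_le0; apply/ler_addgt0Pr => t t0; rewrite add0r.
  have s0 : 0 < CJ + `|v0| + 1 by rewrite ltr_pwDr// addr_ge0.
  pose eps := Num.min 1 (t / (CJ + `|v0| + 1)).
  have eps0 : 0 < eps by rewrite lt_min ltr01 divr_gt0.
  apply: le_trans (key eps eps0 _) _; first by rewrite ge_min lexx.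
  by rewrite -ler_pdivlMr// ge_min lexx orbT.
have [d d0 H] := local_solution.
have v1 : 0 < `|v| + 1 by rewrite ltr_pwDr.
have small t : `|t| < d / (`|v| + 1) -> `|t *: v| < d.
  rewrite ltr_pdivlMr// normrZ; apply: le_lt_trans; by rewrite ler_wpM2l// lerDl.
have ex t : exists w : 'rV[R]_m, `|t| < d / (`|v| + 1) ->
    [/\ U (x + t *: v + w *m A), f (x + t *: v + w *m A) = 0, `|w| <= 2 * `|f (x + t *: v)| & `|w *m A| <= `|t *: v|].
  have [td|td] := pselect (`|t| < d / (`|v| + 1)); last by exists 0.
  have [||||w Hw] := H x (t *: v); last by exists w.
  - by rewrite subrr normr0.
  - exact: small.
  - by [].
  - by rewrite -scalemxAl vJ scaler0.
have [w Hw] := choice ex.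
have w0 : w 0 = 0.
  have [|_ _ + _] := Hw 0; first by rewrite normr0 divr_gt0.
  by rewrite scale0r addr0 fx normr0 mulr0 normr_le0 => /eqP.
pose g (t : R) := x + t *: v + w t *m A.
have g0 : g 0 = x by rewrite /g w0 scale0r mul0mx !addr0.
have [dg Dg] : derivable g 0 1 /\ derive g 0 1 = v.
  apply: derive_of_eps => e e0.
  have eps0 : 0 < e / (4 * C * (`|v| + 1)) by rewrite divr_gt0// !mulr_gt0.
  have [d1 d10 K] := strict eps0.
  exists (Num.min (d / (`|v| + 1)) (d1 / (`|v| + 1))).
    by rewrite lt_min !divr_gt0.
  move=> h h0; rewrite lt_min => /andP[hd hd1].
  rewrite [h *: 1]mulr1 addr0 g0 /g.
  have -> : v - h^-1 *: (x + h *: v + w h *m A - x) = - h^-1 *: (w h *m A).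
    rewrite -(addrA x) addrAC subrr add0r scalerDr scalerA mulVf// scale1r opprD addrA subrr sub0r scaleNr.
    by [].
  have hv : `|h *: v| < d1.
    rewrite normrZ; rewrite ltr_pdivlMr// in hd1; apply: le_lt_trans hd1.
    by rewrite ler_wpM2l// lerDl.
  have xh : `|x + h *: v - x| < d1 by rewrite addrAC subrr add0r.
  have xx : `|x - x| < d1 by rewrite subrr normr0.
  have := (K _ xh).2 x xx; rewrite fx subr0 addrAC subrr add0r -scalemxAl vJ scaler0 subr0 normrZ => fb.
  have [_ _ wb _] := Hw h hd.
  have hp : 0 < `|h| by rewrite normr_gt0.
  rewrite normrZ normrN normfV ltr_pdivrMl//.
  apply: le_lt_trans (AC _) _.
  have : C * `|w h| <= C * (2 * (e / (4 * C * (`|v| + 1)) * (`|h| * `|v|))).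
    rewrite ler_wpM2l ?(ltW C0)//; apply: (le_trans wb); rewrite ler_wpM2l//.
  move=> /le_lt_trans; apply.
  have -> : C * (2 * (e / (4 * C * (`|v| + 1)) * (`|h| * `|v|))) = `|h| * (e * (`|v| / (`|v| + 1)) / 2).
    by field; rewrite !gt_eqF.
  rewrite ltr_pM2l//.
  have : e * (`|v| / (`|v| + 1)) <= e by rewrite ler_piMr ?(ltW e0)// ler_pdivrMr// mul1r lerDl.
  lra.
exists g; split => //; exists (d / (`|v| + 1)); first by rewrite divr_gt0.
by move=> t td; have [Ut ft _ _] := Hw t td; exact: mem_zeros.
Qed.

End LocalSolution.

(** * Locally symmetric submanifolds *)

Section Submanifold.
Variables (R : realType) (n d : nat) (M : set 'rV[R]_n).
Hypothesis subM : C2_submanifold M d.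

Lemma submanifold_local x : M x -> exists (J : 'M[R]_(n, n - d)) (A : 'M[R]_(n - d, n)),
  [/\ A *m J = 1%:M, forall (v : 'rV_n) (w : 'rV_(n - d)), v *m J = 0 -> dotv (w *m A) v = 0,
   forall v, mfd_tangent M x v <-> v *m J = 0,
   exists2 r : R, 0 < r & forall y z (w : 'rV_(n - d)), M y -> M z -> `|y - x| < r -> `|z - x| < r ->
     y - z = w *m A -> y = z &
   exists2 r : R, 0 < r & forall y v, M y -> `|y - x| < r -> `|v| < r -> v *m J = 0 ->
     exists w : 'rV_(n - d), M (y + v + w *m A) /\ `|w *m A| <= `|v| ].
Proof.
move=> Mx; have [_ /(_ x Mx)[U [F [oU Ux [C1F _] sF MU]]]] := subM.
have strict := C1_strict_derivative oU Ux C1F.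
set J := jacobian F x in strict.
have [A AJ oA] : exists2 A : 'M[R]_(n - d, n), A *m J = 1%:M &
    forall (v : 'rV_n) (w : 'rV_(n - d)), v *m J = 0 -> dotv (w *m A) v = 0.
  apply: orth_right_inverse => w; have [v <-] := sF w; exists v.
  by rewrite (derive_strict strict v).2.
have [r0 r00 H0] := strict _ (@ltr01 R).
exists J, A; split => //.
- by move=> v; exact: (tangent_kernel strict AJ Mx Ux MU v).
- have [r1 r10 H1] := local_unique strict AJ; exists (Num.min r0 r1); first by rewrite lt_min r00.
  move=> y z w My Mz; rewrite !lt_min => /andP[y0 y1] /andP[z0 z1]; apply: H1 => //.
  by rewrite (zeros_mem MU (H0 _ y0).1 My) (zeros_mem MU (H0 _ z0).1 Mz).
- have [r1 r10 H1] := local_solution strict AJ; exists (Num.min r0 r1); first by rewrite lt_min r00.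
  move=> y v My; rewrite !lt_min => /andP[y0 y1] /andP[v0 v1] vJ.
  have [w [Uw fw _ wA]] := H1 y v y1 v1 (zeros_mem MU (H0 _ y0).1 My) vJ.
  by exists w; split => //; exact: mem_zeros MU _ Uw fw.
Qed.

Lemma orth_tangent_complement m (J : 'M[R]_(n, m)) (A : 'M[R]_(m, n)) (u : 'rV[R]_n) : A *m J = 1%:M ->
  (forall (v : 'rV_n) (w : 'rV_m), v *m J = 0 -> dotv (w *m A) v = 0) ->
  (forall v, v *m J = 0 -> dotv u v = 0) -> u = u *m J *m A.
Proof.
move=> AJ oA uv; pose k := u - u *m J *m A.
have kJ : k *m J = 0 by rewrite /k mulmxBl -[u *m J *m A *m J]mulmxA AJ mulmx1 subrr.
apply/eqP; rewrite -subr_eq0 -/k; apply/eqP/dotvv_eq0.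
have := uv k kJ; have := oA k (u *m J) kJ; rewrite !dotvE {3}/k mulmxBl !mxE => h1 h2.
by rewrite h2 h1 subrr.
Qed.

Lemma submanifold_tangent_dim x : M x -> subspace_dim (mfd_tangent M x) d.
Proof.
move=> Mx; have [J [A [AJ oA TJ _ _]]] := submanifold_local Mx.
have rJ : \rank J = (n - d)%N.
  apply/eqP; rewrite eqn_leq rank_leq_col /= -{1}(mxrank1 R (n - d)) -AJ.
  exact: mxrankM_maxr.
have rK : \rank (kermx J) = d.
  by rewrite mxrank_ker rJ subKn//; case: subM.
rewrite -rK; exists (row_base (kermx J)); split; first exact: row_base_free.
by move=> v; rewrite TJ eq_row_base; split => /sub_kermxP.
Qed.

Lemma dotv_diff i j (v : 'rV[R]_n) : dotv (delta_mx 0 i - delta_mx 0 j) v = v 0 i - v 0 j.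
Proof. by rewrite dotvE mulmxBl -!rowE !mxE. Qed.

Lemma dotvC (u v : 'rV[R]_n) : dotv u v = dotv v u.
Proof. by apply: eq_bigr => i _; rewrite mulrC. Qed.

Definition swap (i j : 'I_n) (y : 'rV[R]_n) := perm_act (tperm i j) y.

Lemma swapE i j (y : 'rV[R]_n) k : swap i j y 0 k = y 0 (tperm i j k).
Proof. by rewrite /swap /perm_act mxE tpermV. Qed.

(** A transposition moves points only along e_i - e_j, so the alternative is whether this single
    vector is tangent or normal. *)
Lemma sub_swap i j (y : 'rV[R]_n) : y - swap i j y = (y 0 i - y 0 j) *: (delta_mx 0 i - delta_mx 0 j).
Proof.
apply/rowP => k; rewrite !mxE tpermV !eqxx /=.
have [->|->|ki kj] := tpermP i j k.
- have [ij|ij] := eqVneq i j; rewrite ?ij ?subrr ?mulr0 ?mul0r//.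
  by rewrite eqxx subr0 mulr1.
- have [ij|ij] := eqVneq j i; rewrite ?ij ?subrr ?mulr0 ?mul0r//.
  by rewrite eqxx sub0r mulrN1 opprB.
- by move/eqP/negbTE: ki => ->; move/eqP/negbTE: kj => ->; rewrite !subrr mulr0.
Qed.

Lemma swap_fix i j (y : 'rV[R]_n) : y 0 i = y 0 j -> swap i j y = y.
Proof. by move=> e; apply/esym/eqP; rewrite -subr_eq0 sub_swap e subrr scale0r. Qed.

Lemma eball_near (x : 'rV[R]_n) (r : R) : 0 < r -> exists2 e : R, 0 < e & forall y, `|y - x| < e -> eball x r y.
Proof.
move=> r0; exists (r / n.+1%:R); first by rewrite divr_gt0.
move=> y yx; rewrite /eball /=.
apply: (@le_lt_trans _ _ (\sum_(i < n) (r / n.+1%:R) ^+ 2)).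
  apply: ler_sum => i _; rewrite -[leLHS]real_normK ?num_real// lerXn2r ?nnegrE// ?divr_ge0 ?(ltW r0)//.
  by apply: (le_trans _ (ltW yx)); have := entry_le_mxnorm (y - x) 0 i; rewrite !mxE.
rewrite sumr_const card_ord expr_div_n -[ltLHS]mulr_natl mulrCA gtr_pMr ?exprn_gt0//.
rewrite ltr_pdivrMr ?exprn_gt0// mul1r -natrX ltr_nat; lia.
Qed.

Hypothesis locM : locally_symmetric M.

Lemma locally_symmetric_swap (x : 'rV[R]_n) i j : M x -> x 0 i = x 0 j ->
  exists2 e : R, 0 < e & forall y, M y -> `|y - x| < e -> M (swap i j y).
Proof.
move=> Mx xij; have [_ /(_ x Mx)[del del0 H]] := locM.
have [e e0 He] := eball_near x del0; exists e => // y My yx.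
have Mxx : (M `&` eball x del) x by split => //; apply: He; rewrite subrr normr0.
suff : (perm_act (tperm i j) @` (M `&` eball x del)) (swap i j y).
  by rewrite (H x (tperm i j) Mxx (swap_fix xij)) => -[].
by exists y => //; split => //; exact: He.
Qed.

Lemma tangent_swap (x : 'rV[R]_n) i j v : M x -> x 0 i = x 0 j -> mfd_tangent M x v -> mfd_tangent M x (swap i j v).
Proof.
move=> Mx xij [g [g0 [e e0 Mg] dg Dg]].
have [e1 e10 H] := locally_symmetric_swap Mx xij.
have gd : exists2 r : R, 0 < r & forall t, `|t| < r -> `|g t - x| < e1.
  have [r r0 K] := derive_eps dg (@ltr01 R).
  have v1 : 0 < `|v| + 1 by rewrite ltr_pwDr.
  exists (Num.min r (e1 / (`|v| + 1))); first by rewrite lt_min r0 divr_gt0.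
  move=> t; rewrite lt_min => /andP[tr te].
  have [->|t0] := eqVneq t 0; first by rewrite g0 subrr normr0.
  have := K t t0 tr; rewrite [t *: 1]mulr1 addr0 g0 Dg.
  set q := _ *: _ => vq.
  have -> : g t - x = t *: q by rewrite /q scalerA mulfV// scale1r.
  clearbody q.
  rewrite normrZ; rewrite ltr_pdivlMr// in te; apply: le_lt_trans te; rewrite ler_wpM2l//.
  by rewrite -[q](subrK v); apply: (le_trans (ler_normD _ _)); rewrite distrC; lra.
have [r r0 Hr] := gd.
have dgc k : derivable (fun t => g t 0 k) 0 1 by move/derivable_mxP: dg; exact.
have E k : (fun t => swap i j (g t) 0 k) = (fun t => g t 0 (tperm i j k)).
  by apply/funext => t; rewrite swapE.
have dsw : derivable (fun t => swap i j (g t)) 0 1.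
  by apply/derivable_mxP => z k; rewrite ord1 E.
exists (fun t => swap i j (g t)); split => //.
- by rewrite g0 swap_fix.
- exists (Num.min e r); first by rewrite lt_min e0.
  by move=> t; rewrite lt_min => /andP[te tr]; apply: H; [exact: Mg|exact: Hr].
- rewrite derive_mx//; apply/rowP => k; rewrite mxE swapE E -Dg derive_mx// mxE.
  by [].
Qed.

(** Here e_i - e_j is normal, so [y] and its mirror image are two points of [M] in one normal slice,
    and they coincide. *)
Lemma equal_coords_near (x : 'rV[R]_n) i j : M x -> x 0 i = x 0 j -> (forall v : 'rV[R]_n, mfd_tangent M x v -> v 0 i = v 0 j) ->
  exists2 e : R, 0 < e & forall y, M y -> `|y - x| < e -> y 0 i = y 0 j.
Proof.
move=> Mx xij Tij; have [J [A [AJ oA TJ [r r0 uniq] _]]] := submanifold_local Mx.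
have [e e0 H] := locally_symmetric_swap Mx xij.
exists (Num.min e r); first by rewrite lt_min e0.
move=> y My; rewrite lt_min => /andP[ye yr].
have sr : `|swap i j y - x| < r.
  apply: mxnorm_lt => // z k; rewrite ord1 !mxE tpermV.
  apply: le_lt_trans yr; have -> : x 0 k = x 0 (tperm i j k).
    by rewrite -swapE swap_fix.
  by have := entry_le_mxnorm (y - x) 0 (tperm i j k); rewrite !mxE.
have orth : y - swap i j y = (y - swap i j y) *m J *m A.
  apply: orth_tangent_complement AJ oA _ => v /TJ /Tij vij.
  by rewrite sub_swap dotvE -scalemxAl mxE -dotvE dotv_diff vij subrr mulr0.
have ys := uniq _ _ _ My (H y My ye) yr sr orth.
have : y 0 i = swap i j y 0 i by rewrite -ys.
by rewrite swapE tpermL.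
Qed.

(** The tangent space is invariant under the swap, so [v0] minus its mirror image is tangent: a
    nonzero multiple of e_i - e_j. Moving [y] along it separates the two coordinates. *)
Lemma unequal_coords_dense (x : 'rV[R]_n) i j (v0 : 'rV[R]_n) : M x -> x 0 i = x 0 j -> mfd_tangent M x v0 -> v0 0 i != v0 0 j ->
  mfd_tangent M x (delta_mx 0 i - delta_mx 0 j) /\
  exists2 e : R, 0 < e & forall y, M y -> `|y - x| < e -> forall rho : R, 0 < rho ->
    exists z, [/\ M z, `|z - y| < rho & z 0 i != z 0 j].
Proof.
move=> Mx xij Tv vij; have [J [A [AJ oA TJ _ [r r0 ex]]]] := submanifold_local Mx.
set dl := delta_mx 0 i - delta_mx 0 j.
have dlJ : dl *m J = 0.
  have /TJ s1 := tangent_swap Mx xij Tv; have /TJ s2 := Tv.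
  have : (v0 - swap i j v0) *m J = 0 by rewrite mulmxBl s1 s2 subrr.
  rewrite sub_swap -/dl -scalemxAl => /eqP; rewrite scaler_eq0 subr_eq0 (negbTE vij) /=.
  by move/eqP.
split; first exact/TJ.
exists r => // y My yr rho rho0.
have [yij|yij] := eqVneq (y 0 i) (y 0 j); last by exists y; rewrite subrr normr0.
have ij : i != j by apply: contra vij => /eqP ->.
pose t := Num.min (rho / 4) (r / 2).
have t0 : 0 < t by rewrite lt_min !divr_gt0.
have trho : t <= rho / 4 by rewrite ge_min lexx.
have tr : t <= r / 2 by rewrite ge_min lexx orbT.
have ndl : `|t *: dl| <= t.
  apply: mxnorm_le; first exact: ltW.
  move=> z k; rewrite ord1 !mxE eqxx /= normrM gtr0_norm// ler_piMr ?(ltW t0)//.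
  by case: (k == i); case: (k == j); rewrite ?subrr ?subr0 ?sub0r ?normrN ?normr0 ?normr1.
have [||w [Mz wA]] := ex y (t *: dl) My yr.
  by lra.
  by rewrite -scalemxAl dlJ scaler0.
exists (y + t *: dl + w *m A); split => //.
  by rewrite -(addrA y) addrAC subrr add0r; apply: le_lt_trans (ler_normD _ _) _; lra.
(* The normal correction is orthogonal to the tangent vector e_i - e_j, so it cannot undo the
   separation. *)
have wdl : (w *m A) 0 i = (w *m A) 0 j.
  by apply/eqP; rewrite -subr_eq0 -dotv_diff dotvC oA.
have di : dl 0 i = 1 by rewrite !mxE !eqxx (negbTE ij) subr0.
have dj : dl 0 j = -1 by rewrite !mxE !eqxx eq_sym (negbTE ij) sub0r.
rewrite [in X in X != _]mxE [in X in _ != X]mxE wdl (inj_eq (addIr _)).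
rewrite [in X in X != _]mxE [in X in _ != X]mxE yij (inj_eq (addrI _)).
rewrite [in X in X != _]mxE [in X in _ != X]mxE di dj mulr1 mulrN1.
by apply/eqP; lra.
Qed.

Hypothesis conM : connected M.

Definition equal_near (i j : 'I_n) : set 'rV[R]_n :=
  [set x | exists2 e : R, 0 < e & forall y, M y -> `|y - x| < e -> y 0 i = y 0 j].

Lemma equal_near_all i j x y : M x -> M y -> equal_near i j x -> equal_near i j y.
Proof.
move=> Mx My ex; suff E : M `&` equal_near i j = M by have : M y by []; rewrite -{1}E => -[].
apply: conM; first by exists x.
- exists (equal_near i j) => //; rewrite openE => z [e e0 H]; apply/nbhs_mxP.
  exists (e / 2); first by rewrite divr_gt0.
  move=> z' zz'; exists (e / 2); first by rewrite divr_gt0.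
  move=> u Mu uz; apply: H => //; rewrite -(subrK z' u) -addrA.
  by apply: le_lt_trans (ler_normD _ _) _; lra.
- exists (closure (M `&` equal_near i j)); first exact: closed_closure.
  apply/seteqP; split=> z; first by move=> Ez; split; [case: Ez|exact: subset_closure].
  move=> [Mz clz]; split => //.
  have near (e : R) : 0 < e -> exists u, [/\ M u, equal_near i j u & `|u - z| < e].
    move=> e0; have : nbhs z [set u | `|u - z| < e] by apply/nbhs_mxP; exists e.
    by move=> /clz[u [[Mu Eu] uz]]; exists u.
  have zij : z 0 i = z 0 j.
    apply: contrapT => /eqP nz.
    have dz : 0 < `|z 0 i - z 0 j| / 2 by rewrite divr_gt0// normr_gt0 subr_eq0.
    have [u [Mu [e e0 Eu] uz]] := near _ dz.
    have uij : u 0 i = u 0 j by apply: Eu => //; rewrite subrr normr0.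
    have h1 := entry_le_mxnorm (u - z) 0 i; have h2 := entry_le_mxnorm (u - z) 0 j.
    rewrite !mxE in h1 h2.
    have : `|z 0 i - z 0 j| <= `|u 0 i - z 0 i| + `|u 0 j - z 0 j|.
      have -> : z 0 i - z 0 j = - (u 0 i - z 0 i) + (u 0 j - z 0 j) by rewrite uij; ring.
      by apply: (le_trans (ler_normD _ _)); rewrite normrN.
    lra.
  have [Tij|] := pselect (forall v, mfd_tangent M z v -> v 0 i = v 0 j).
    exact: equal_coords_near.
  (* In the other case points with unequal coordinates accumulate at every point of [M] near [z], in
     particular at a point of [equal_near i j]. *)
  move=> /existsNP[v /not_implyP[Tv /eqP vij]].
  have [_ [e e0 D]] := unequal_coords_dense Mz zij Tv vij.
  have [u [Mu [e' e'0 Eu] uz]] := near e e0.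
  have [u' [Mu' u'u]] := D u Mu uz e' e'0.
  by rewrite (Eu u' Mu' u'u) eqxx.
Qed.

(** Near [y0] the orbits of [sstar] are exactly the blocks of equal coordinates; connectedness
    carries this information to [x] in both directions. *)
Lemma char_perm_tangent (sstar : 'S_n) (y0 x : 'rV[R]_n) (rho : R) : 0 < rho -> M y0 ->
  M `&` eball y0 rho `<=` Delta sstar -> M x ->
  forall i j, [/\ j \in porbit sstar i -> x 0 i = x 0 j,
    j \in porbit sstar i -> forall v, mfd_tangent M x v -> v 0 i = v 0 j &
    j \notin porbit sstar i -> x 0 i = x 0 j -> mfd_tangent M x (delta_mx 0 i - delta_mx 0 j)].
Proof.
move=> rho0 My0 Dy0 Mx i j; have [e e0 He] := eball_near y0 rho0.
have starx : j \in porbit sstar i -> equal_near i j x.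
  move=> ji; apply: (equal_near_all My0 Mx); exists e => // y My yy0.
  by apply/(Dy0 y _ i j) => //; split => //; exact: He.
split=> [/starx[r r0 H]|/starx[r r0 H] v Tv|ji xij].
- by apply: H => //; rewrite subrr normr0.
- apply: contrapT => /eqP vij.
  have xij : x 0 i = x 0 j by apply: H => //; rewrite subrr normr0.
  have [_ [e1 e10 D]] := unequal_coords_dense Mx xij Tv vij.
  have xx : `|x - x| < e1 by rewrite subrr normr0.
  have [z [Mz zx]] := D x Mx xx r r0.
  by rewrite (H z Mz zx) eqxx.
have [Tij|] := pselect (forall v, mfd_tangent M x v -> v 0 i = v 0 j).
  have := equal_near_all Mx My0 (equal_coords_near Mx xij Tij) => -[r r0 H].
  have y0ij : y0 0 i = y0 0 j by apply: H => //; rewrite subrr normr0.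
  have By0 : (M `&` eball y0 rho) y0 by split => //; apply: He; rewrite subrr normr0.
  by move: ji; rewrite (proj1 (Dy0 y0 By0 i j) y0ij).
move=> /existsNP[v /not_implyP[Tv /eqP vij]].
by have [] := unequal_coords_dense Mx xij Tv vij.
Qed.

End Submanifold.

(** * Orbits of the characteristic permutation *)

Section Orbits.
Variables (n : nat) (s : 'S_n).

Lemma porbit_eq i j : j \in porbit s i -> porbit s j = porbit s i.
Proof. by rewrite -eq_porbit_mem => /eqP. Qed.

Lemma porbitsP (I : {set 'I_n}) i : I \in porbits s -> (porbit s i == I) = (i \in I).
Proof. by case/imsetP => k _ ->; rewrite eq_porbit_mem. Qed.

Definition orep (i : 'I_n) : 'I_n := [arg min_(k < i | k \in porbit s i) (k : nat)]%N.

Lemma orepP i : orep i \in porbit s i /\ forall k, k \in porbit s i -> (orep i <= k)%N.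
Proof. by rewrite /orep; case: arg_minnP; [exact: porbit_id|move=> k ki kmin; split]. Qed.

Lemma orep_eq i j : j \in porbit s i -> orep j = orep i.
Proof.
move=> ji; apply/val_inj/eqP; rewrite eqn_leq.
have [a1 a2] := orepP i; have [b1 b2] := orepP j; rewrite (porbit_eq ji) in b1 b2.
by rewrite a2// b2.
Qed.

Lemma orepK i : orep (orep i) = orep i.
Proof. by apply: orep_eq; case: (orepP i). Qed.

(** One pair per equation. Since [orep] is the least element of its orbit, the last condition
    removes just the diagonal entry at the representative, which defines mu; a fixed point
    contributes nothing. *)
Definition eq_pairs : {set 'I_n * 'I_n} :=
  [set ik : 'I_n * 'I_n | [&& (ik.1 <= ik.2)%N, ik.2 \in porbit s ik.1 & ik.2 != orep ik.1]]%SET.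

Lemma sum_porbits (F : {set 'I_n} -> 'I_n -> nat) :
  (\sum_i F (porbit s i) i = \sum_(I in porbits s) \sum_(i in I) F I i)%N.
Proof.
rewrite (partition_big (porbit s) (mem (porbits s))) /=; last by move=> i _; exact: imset_f.
apply: eq_bigr => I Is; apply: eq_big => [i|i /eqP ->//]; exact: porbitsP.
Qed.

Lemma sum_ordered_pairs (I : {set 'I_n}) :
  (\sum_(i in I) \sum_(k in I) (i <= k) = (#|I| * #|I|.+1)./2)%N.
Proof.
set a := (X in X = _).
have b : (\sum_(i in I) \sum_(k in I) (k <= i) = a)%N by rewrite exchange_big.
have ab : (a + \sum_(i in I) \sum_(k in I) (k <= i) = #|I| * #|I|.+1)%N.
  rewrite -big_split /= (eq_bigr (fun=> #|I|.+1)); last first.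
    move=> i iI; rewrite -big_split /= (bigD1 i)//= leqnn.
    rewrite (eq_bigr (fun=> 1%N)); last first.
      by move=> k /andP[_ /negbTE ki]; move: ki; rewrite -val_eqE /=; case: ltngtP.
    by rewrite sum1_card (cardsD1 i I) iI /= addSnnS add1n; congr (_.+2); apply: eq_card => k; rewrite !inE andbC.
  by rewrite sum_nat_const.
by rewrite -ab b addnn doubleK.
Qed.

Lemma sum_is_card (T : finType) (P : pred T) : (\sum_x P x = #|P|)%N.
Proof. by rewrite -sum1_card [RHS]big_mkcond; apply: eq_bigr => x _; rewrite unfold_in; case: (P x). Qed.

(** Ordered pairs inside orbits are counted twice: as [eq_pairs] plus one removed pair per orbit,
    and as |I|(|I|+1)/2 per orbit, which is 1 for a fixed point. *)
Lemma card_eq_pairs :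
  (#|eq_pairs| + #|porbits s| = #|[pred i | s i == i]| +
    \sum_(I in porbits s | 1 < #|I|) (#|I| * #|I|.+1)./2)%N.
Proof.
have P : (\sum_(i < n) \sum_(k < n) ((i <= k) && (k \in porbit s i)) = #|eq_pairs| + #|porbits s|)%N.
  have -> : (#|eq_pairs| = \sum_(i < n) \sum_(k < n) ((i <= k) && ((k \in porbit s i) && (k != orep i))))%N.
    rewrite pair_big /= -sum1_card big_mkcond; apply: eq_bigr => -[i k] _; rewrite inE /=.
    by case: [&& _, _ & _].
  have -> : (#|porbits s| = \sum_i (orep i == i))%N.
    rewrite (sum_porbits (fun _ i => orep i == i : nat)) -sum1_card; apply: eq_bigr => I /imsetP[k _ ->].
    have [rk _] := orepP k.
    rewrite (bigD1 (orep k))//= orepK eqxx big1// => j /andP[jk jr].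
    by rewrite (orep_eq jk) eq_sym (negbTE jr).
  rewrite -big_split /=; apply: eq_bigr => i _.
  have -> : (\sum_(k < n) ((i <= k) && (k \in porbit s i)) = \sum_(k < n) ((i <= k) && ((k \in porbit s i) && (k != orep i)))
       + \sum_(k < n) [&& i <= k, k \in porbit s i & k == orep i])%N.
    rewrite -big_split /=; apply: eq_bigr => k _.
    by case: (i <= k)%N; case: (k \in porbit s i); case: (k == orep i).
  congr (_ + _)%N; have [ri rmin] := orepP i.
  rewrite (bigD1 (orep i))//= ri eqxx /= andbT big1 ?addn0; last first.
    by move=> k /negbTE ->; rewrite !andbF.
  congr (nat_of_bool _); apply/idP/eqP => [ir|->//].
  by apply/val_inj/eqP; rewrite eqn_leq ir rmin ?porbit_id.
rewrite -P (eq_bigr (fun i => \sum_(k in porbit s i) (i <= k)))%N; last first.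
  by move=> i _; rewrite [RHS]big_mkcond; apply: eq_bigr => k _; rewrite andbC; case: (k \in _).
rewrite (sum_porbits (fun I i => \sum_(k in I) (i <= k))%N).
rewrite (eq_bigr (fun I : {set 'I_n} => (#|I| * #|I|.+1)./2)); last first.
  by move=> I _; exact: sum_ordered_pairs.
rewrite (bigID (fun I : {set 'I_n} => (1 < #|I|)%N)) /= addnC; congr (_ + _)%N.
rewrite -sum_is_card.
rewrite (eq_bigr (fun i => (~~ (1 < #|porbit s i|)) : nat)%N); last first.
  move=> i _; congr (nat_of_bool _); rewrite -leqNgt.
  apply/idP/idP => [/eqP si|].
    rewrite (_ : porbit s i = [set i]%SET) ?cards1//; apply/setP => k; rewrite inE.
    apply/idP/eqP => [/porbitP[m ->]|->]; last exact: porbit_id.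
    by elim: m => [|m IH]; rewrite ?expg0 ?perm1// expgS permM si.
  move=> /card_le1_eqP h; apply/eqP; apply: (h i (s i)); first exact: porbit_id.
  by rewrite -{1}(expg1 s) mem_porbit.
rewrite (sum_porbits (fun I _ => ~~ (1 < #|I|) : nat))%N.
rewrite [in RHS](bigID (fun I : {set 'I_n} => (1 < #|I|)%N)) /= [X in (_ = X + _)%N]big1 ?add0n; last first.
  by move=> I /andP[_ ->]; rewrite big1.
apply: eq_bigr => I /andP[Is I1]; rewrite I1 sum_nat_const muln1.
have I0 : (0 < #|I|)%N by case/imsetP: Is => k _ ->; apply/card_gt0P; exists k; exact: porbit_id.
have -> : #|I| = 1%N by move: I1 I0; case: #|I| => [|[|]].
by [].
Qed.

Lemma card_eq_pairs_le : (#|eq_pairs| <= (n * n.+1)./2)%N.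
Proof.
have := sum_ordered_pairs [set: 'I_n]%SET; rewrite cardsT card_ord => <-.
have -> : (#|eq_pairs| = \sum_(i < n) \sum_(k < n) ((i, k) \in eq_pairs))%N.
  by rewrite pair_big /= -sum_is_card; apply: eq_bigr => -[i k] _.
rewrite [leqRHS](eq_bigl xpredT); last by move=> i; rewrite inE.
apply: leq_sum => i _; rewrite [leqRHS](eq_bigl xpredT); last by move=> k; rewrite inE.
apply: leq_sum => k _; rewrite inE /=; by case: (i <= k)%N => //=; case: (_ && _).
Qed.

End Orbits.

Section OrbitSpace.
Variables (R : realType) (n : nat) (s : 'S_n).

Definition orbmx : 'M[R]_(#|porbits s|, n) :=
  \matrix_(a < #|porbits s|, i < n) (i \in (enum_val a : {set 'I_n}))%:R.

Lemma orbit_index (i : 'I_n) : exists a : 'I_#|porbits s|, enum_val a = porbit s i.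
Proof.
have h : porbit s i \in porbits s by exact: imset_f.
by exists (enum_rank_in h (porbit s i)); rewrite enum_rankK_in.
Qed.

Lemma enum_porbit (a : 'I_#|porbits s|) : exists i, enum_val a = porbit s i.
Proof. by have /imsetP[i _ ->] := enum_valP a; exists i. Qed.

Lemma mem_enum_porbit (a b : 'I_#|porbits s|) i : i \in (enum_val a : {set 'I_n}) -> (i \in (enum_val b : {set 'I_n})) = (b == a).
Proof.
move=> ia; apply/idP/eqP => [ib|->//]; apply: enum_val_inj.
move: ia ib; have [ka ->] := enum_porbit a; have [kb ->] := enum_porbit b => ia ib.
by rewrite -(porbit_eq ia) -(porbit_eq ib).
Qed.

Lemma orbmx_free : row_free orbmx.
Proof.
have [rep repE] := choice enum_porbit.
have repP a : rep a \in (enum_val a : {set 'I_n}) by rewrite repE porbit_id.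
apply/row_freeP; exists (\matrix_(i, a) (i == rep a)%:R).
apply/matrixP => a b; rewrite !mxE (bigD1 (rep b))//= !mxE eqxx mulr1 big1 ?addr0; last first.
  by move=> i /negbTE ir; rewrite !mxE ir mulr0.
by rewrite (mem_enum_porbit _ (repP b)).
Qed.

Lemma orbmx_Deltapp (v : 'rV[R]_n) : Deltapp s v <-> (v <= orbmx)%MS.
Proof.
split=> [vs|/submxP[w ->] i j ji].
  have [rep repP] := choice enum_porbit.
  apply/submxP; exists (\row_a v 0 (rep a)); apply/rowP => i; rewrite !mxE.
  have [a ia] := orbit_index i.
  have iva : i \in (enum_val a : {set 'I_n}) by rewrite ia porbit_id.
  rewrite (bigD1 a)//= !mxE iva mulr1 big1 ?addr0; last first.
    by move=> b ba; rewrite !mxE (mem_enum_porbit _ iva) (negbTE ba) mulr0.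
  by apply/esym/vs; rewrite -repP.
rewrite !mxE; apply: eq_bigr => a _; rewrite !mxE; congr (_ * (nat_of_bool _)%:R).
have [k ->] := enum_porbit a.
by rewrite -!eq_porbit_mem (porbit_eq ji).
Qed.

End OrbitSpace.

(** * The space T + N^red *)

Section TangentSum.
Variables (R : realType) (n d nred : nat) (M : set 'rV[R]_n) (sstar s : 'S_n) (x : 'rV[R]_n).
Hypothesis subM : C2_submanifold M d.
Hypothesis Mx : M x.
Hypothesis Dx : Delta s x.
Hypothesis h1 : forall i j, j \in porbit sstar i -> x 0 i = x 0 j.
Hypothesis h2 : forall i j, j \in porbit sstar i -> forall v, mfd_tangent M x v -> v 0 i = v 0 j.
Hypothesis h3 : forall i j, j \notin porbit sstar i -> x 0 i = x 0 j ->
  mfd_tangent M x (delta_mx 0 i - delta_mx 0 j).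

Let nred_space := mfd_normal M x `&` Deltapp s.

(** Otherwise e_i - e_k would be tangent, although its coordinates [i] and [j], of one orbit, are 1
    and 0. *)
Lemma nontrivial_orbit_is_cluster i j k : j \in porbit sstar i -> i != j -> x 0 k = x 0 i ->
  k \in porbit sstar i.
Proof.
move=> ji ij xki; apply: contraT => ki.
have /(h2 ji) := h3 ki (esym xki); rewrite !mxE !eqxx.
have ik : i != k by apply: contraNneq ki => <-; exact: porbit_id.
have jk : j != k by apply: contraNneq ki => <-.
rewrite (negbTE ik) eq_sym (negbTE ij) (negbTE jk) subrr subr0 => /eqP.
by rewrite oner_eq0.
Qed.

(** Split [u] orthogonally. The normal part is constant on the orbits of [s]: inside an orbit of
    [sstar] because [u] and the tangent part are, and across such orbits because e_i - e_j is
    tangent there. *)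
Lemma tangent_normal_decomp u : Deltapp sstar u ->
  exists t w, [/\ mfd_tangent M x t, nred_space w & u = t + w].
Proof.
move=> us; have [J [A [AJ oA TJ _ _]]] := submanifold_local subM Mx.
have Tt : mfd_tangent M x (u - u *m J *m A).
  by apply/TJ; rewrite mulmxBl -[u *m J *m A *m J]mulmxA AJ mulmx1 subrr.
exists (u - u *m J *m A), (u *m J *m A); split => //; last by rewrite subrK.
have Nw : mfd_normal M x (u *m J *m A) by move=> v /TJ vJ; exact: oA.
split => // i j ji; have xij : x 0 i = x 0 j by apply/Dx.
have [st|nst] := boolP (j \in porbit sstar i).
  have := h2 st Tt; rewrite mxE [in RHS]mxE (us i j st) => /addrI.
  by rewrite mxE [in RHS]mxE => /oppr_inj.
have := Nw _ (h3 nst xij); rewrite dotvC dotv_diff => /eqP.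
by rewrite subr_eq0 => /eqP.
Qed.

Lemma tangent_normal_sum (y : 'rV[R]_n) :
  (exists t w, [/\ mfd_tangent M x t, nred_space w & y = x + t + w]) <-> Deltapp sstar y.
Proof.
split=> [[t [w [Tt [_ ws] ->]]] i j ji|ys].
  rewrite !mxE (h1 ji) (h2 ji Tt) (ws i j)//.
  by apply/Dx; exact: h1.
have [|t [w [Tt Nw e]]] := @tangent_normal_decomp (y - x).
  by move=> i j ji; rewrite !mxE (ys i j ji) (h1 ji).
by exists t, w; split => //; rewrite -addrA -e addrC subrK.
Qed.

Lemma tangent_normal_dim : subspace_dim nred_space nred -> (d + nred = #|porbits sstar|)%N.
Proof.
have [K [fK TK]] := submanifold_tangent_dim subM Mx.
move=> [B [fB NB]].
have /eqP <- := orbmx_free R sstar.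
have inter : (K :&: B)%MS = 0.
  apply/eqP/rowV0P => v; rewrite sub_capmx => /andP[/TK Tv /NB[Nv _]].
  by apply: dotvv_eq0; exact: Nv.
have /eqmxP -> : (orbmx R sstar == K + B)%MS.
  apply/andP; split; apply/rV_subP => v.
    move=> /orbmx_Deltapp /tangent_normal_decomp[t [w [/TK Tt /NB Nw ->]]].
    by apply: addmx_sub_adds.
  move=> /sub_addsmxP[[a b] /= ->]; apply/orbmx_Deltapp => i j ji.
  have /TK Ta : (a *m K <= K)%MS by exact: submxMl.
  have /NB[_ Nb] : (b *m B <= B)%MS by exact: submxMl.
  rewrite [LHS]mxE [RHS]mxE (h2 ji Ta) (Nb i j)//.
  by apply/Dx; exact: h1.
have := mxrank_sum_cap K B; rewrite inter mxrank0 addn0 => ->.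
by rewrite (eqP fK) (eqP fB).
Qed.

End TangentSum.

(** * Analytic equations for the spectral set *)

Section Pencil.
Variables (R : realType) (n : nat) (U : 'M[R]_n) (I : {set 'I_n}) (r : 'I_n).
Local Notation P := (mpoly (n * n) R).

Definition pencilR (B : 'M[R]_n) (t0 : R) : 'M[{poly R}]_n := map_mx polyC B - (t0%:P + 'X)%:M.

Definition qR B t0 : {poly R} := schur I (pencilR B t0) r r.

(** The generic perturbation of [A]: its entries are polynomial variables, and the eigenvalue
    parameter is the offset 'X from [t0], so that both expansions are centred at 0. *)
Definition pencilP (A : 'M[R]_n) (t0 : R) : 'M[{poly P}]_n :=
  map_mx polyC (map_mx (@mpolyC (n * n) R) U *m (map_mx (@mpolyC (n * n) R) A + \matrix_(i, j) ent_var R i j)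
    *m map_mx (@mpolyC (n * n) R) U^T) - ((mpolyC (n * n) t0)%:P + 'X)%:M.

Definition qP A t0 : {poly P} := schur I (pencilP A t0) r r.

Lemma qRE B t0 u : (qR B t0).[u] = schur I (B - (t0 + u)%:M) r r.
Proof.
have -> : B - (t0 + u)%:M = map_mx (horner_eval u) (pencilR B t0).
  by apply/matrixP => i j; rewrite !mxE /horner_eval !hornerE hornerMn !hornerE.
exact: (schur_map_entry I (horner_eval u)).
Qed.

Lemma qP_eval A t0 (Z : 'M[R]_n) :
  map_poly (meval (mxev Z)) (qP A t0) = qR (U *m (A + Z) *m U^T) t0.
Proof.
rewrite /qR; have <- : map_mx (map_poly (meval (mxev Z))) (pencilP A t0) = pencilR (U *m (A + Z) *m U^T) t0.
  have mC (p q : nat) (B : 'M[R]_(p, q)) : map_mx (meval (mxev Z)) (map_mx (@mpolyC (n * n) R) B) = B.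
    by apply/matrixP => i j; rewrite !mxE mevalC.
  rewrite /pencilP map_mxB map_scalar_mx rmorphD /= map_polyC map_polyX /= mevalC /pencilR; congr (_ - _).
  have -> (B : 'M[P]_n) : map_mx (map_poly (meval (mxev Z))) (map_mx polyC B) =
      map_mx polyC (map_mx (meval (mxev Z)) B).
    by apply/matrixP => i j; rewrite !mxE map_polyC.
  congr (map_mx polyC _); rewrite !map_mxM map_mxD !mC; congr (_ *m (_ + _) *m _).
  by apply/matrixP => i j; rewrite !mxE /= meval_ent_var.
have e := schur_map_entry I (map_poly (meval (mxev Z))) (pencilP A t0) r r.
exact e.
Qed.

Lemma qR_shift B t0 t1 : qR B t1 = qR B t0 \Po ('X + (t1 - t0)%:P).
Proof.
rewrite /qR.
have -> : pencilR B t1 = map_mx (comp_poly ('X + (t1 - t0)%:P)) (pencilR B t0).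
  rewrite /pencilR map_mxB map_scalar_mx; congr (_ - _).
    by apply/matrixP => i j; rewrite !mxE /= comp_polyC.
  congr (_%:M); rewrite rmorphD /= comp_polyC comp_polyX polyCB.
  by ring.
by rewrite -(schur_map_entry I (comp_poly ('X + (t1 - t0)%:P))).
Qed.

End Pencil.

(** * The analytic root mu attached to a cluster of equal eigenvalues *)

Section ClusterRoot.
Variables (R : realType) (n : nat) (U Xb : 'M[R]_n) (x : 'rV[R]_n) (r : 'I_n).
Hypothesis UU : U *m U^T = 1%:M.
Hypothesis XbE : Xb = U^T *m diag_mx x *m U.

Definition cluster : {set 'I_n} := [set a | x 0 a == x 0 r]%SET.
Local Notation I := cluster.

Lemma conj_diag : U *m Xb *m U^T = diag_mx x.
Proof. by rewrite XbE !mulmxA UU mul1mx -mulmxA UU mulmx1. Qed.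

Lemma qR_diag : qR I r (diag_mx x) (x 0 r) =
  (\prod_a (if a \in I then 1 else (x 0 a - x 0 r)%:P - 'X)) * - 'X.
Proof.
have pE : pencilR (diag_mx x) (x 0 r) = diag_mx (\row_a ((x 0 a - x 0 r)%:P - 'X)).
  apply/matrixP => i j; rewrite !mxE; have [->|ij] := eqVneq i j.
    by rewrite !mulr1n polyCB opprD addrA.
  by rewrite !mulr0n subr0 polyC0.
rewrite /qR pE schur_block; last first.
  by move=> b bI; rewrite !mxE; case: eqP => [e|_]; rewrite ?mulr0n//; move: bI; rewrite -e inE eqxx.
rewrite bordm_diag det_diag !mxE eqxx mulr1n subrr polyC0 sub0r; congr (_ * _).
by apply: eq_bigr => a _; rewrite !mxE.
Qed.

Lemma qR_diag_root : (qR I r (diag_mx x) (x 0 r)).[0] = 0.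
Proof. by rewrite qR_diag hornerM hornerN hornerX oppr0 mulr0. Qed.

Lemma qR_diag_simple : (qR I r (diag_mx x) (x 0 r))^`().[0] != 0.
Proof.
rewrite qR_diag derivM derivN derivX hornerD !hornerM !hornerN hornerX hornerC oppr0 mulr0 add0r.
rewrite mulrN1 oppr_eq0 horner_prod; apply/prodf_neq0 => a _.
case: (boolP (a \in I)) => [_|]; first by rewrite hornerC oner_eq0.
by rewrite inE hornerD hornerN hornerX hornerC subr0 subr_eq0.
Qed.

Lemma mxev0 : mxev (0 : 'M[R]_n) = fun=> 0.
Proof. by apply/funext => l; rewrite /mxev linear0 mxE. Qed.

(** The simple root theorem at Xbar defines mu on a ball, but analyticity is wanted at each [A] in
    it. The theorem is therefore applied again, centred at [A] and at mu(A), and uniqueness from the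
    first application identifies the two roots. *)
Lemma cluster_root (eta : R) : 0 < eta -> exists rho R0 (mu : 'M[R]_n -> R),
  [/\ 0 < rho, 0 < R0, R0 <= eta & forall A, `|A - Xb| < rho ->
    [/\ `|mu A - x 0 r| < R0, schur I (U *m A *m U^T - (mu A)%:M) r r = 0,
     forall t, `|t - x 0 r| <= R0 -> schur I (U *m A *m U^T - t%:M) r r = 0 -> t = mu A &
     analytic_approx mu A]].
Proof.
move=> eta0.
have ar1 (a z r2 e k : R) : z <= r2 -> r2 <= e -> e <= (k - a) / 2 -> a < k -> a + z < k by lra.
have ar2 (a z r2 e k : R) : z < r2 -> r2 <= e -> e <= k - a -> a + z <= k by lra.
have p1 : (map_poly (meval (fun=> 0)) (qP U I r Xb (x 0 r))).[0] = 0.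
  by rewrite -mxev0 qP_eval addr0 conj_diag qR_diag_root.
have p2 : (map_poly (meval (fun=> 0)) (qP U I r Xb (x 0 r)))^`().[0] != 0.
  by rewrite -mxev0 qP_eval addr0 conj_diag qR_diag_simple.
have [rho [R0 [[rho0 _ R00 R0eta] [Q [f [_ _ H]]]]]] := simple_root_analytic p1 p2 eta0.
pose mu (A : 'M[R]_n) := x 0 r + f (mxev (A - Xb)).
exists rho, R0, mu; split => //.
have Hmu A : `|A - Xb| < rho ->
    [/\ `|mu A - x 0 r| < R0, schur I (U *m A *m U^T - (mu A)%:M) r r = 0,
     (qR I r (U *m A *m U^T) (x 0 r))^`().[mu A - x 0 r] != 0 &
     forall t, `|t - x 0 r| <= R0 -> schur I (U *m A *m U^T - t%:M) r r = 0 -> t = mu A].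
  move=> AX; have [|_ fr] := H (mxev (A - Xb)).
    by apply: mxev_le => i j; apply: (le_trans (entry_le_mxnorm _ _ _)); exact: ltW.
  rewrite qP_eval (_ : Xb + (A - Xb) = A); last by rewrite addrC subrK.
  have muE : mu A - x 0 r = f (mxev (A - Xb)) by rewrite /mu addrAC subrr add0r.
  rewrite -muE => /eqP; rewrite qRE [x 0 r + _]addrC subrK => rt sm un.
  split => //; first by rewrite muE.
  move=> t tr st; have := un _ tr; rewrite /root qRE [x 0 r + _]addrC subrK st eqxx.
  by move=> /(_ isT) /(congr1 (+%R^~ (x 0 r))); rewrite !subrK.
move=> A AX; have [m1 m2 m3 m4] := Hmu A AX; split => //.
have q1 : (map_poly (meval (fun=> 0)) (qP U I r A (mu A))).[0] = 0.
  by rewrite -mxev0 qP_eval addr0 qRE addr0.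
have q2 : (map_poly (meval (fun=> 0)) (qP U I r A (mu A)))^`().[0] != 0.
  rewrite -mxev0 qP_eval addr0 (qR_shift I r _ (x 0 r)) deriv_comp hornerM horner_comp.
  by rewrite derivD derivX derivC addr0 !hornerE.
(* Keeps the new matrices and the new root inside the region where uniqueness at Xbar is
   available. *)
pose eta2 := Num.min ((rho - `|A - Xb|) / 2) (R0 - `|mu A - x 0 r|).
have eta20 : 0 < eta2 by rewrite lt_min divr_gt0 ?subr_gt0.
have [rho2 [r2 [[rho20 rho2e r20 r2e] [Q2 [f2 [oQ nQ H2]]]]]] := simple_root_analytic q1 q2 eta20.
have e1 : eta2 <= (rho - `|A - Xb|) / 2 by rewrite ge_min lexx.
have e2 : eta2 <= R0 - `|mu A - x 0 r| by rewrite ge_min lexx orbT.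
exists rho2, (`|mu A| + r2), (fun d => mpolyC (n * n) (mu A) + Q2 d); split => //.
- by move=> d; rewrite opprD addrACA subrr add0r; exact: oQ.
- move=> d; apply: (le_trans (mnormD _ _ (ltW rho20))); rewrite mnormC lerD2l.
  exact: nQ.
- move=> Z hZ; have [|cv fr rt _ _] := H2 (mxev Z); first exact: mxev_le.
  have AZ : `|A + Z - Xb| < rho.
    rewrite addrAC; apply: le_lt_trans (ler_normD _ _) _.
    have Zr : `|Z| <= rho2 by apply: mxnorm_le => //; exact: ltW.
    exact: ar1 Zr rho2e e1 AX.
  have [_ _ _ un] := Hmu (A + Z) AZ.
  rewrite -(un (mu A + f2 (mxev Z))).
  + under eq_fun do rewrite mevalD mevalC.
    by apply: cvgD => //; exact: cvg_cst.
  + rewrite addrAC; apply: (le_trans (ler_normD _ _)); exact: ar2 fr r2e e2.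
  + by move: rt; rewrite /root qP_eval qRE => /eqP.
Qed.

End ClusterRoot.

Section DetContinuity.
Variables (R : realType) (n : nat) (I : {set 'I_n}).

Lemma continuous_bigprod (T : topologicalType) (K : Type) (s : seq K) (C : pred K) (f : K -> T -> R) :
  (forall i, continuous (f i)) -> continuous (fun x => \prod_(i <- s | C i) f i x).
Proof.
move=> hf; elim: s => [|i s IH] x.
  by under eq_fun do rewrite big_nil; exact: cvg_cst.
under eq_fun do rewrite big_cons; case: (C i) => //; last exact: IH.
by apply: cvgM; [exact: hf|exact: IH].
Qed.

Lemma continuous_addR (T : topologicalType) (f g : T -> R) :
  continuous f -> continuous g -> continuous (fun x => f x + g x).
Proof. by move=> hf hg x; apply: cvgD; [exact: hf|exact: hg]. Qed.

Lemma det_bordm_continuous : continuous (fun T : 'M[R]_n => \det (bordm I T)).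
Proof.
apply: continuous_bigsum => s; apply: continuous_mulR; first exact: cst_continuous.
apply: continuous_bigprod => i.
under eq_fun do rewrite mxE projm_mulr projm_mull.
apply: continuous_addR; last exact: cst_continuous.
apply: continuous_mulR; last exact: cst_continuous.
by apply: continuous_mulR; [exact: cst_continuous|exact: coord_continuous].
Qed.

Lemma det_bordm_eps (T0 : 'M[R]_n) (e : R) : 0 < e -> exists2 d : R, 0 < d &
  forall T, `|T - T0| < d -> `|\det (bordm I T0) - \det (bordm I T)| < e.
Proof.
move=> e0.
have := proj1 (@cvgrPdist_lt _ _ _ (nbhs T0) (nbhs_filter T0) (fun T : 'M[R]_n => \det (bordm I T)) _)
  (@det_bordm_continuous T0) e e0.
by move/nbhs_mxP.
Qed.

End DetContinuity.

Section SchurAnalytic.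
Variables (R : realType) (p q n : nat).

Lemma mx_analytic_schur (I : {set 'I_n}) (H : 'M[R]_(p, q) -> 'M[R]_n) A :
  mx_analytic H A -> mx_analytic (fun Y => schur I (H Y)) A.
Proof.
move=> hH; have hB : mx_analytic (fun Y => bordm I (H Y)) A.
  apply: mx_analyticD; last exact: mx_analytic_cst.
  apply: mx_analyticM; last exact: mx_analytic_cst.
  by apply: mx_analyticM => //; exact: mx_analytic_cst.
apply: mx_analyticD; first by apply: mx_analyticZ => //; exact: analytic_approx_det.
apply: mx_analyticN; apply: mx_analyticM => //.
apply: mx_analyticM; last exact: mx_analytic_cst.
apply: mx_analyticM; last exact: mx_analytic_adj.
by apply: mx_analyticM => //; exact: mx_analytic_cst.
Qed.

Lemma mx_analytic_scalar (h : 'M[R]_(p, q) -> R) A : analytic_approx h A ->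
  mx_analytic (fun Y => (h Y)%:M : 'M[R]_n) A.
Proof.
move=> hh i j; under eq_fun do rewrite mxE; case: (i == j) => //=.
by under eq_fun do rewrite mulr0n; exact: analytic_approx_cst.
Qed.

End SchurAnalytic.

(** * The defining equations of the spectral set *)

Section SpectralSet.
Variables (R : realType) (n : nat) (sstar : 'S_n) (U Xb : 'M[R]_n) (x : 'rV[R]_n).
Hypothesis UU : U *m U^T = 1%:M.
Hypothesis XbE : Xb = U^T *m diag_mx x *m U.
Hypothesis orbit_cluster : forall i j, j \in porbit sstar i -> x 0 i = x 0 j.
Hypothesis cluster_orbit : forall i j k, j \in porbit sstar i -> i != j -> x 0 k = x 0 i ->
  k \in porbit sstar i.

Local Notation cl := (cluster x).
Definition conjp (A : 'M[R]_n) (t : R) : 'M[R]_n := U *m A *m U^T - t%:M.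

Lemma conjpXb t : conjp Xb t = diag_mx x - t%:M.
Proof. by rewrite /conjp (conj_diag UU XbE). Qed.

Lemma conjp_norm A t t0 :
  `|conjp A t - conjp Xb t0| <= n%:R * `|U^T| * (n%:R * `|U|) * `|A - Xb| + `|t - t0|.
Proof.
have -> : conjp A t - conjp Xb t0 = U *m (A - Xb) *m U^T - (t - t0)%:M.
  rewrite /conjp mulmxBr mulmxBl; move: (U *m A *m U^T) (U *m Xb *m U^T) => PA PX.
  by apply/matrixP => i j; rewrite !mxE; case: (i == j); rewrite ?mulr1n ?mulr0n; ring.
apply: (le_trans (ler_normB _ _)); apply: lerD; last first.
  apply: mxnorm_le => // i j; rewrite mxE; case: (i == j); rewrite ?mulr1n ?mulr0n//.
  by rewrite normr0.
apply: (le_trans (mulmx_norm_le _ _)); rewrite -[leRHS]mulrA ler_wpM2l ?mulr_ge0//.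
by apply: (le_trans (mulmx_norm_le _ _)); rewrite mulrAC.
Qed.

Lemma conjp_unit_near (r : 'I_n) : exists2 e : R, 0 < e & forall A t,
  `|conjp A t - conjp Xb (x 0 r)| < e -> bordm (cl r) (conjp A t) \in unitmx.
Proof.
set T0 := conjp Xb (x 0 r).
have d0 : \det (bordm (cl r) T0) != 0.
  have -> : T0 = diag_mx (\row_a (x 0 a - x 0 r)).
    rewrite /T0 conjpXb; apply/matrixP => i j; rewrite !mxE.
    by case: (i == j); rewrite ?mulr1n ?mulr0n ?subr0.
  rewrite bordm_diag det_diag; apply/prodf_neq0 => a _; rewrite !mxE.
  by case: (boolP (a \in cl r)); rewrite ?oner_eq0// inE subr_eq0.
have nd0 : 0 < `|\det (bordm (cl r) T0)| by rewrite normr_gt0.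
have [e e0 H] := det_bordm_eps (cl r) T0 nd0.
exists e => // A t /H K; rewrite unitmxE unitfE; apply: contraTneq K => ->.
by rewrite subr0 ltxx.
Qed.

(** Shrinks the radii so that the complementary block stays invertible; n d <= R0 ensures, by Weyl's
    inequality, that the eigenvalues of the cluster lie where the root is unique. *)
Lemma cluster_data (r : 'I_n) (eta : R) : 0 < eta -> exists d R0 (mu : 'M[R]_n -> R),
  [/\ 0 < d, 0 < R0, R0 <= eta, n%:R * d <= R0 & forall A, `|A - Xb| < d ->
    [/\ `|mu A - x 0 r| < R0, schur (cl r) (conjp A (mu A)) r r = 0,
     forall t, `|t - x 0 r| <= R0 -> schur (cl r) (conjp A t) r r = 0 -> t = mu A,
     analytic_approx mu A &
     forall t, `|t - x 0 r| <= R0 -> bordm (cl r) (conjp A t) \in unitmx]].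
Proof.
move=> eta0; have [e e0 He] := conjp_unit_near r.
have ee : e / 4 + e / 4 < e by lra.
have eta'0 : 0 < Num.min eta (e / 4) by rewrite lt_min eta0 divr_gt0.
have [rho [R0 [mu [rho0 R00 R0e H]]]] := cluster_root r UU XbE eta'0.
have R0eta : R0 <= eta by apply: (le_trans R0e); rewrite ge_min lexx.
have R0e4 : R0 <= e / 4 by apply: (le_trans R0e); rewrite ge_min lexx orbT.
set c := n%:R * `|U^T| * (n%:R * `|U|).
have c0 : 0 <= c by rewrite !mulr_ge0.
pose d := Num.min rho (Num.min (e / 4 / (c + 1)) (R0 / n.+1%:R)).
have d0 : 0 < d by rewrite !lt_min rho0 !divr_gt0// ltr_wpDl.
exists d, R0, mu; split => //.
  rewrite mulrC; apply: (@le_trans _ _ (R0 / n.+1%:R * n%:R)).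
    by rewrite ler_wpM2r// !ge_min lexx !orbT.
  by rewrite mulrAC ler_pdivrMr// ler_wpM2l ?(ltW R00)// ler_nat.
move=> A Ad; have Arho : `|A - Xb| < rho by apply: (lt_le_trans Ad); rewrite ge_min lexx.
have [m1 m2 m3 m4] := H A Arho; split => // t tr.
apply: He; apply: (le_lt_trans (conjp_norm _ _ _)); rewrite -/c.
have cA : c * `|A - Xb| <= e / 4.
  apply: (@le_trans _ _ ((c + 1) * (e / 4 / (c + 1)))).
    apply: ler_pM => //; first by rewrite lerDl.
    by apply: (le_trans (ltW Ad)); rewrite !ge_min lexx orbT.
  by rewrite mulrC divfK// gt_eqF// ltr_wpDl.
have : c * `|A - Xb| + `|t - x 0 r| <= e / 4 + e / 4 by rewrite lerD// (le_trans tr).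
by move=> /le_lt_trans; apply.
Qed.

Lemma gap_exists : exists2 g : R, 0 < g & forall a b, x 0 a != x 0 b -> g <= `|x 0 a - x 0 b|.
Proof.
have [g g0 H] : exists2 g : R, 0 < g & forall ab : 'I_n * 'I_n,
    x 0 ab.1 != x 0 ab.2 -> g <= `|x 0 ab.1 - x 0 ab.2|.
  apply: common_radius => [[a b] d d' dd' h /h|[a b]]; first exact: le_trans.
  have [e|ne] := eqVneq (x 0 a) (x 0 b); first by exists 1 => //=; rewrite e eqxx.
  by exists `|x 0 a - x 0 b| => //; rewrite normr_gt0 subr_eq0.
by exists g => // a b; exact: (H (a, b)).
Qed.

Lemma conjp_spectral (V A : 'M[R]_n) (a : 'rV[R]_n) t : V *m V^T = 1%:M -> A = V^T *m diag_mx a *m V ->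
  let W := V *m U^T in W *m W^T = 1%:M /\
  conjp A t = W^T *m diag_mx (\row_i (a 0 i - t)) *m W.
Proof.
move=> VV AE W; have UU' := mulmx1C UU; have VV' := mulmx1C VV.
have WW : W *m W^T = 1%:M by rewrite /W trmx_mul trmxK mulmxA -[V *m U^T *m U]mulmxA UU' mulmx1.
split => //.
have -> : diag_mx (\row_i (a 0 i - t)) = diag_mx a - t%:M.
  by apply/matrixP => i j; rewrite !mxE; case: (i == j); rewrite ?mulr1n ?mulr0n ?subr0.
rewrite mulmxBr mulmxBl mul_mx_scalar -scalemxAl (mulmx1C WW) scalemx1 /conjp; congr (_ - _).
by rewrite AE /W trmx_mul trmxK !mulmxA.
Qed.

Lemma conjp_sym A t : A^T = A -> (conjp A t)^T = conjp A t.
Proof.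
move=> sA; rewrite /conjp linearB /= tr_scalar_mx !trmx_mul trmxK sA mulmxA.
by [].
Qed.

Variables (m : nat) (D B : set 'rV[R]_n) (e : R).
Hypothesis rx : Rge x.
Hypothesis mE : ((n * n.+1)./2 - m = #|eq_pairs sstar|)%N.
Hypothesis DE : forall y, D y <-> Deltapp sstar y /\ B y.
Hypothesis e0 : 0 < e.
Hypothesis Be : forall y : 'rV[R]_n, (forall i, `|y 0 i - x 0 i| <= e) -> B y.
Local Notation N' := ((n * n.+1)./2 - m)%N.

Definition eqpr (l : 'I_N') : 'I_n * 'I_n := enum_val (cast_ord mE l).

Lemma eqprP l : eqpr l \in eq_pairs sstar.
Proof. exact: enum_valP. Qed.

Lemma eqpr_inj : injective eqpr.
Proof. by move=> l l' /enum_val_inj /cast_ord_inj. Qed.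

Lemma eqpr_surj i k : (i, k) \in eq_pairs sstar -> exists l, eqpr l = (i, k).
Proof.
move=> ik; exists (cast_ord (esym mE) (enum_rank_in ik (i, k))).
by rewrite /eqpr cast_ordKV enum_rankK_in.
Qed.

Local Notation rep := (orep sstar).

Lemma rep_x i : x 0 (rep i) = x 0 i.
Proof. by apply/esym/orbit_cluster; case: (orepP sstar i). Qed.

Definition specF (mu : 'I_n -> 'M[R]_n -> R) (Y : 'M[R]_n) : 'rV[R]_N' :=
  \row_l schur (cl (rep (eqpr l).1)) (conjp Y (mu (rep (eqpr l).1) Y)) (eqpr l).1 (eqpr l).2.

Lemma specFE mu Y l : specF mu Y 0 l =
  schur (cl (rep (eqpr l).1)) (conjp Y (mu (rep (eqpr l).1) Y)) (eqpr l).1 (eqpr l).2.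
Proof. by rewrite /specF [LHS]mxE. Qed.

Variables (rad : R) (R0 : 'I_n -> R) (mu : 'I_n -> 'M[R]_n -> R).
Hypothesis rad0 : 0 < rad.
Hypothesis data : forall r A, `|A - Xb| < rad ->
  [/\ `|mu r A - x 0 r| < R0 r, schur (cl r) (conjp A (mu r A)) r r = 0,
     forall t, `|t - x 0 r| <= R0 r -> schur (cl r) (conjp A t) r r = 0 -> t = mu r A,
     analytic_approx (mu r) A &
     forall t, `|t - x 0 r| <= R0 r -> bordm (cl r) (conjp A t) \in unitmx].
Hypothesis nradR : forall r, n%:R * rad <= R0 r.
Hypothesis nrade : n%:R * rad <= e.
Hypothesis gapR : forall r a, a \notin cl r -> R0 r + n%:R * rad < `|x 0 a - x 0 r|.

Lemma lambdaXb : is_lambda Xb x.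
Proof. by split => //; exists U. Qed.

Lemma lambda_near Y (y : 'rV[R]_n) : `|Y - Xb| < rad -> is_lambda Y y -> forall i, `|y 0 i - x 0 i| <= n%:R * rad.
Proof.
move=> YX ly; apply: (weyl ly lambdaXb) => a b; apply: (le_trans _ (ltW YX)).
by have := entry_le_mxnorm (Y - Xb) a b; rewrite !mxE.
Qed.

Lemma cl_id r : r \in cl r.
Proof. by rewrite inE. Qed.

(** A pair in [eq_pairs] witnesses a nontrivial orbit, by [i != k] or by [i != rep i]; such an orbit
    is a whole cluster. *)
Lemma cl_orbit i k a : (i, k) \in eq_pairs sstar -> a \in cl (rep i) -> a \in porbit sstar i.
Proof.
rewrite !inE /= rep_x => /and3P[ik kp kr] /eqP xa; have [ri _] := orepP sstar i.
have [eik|nik] := eqVneq i k; last exact: (cluster_orbit kp nik xa).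
by apply: (cluster_orbit ri _ xa); rewrite {1}eik.
Qed.

Lemma orbit_cl i a : a \in porbit sstar i -> a \in cl (rep i).
Proof. by move=> ai; rewrite inE rep_x (orbit_cluster ai). Qed.

(** The common eigenvalue on the orbit makes the whole Schur block vanish; in particular it is a
    root of the representative entry, hence equal to mu(Y). *)
Lemma specF_zero Y : `|Y - Xb| < rad -> lambda_inv D Y -> specF mu Y = 0.
Proof.
move=> YX [sY [y [ly /DE[yD _]]]]; apply/rowP => l; rewrite specFE [RHS]mxE.
have := eqprP l; case: (eqpr l) => i k /= ik.
have [m1 m2 m3 m4 m5] := data (rep i) YX.
have [_ [V [VV YE]]] := ly.
have kp : k \in porbit sstar i by move: ik; rewrite inE => /and3P[].
pose t := y 0 i.
have tr : `|t - x 0 (rep i)| <= R0 (rep i).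
  by rewrite rep_x; apply: (le_trans (lambda_near YX ly i)).
have [WW TE] := conjp_spectral t VV YE.
have S0 := eigen_schur0 (m5 t tr) WW TE.
have {}S0 : {in cl (rep i) &, forall a b, schur (cl (rep i)) (conjp Y t) a b = 0}.
  apply: S0 => a /(cl_orbit ik) ai; rewrite mxE /t.
  by rewrite (yD i a ai) subrr.
have <- : t = mu (rep i) Y by apply: m3 => //; apply: S0; exact: cl_id.
by apply: S0; apply: orbit_cl => //; exact: porbit_id.
Qed.

Lemma specF_zero_inv Y : `|Y - Xb| < rad -> Y^T = Y -> specF mu Y = 0 -> lambda_inv D Y.
Proof.
move=> YX sY FY; have [y ly] := spectral_decomposition sY.
have near_y := lambda_near YX ly.
split => //; exists y; split => //; apply/DE; split; last first.
  by apply: Be => i; exact: le_trans nrade.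
move=> i j ji; have [->//|ij] := eqVneq i j.
set r := rep i; have [m1 m2 m3 m4 m5] := data r YX.
have [_ [V [VV YE]]] := ly.
set t := mu r Y in m1 m2 *.
have clp a : a \in cl r -> a \in porbit sstar i.
  by rewrite inE rep_x => /eqP xa; exact: (cluster_orbit ji ij xa).
have S1 a b : a \in cl r -> b \in cl r -> (a <= b)%N -> schur (cl r) (conjp Y t) a b = 0.
  move=> /clp ai /clp bi ab; have ra : rep a = r by exact: orep_eq.
  (* Only the entry at the representative is missing among the equations; it vanishes by the
     definition of mu. *)
  have [br|br] := eqVneq b r.
    have [_ rmin] := orepP sstar i.
    have -> : a = r by apply/val_inj/eqP; rewrite eqn_leq rmin// andbT -br.
    by rewrite br.
  have ab_eq : (a, b) \in eq_pairs sstar.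
    by rewrite inE /= ab ra br andbT /= (porbit_eq ai).
  have [l le] := eqpr_surj ab_eq.
  by have /rowP/(_ l) := FY; rewrite specFE [RHS]mxE le /= ra.
have S0 : {in cl r &, forall a b, schur (cl r) (conjp Y t) a b = 0}.
  move=> a b ac bc; have [ab|/ltnW ba] := leqP a b; first exact: S1.
  by rewrite -(schur_tr (cl r) (conjp_sym t sY)) mxE S1.
have [WW TE] := conjp_spectral t VV YE.
have y0 := schur0_eigen (m5 t (ltW m1)) S0 WW TE.
have yt a : a \in cl r -> y 0 a = t.
  (* Eigenvalues with index outside the cluster cannot equal [t], because [gapR] keeps them apart;
     this is the side condition of [schur0_eigen]. *)
  move=> ac; apply/eqP; rewrite -subr_eq0; have := y0 _ a ac; rewrite mxE => -> // b bc.
  rewrite mxE subr_eq0; apply/eqP => yb; have := gapR bc; rewrite ltNge => /negP; apply.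
  have -> : x 0 b - x 0 r = (t - x 0 r) - (y 0 b - x 0 b) by rewrite yb; ring.
  by apply: (le_trans (ler_normB _ _)); apply: lerD; [exact: ltW|exact: near_y].
by rewrite !yt//; apply: orbit_cl => //; exact: porbit_id.
Qed.

Lemma specF_analytic A : `|A - Xb| < rad -> forall l, analytic_at (fun Y => specF mu Y 0 l) A.
Proof.
move=> AX l; apply: analytic_approx_at; under eq_fun do rewrite specFE.
apply: mx_analytic_schur; apply: mx_analyticD.
  apply: mx_analyticM; last exact: mx_analytic_cst.
  by apply: mx_analyticM; [exact: mx_analytic_cst|move=> a b; exact: analytic_approx_ent].
apply: mx_analyticN; apply: mx_analytic_scalar.
by have [] := data (rep (eqpr l).1) AX.
Qed.

Definition ordp (a b : 'I_n) : 'I_n * 'I_n := if (a <= b)%N then (a, b) else (b, a).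

Lemma ordpC a b : ordp a b = ordp b a.
Proof. by rewrite /ordp; case: ltngtP => // /val_inj ->. Qed.

Lemma ordp_eq_pairs a b : ordp a b \in eq_pairs sstar -> b \in porbit sstar a.
Proof.
rewrite /ordp; case: ifP => _; rewrite inE /= => /and3P[_ h _] //.
by rewrite porbit_sym.
Qed.

(** In the eigenbasis, take [S] block diagonal with zero entry at each representative. Along h S the
    root mu keeps its value at Xbar, and each component of [specF] is a determinant, nonzero at h =
    0, times h times an entry of [S]. *)
Lemma specF_derive (w : 'rV[R]_N') : exists2 H, @SymMx R n H & derive (specF mu) Xb H = w.
Proof.
pose T0 r := conjp Xb (x 0 r).
pose el l := \det (bordm (cl (rep (eqpr l).1)) (T0 (rep (eqpr l).1))).
have el0 l : el l != 0.
  have XX : `|Xb - Xb| < rad by rewrite subrr normr0.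
  have [_ _ _ _ m5] := data (rep (eqpr l).1) XX.
  have := m5 (x 0 (rep (eqpr l).1)); rewrite subrr normr0 => /(_ _)/wrap[].
    by apply: le_trans (nradR _); rewrite mulr_ge0// ltW.
  by rewrite unitmxE unitfE.
(* Compensates the determinant by which [schur] is scaled. *)
pose c l := w 0 l / el l.
pose S : 'M[R]_n := \matrix_(a, b) \sum_l (eqpr l == ordp a b)%:R * c l.
have S0 a b : ordp a b \notin eq_pairs sstar -> S a b = 0.
  move=> ab; rewrite mxE big1// => l _; case: eqP => [e'|_]; rewrite ?mul0r//.
  by move: ab; rewrite -e' eqprP.
have Sl l : S (eqpr l).1 (eqpr l).2 = c l.
  have : ((eqpr l).1 <= (eqpr l).2)%N by have := eqprP l; rewrite inE => /and3P[].
  rewrite mxE /ordp => ->; rewrite -surjective_pairing (bigD1 l)//= eqxx mul1r big1 ?addr0// => l' ll'.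
  by rewrite (inj_eq eqpr_inj) (negbTE ll') mul0r.
have sS : S^T = S by apply/matrixP => a b; rewrite !mxE; apply: eq_bigr => l _; rewrite ordpC.
clearbody S.
pose H := U^T *m S *m U.
have HS : U *m H *m U^T = S by rewrite /H !mulmxA UU mul1mx -mulmxA UU mulmx1.
exists H; first by rewrite /SymMx /= /H !trmx_mul trmxK sS mulmxA.
have Th (h : R) t : conjp (h *: H + Xb) t = h *: S + (diag_mx x - t%:M).
  by rewrite /conjp mulmxDr mulmxDl -scalemxAr -scalemxAl HS (conj_diag UU XbE) addrA.
have S_off a b : x 0 a != x 0 b -> S a b = 0.
  by move=> xab; apply: S0; apply: contra xab => /ordp_eq_pairs /orbit_cluster ->.
have FE (h : R) l : `|h *: H| < rad -> specF mu (h *: H + Xb) 0 l =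
    \det (bordm (cl (rep (eqpr l).1)) (conjp (h *: H + Xb) (x 0 (rep (eqpr l).1)))) * (h * c l).
  move=> hr; rewrite specFE -Sl; have := eqprP l; case: (eqpr l) => i k /= ik.
  set r := rep i.
  have hX : `|h *: H + Xb - Xb| < rad by rewrite addrK.
  have [_ _ m3 _ _] := data r hX.
  have row0 a b : a \in cl r -> b \notin cl r -> conjp (h *: H + Xb) (x 0 r) a b = 0.
    rewrite !inE => /eqP xa xb.
    have xab : x 0 a != x 0 b by rewrite xa eq_sym.
    have ab : a != b by apply: contraNneq xab => ->.
    by rewrite Th !mxE (negbTE ab) S_off// !mulr0n subr0 mulr0 addr0.
  have ent a b : x 0 a = x 0 r -> conjp (h *: H + Xb) (x 0 r) a b = h * S a b.
    by move=> xa; rewrite Th !mxE; case: (a == b); rewrite ?mulr1n ?mulr0n ?xa subrr addr0.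
  have ic : i \in cl r by apply: orbit_cl; exact: porbit_id.
  have xi : x 0 i = x 0 r by rewrite rep_x.
  (* The representative diagonal entry of [S] is zero, so [x 0 r] is still a root and uniqueness
     applies. *)
  have <- : x 0 r = mu r (h *: H + Xb).
    apply: m3; first by rewrite subrr normr0; apply: le_trans (nradR _); rewrite mulr_ge0// ltW.
    rewrite schur_block; last by move=> b; apply: row0; exact: cl_id.
    rewrite ent// S0 ?mulr0// /ordp leqnn inE /= orepK eqxx !andbF; done.
  by rewrite schur_block ?ent// => b; exact: row0.
have H1 : 0 < `|H| + 1 by rewrite ltr_wpDl.
have F0 : specF mu Xb = 0.
  apply/rowP => l; have := FE 0 l; rewrite scale0r normr0 add0r => ->//.
  by rewrite mul0r mulr0 mxE.
apply: (proj2 (derive_of_eps _)) => eps eps0.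
have [d d0 Hd] : exists2 d : R, 0 < d & forall l (h : R), `|h| < d ->
    `|c l| * `|el l - \det (bordm (cl (rep (eqpr l).1)) (conjp (h *: H + Xb) (x 0 (rep (eqpr l).1))))| < eps.
  apply: common_radius => [l d d' dd' K h hd|l]; first by apply: K; exact: lt_le_trans dd'.
  have c1 : 0 < `|c l| + 1 by rewrite ltr_wpDl.
  have [d d0 K] := det_bordm_eps (cl (rep (eqpr l).1)) (T0 (rep (eqpr l).1)) (divr_gt0 eps0 c1).
  have S1 : 0 < `|S| + 1 by rewrite ltr_wpDl.
  exists (d / (`|S| + 1)); first by rewrite divr_gt0.
  move=> h hd; have := K (conjp (h *: H + Xb) (x 0 (rep (eqpr l).1))).
  rewrite /T0 {1}Th conjpXb addrK normrZ => /(_ _)/wrap[].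
    by rewrite ltr_pdivlMr// in hd; apply: le_lt_trans hd; rewrite ler_wpM2l// lerDl.
  rewrite -conjpXb -/(T0 _) -/(el l) ltr_pdivlMr//; apply: le_lt_trans.
  by rewrite mulrC ler_wpM2l// lerDl.
exists (Num.min d (rad / (`|H| + 1))); first by rewrite lt_min d0 divr_gt0.
move=> h h0; rewrite lt_min => /andP[hd hrad].
have hH : `|h *: H| < rad.
  by rewrite ltr_pdivlMr// in hrad; rewrite normrZ; apply: le_lt_trans hrad; rewrite ler_wpM2l// lerDl.
apply: mxnorm_lt => // z l; rewrite ord1 F0 subr0 mxE [X in _ + X]mxE [in X in - X]mxE (FE h l hH).
have wl : w 0 l = c l * el l by rewrite /c divfK.
rewrite wl.
have -> (p q : R) : c l * p - h^-1 * (q * (h * c l)) = c l * (p - q) by field.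
by rewrite normrM; exact: Hd.
Qed.

End SpectralSet.

Lemma spectral_set_manifold (R : realType) (n m : nat) (sstar : 'S_n) (Xb : 'M[R]_n) (x : 'rV[R]_n)
    (D B : set 'rV[R]_n) (e : R) : is_lambda Xb x ->
  (forall i j, j \in porbit sstar i -> x 0 i = x 0 j) ->
  (forall i j k, j \in porbit sstar i -> i != j -> x 0 k = x 0 i -> k \in porbit sstar i) ->
  (m <= (n * n.+1)./2)%N -> ((n * n.+1)./2 - m = #|eq_pairs sstar|)%N ->
  (forall y, D y <-> Deltapp sstar y /\ B y) -> 0 < e ->
  (forall y : 'rV[R]_n, (forall i, `|y 0 i - x 0 i| <= e) -> B y) ->
  analytic_submanifold_Sn (lambda_inv D) m Xb.
Proof.
move=> [rx [U [UU XbE]]] oc co mN mE DE e0 Be.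
have [g g0 gap] := gap_exists x.
have g4 : 0 < g / 4 by rewrite divr_gt0.
(* A quarter of the spectral gap for the root and a quarter for Weyl's bound leave different
   clusters separated. *)
have [dd /choice[R0 /choice[mu Hmu]]] := choice (fun r => cluster_data UU XbE r g4).
have n0 : 0 < n.+1%:R :> R by [].
have [d d0 Hd] : exists2 d : R, 0 < d & forall r, d <= dd r.
  apply: common_radius => [r d d' dd' h|r]; first exact: le_trans h.
  by have [d0 _ _ _ _] := Hmu r; exists (dd r).
pose rad := Num.min d (Num.min (e / n.+1%:R) (g / 4 / n.+1%:R)).
have rad0 : 0 < rad by rewrite !lt_min d0 !divr_gt0.
have nn (q : R) : 0 < q -> rad <= q / n.+1%:R -> n%:R * rad <= q.
  move=> q0; rewrite ler_pdivlMr// => h; apply: le_trans h; rewrite mulrC ler_wpM2l ?(ltW rad0)//.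
  by rewrite ler_nat.
have nrade : n%:R * rad <= e by apply: nn => //; rewrite !ge_min lexx orbT.
have nradg : n%:R * rad <= g / 4 by apply: nn => //; rewrite !ge_min lexx !orbT.
have radd r : rad <= dd r by apply: le_trans (Hd r); rewrite ge_min lexx.
have nradR r : n%:R * rad <= R0 r.
  have [_ _ _ h _] := Hmu r; apply: le_trans h; rewrite ler_wpM2l//.
have gapR r a : a \notin cluster x r -> R0 r + n%:R * rad < `|x 0 a - x 0 r|.
  rewrite inE => /gap; have [_ _ h _ _] := Hmu r; clear -h nradg g0; lra.
have data r A : `|A - Xb| < rad ->
  [/\ `|mu r A - x 0 r| < R0 r, schur (cluster x r) (conjp U A (mu r A)) r r = 0,
     forall t, `|t - x 0 r| <= R0 r -> schur (cluster x r) (conjp U A t) r r = 0 -> t = mu r A,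
     analytic_approx (mu r) A &
     forall t, `|t - x 0 r| <= R0 r -> bordm (cluster x r) (conjp U A t) \in unitmx].
  by move=> Ar; have [_ _ _ _ h] := Hmu r; apply: h; exact: lt_le_trans (radd r).
split; first by move=> Y [].
split => //; exists [set Y | `|Y - Xb| < rad], (specF U x mE mu); split.
- rewrite openE => Y /= YX; apply/nbhs_mxP; exists (rad - `|Y - Xb|); first by rewrite subr_gt0.
  move=> Z ZY /=; rewrite -[Z](subrK Y) -addrA; apply: le_lt_trans (ler_normD _ _) _.
  by rewrite -ltrBrDr.
- by rewrite /= subrr normr0.
- by move=> A AX l; exact: (specF_analytic mE data AX l).
- move=> w; exact: (specF_derive UU XbE oc mE rad0 data nradR w).
- apply/seteqP; split => Y /=.
    move=> [LY YX]; split => //; split; first by case: LY.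
    exact: (specF_zero UU XbE oc co rx mE DE data nradR YX LY).
  move=> [YX [sY FY]]; split => //.
  exact: (specF_zero_inv UU XbE oc co rx DE Be data nrade gapR YX sY FY).
Qed.

Lemma prodball_near (R : realType) n (sstar : 'S_n) (x : 'rV[R]_n) (r1 r2 : R) : 0 < r1 -> 0 < r2 ->
  exists2 e : R, 0 < e & forall y : 'rV[R]_n, (forall i, `|y 0 i - x 0 i| <= e) -> prodball sstar x r1 r2 y.
Proof.
move=> r10 r20; pose r := Num.min r1 r2.
have r0 : 0 < r by rewrite lt_min r10.
have e0 : 0 < r / n.+1%:R by rewrite divr_gt0.
exists (r / n.+1%:R) => // y hy.
have key (P : pred 'I_n) (q : R) : r <= q -> \sum_(i | P i) (y 0 i - x 0 i) ^+ 2 < q ^+ 2.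
  move=> rq; apply: (@lt_le_trans _ _ (r ^+ 2)); last by rewrite lerXn2r ?nnegrE ?(ltW r0)// (le_trans (ltW r0)).
  apply: (@le_lt_trans _ _ (\sum_(i < n) (r / n.+1%:R) ^+ 2)).
    rewrite big_mkcond; apply: ler_sum => i _; case: (P i); last by rewrite exprn_ge0 ?(ltW e0).
    by rewrite -[leLHS]real_normK ?num_real// lerXn2r ?nnegrE ?(ltW e0).
  rewrite sumr_const card_ord expr_div_n -[ltLHS]mulr_natl mulrCA gtr_pMr ?exprn_gt0//.
  by rewrite ltr_pdivrMr ?exprn_gt0// mul1r -natrX ltr_nat; lia.
by split; apply: key; rewrite ge_min lexx ?orbT.
Qed.

Unset Implicit Arguments. Set Strict Implicit. Set Printing Implicit Defensive.

Theorem theorem4p16 (R : realType) (n d : nat) (M : set 'rV[R]_n)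
  (sstar s : 'S_n) (xbar : 'rV[R]_n) (delta delta1 delta2 : R) (nred : nat) :
  (* M: connected, locally symmetric C^2 submanifold of dimension d *)
  C2_submanifold M d -> connected M -> locally_symmetric M ->
  (* sstar is the characteristic permutation of M *)
  (exists y, exists2 rho : R, 0 < rho & M y /\ M `&` eball y rho `<=` Delta sstar) ->
  (* xbar in M cap Delta(s) *)
  M xbar -> Delta s xbar ->
  0 < delta ->
  (* B(xbar, delta) meets only strata Delta(s') with P(s') refining P(s) *)
  (forall (s' : 'S_n) y, eball xbar delta y -> Delta s' y ->
     forall i j, j \in porbit s' i -> j \in porbit s i) ->
  strongly_locally_symmetric (M `&` eball xbar delta) ->
  proj_diffeo M xbar delta ->
  0 < delta1 -> 0 < delta2 ->
  prodball sstar xbar delta1 delta2 `<=` eball xbar delta ->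
  (* n^red = dim N^red_M(xbar), N^red_M(xbar) = N_M(xbar) cap Delta(s)^{perp perp} *)
  subspace_dim (mfd_normal M xbar `&` Deltapp s) nred ->
  let kappa := #|[pred i | sstar i == i]| in
  let D := [set y | exists t, exists w,
               [/\ mfd_tangent M xbar t, (mfd_normal M xbar `&` Deltapp s) w & y = xbar + t + w]]
           `&` prodball sstar xbar delta1 delta2 in
  forall Xbar : 'M[R]_n, @SymMx R n Xbar -> is_lambda Xbar xbar ->
    exists m : nat,
      (m%:Z = ((n * n.+1)./2)%:Z + d%:Z + nred%:Z - kappa%:Z
              - (\sum_(I in porbits sstar | (1 < #|I|)%N) (#|I| * #|I|.+1)./2)%N%:Z)%R /\
      analytic_submanifold_Sn (lambda_inv D) m Xbar.
Proof.
move=> subM conM locM [y0 [rho rho0 [My0 Dy0]]] Mx Dx _ _ _ _ del10 del20 _ dimN kappa D Xbar _ lX.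
have char i j := char_perm_tangent subM locM conM rho0 My0 Dy0 Mx i j.
have h1 i j : j \in porbit sstar i -> xbar 0 i = xbar 0 j by have [] := char i j.
have h2 i j : j \in porbit sstar i -> forall v, mfd_tangent M xbar v -> v 0 i = v 0 j by have [] := char i j.
have h3 i j : j \notin porbit sstar i -> xbar 0 i = xbar 0 j ->
    mfd_tangent M xbar (delta_mx 0 i - delta_mx 0 j) by have [] := char i j.
have dims := tangent_normal_dim subM Mx Dx h1 h2 h3 dimN.
have cards := card_eq_pairs sstar.
have le := card_eq_pairs_le sstar.
have [e e0 He] := prodball_near sstar xbar del10 del20.
(* Truncation does not occur in this subtraction, by [card_eq_pairs_le]; the integer formula then
   follows from [dims] and [cards]. *)
exists ((n * n.+1)./2 - #|eq_pairs sstar|)%N; split.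
  move: dims cards le; rewrite -/kappa.
  move: (#|eq_pairs sstar|) (#|porbits sstar|) (\sum_(I in porbits sstar | _) _)%N ((n * n.+1)./2) => a b c N.
  by move: kappa => k; lia.
apply: (@spectral_set_manifold R n _ sstar Xbar xbar D (prodball sstar xbar delta1 delta2) e) => //.
- by move=> i j k; exact: (nontrivial_orbit_is_cluster h2 h3).
- exact: leq_subr.
- by rewrite subKn.
- move=> y; split=> [[ex By]|[Dy By]]; split => //.
    exact/(tangent_normal_sum subM Mx Dx h1 h2 h3).
  exact/(tangent_normal_sum subM Mx Dx h1 h2 h3).
Qed.
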